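(* Let $\pi:M\to B$ be a fiber bundle with $M$ a 5-dimensional manifold with volume form $\Omega$ and $B$ an oriented 2-manifold with area form $\omega$. Let $(\gamma,\kappa,\beta)$ be a Poisson triple on $M$, let $\mu\in\Gamma\mathbb V^\circ$ be a horizontal 1-form, and let $c\in C^\infty(M)$ be a Casimir function of $P_\beta$, i.e. $d_{0,1}c\wedge\beta=0$. Define $$\widetilde\gamma(X)=\gamma(X)+\mathbf i_{d_{0,1}\mu\wedge\beta}(Q_{\mathrm V}\wedge X)\quad (X \text{ a vector field on } M),\qquad \widetilde\kappa=\frac{\kappa}{1-\kappa(\varkappa_\mu-c)},\qquad \widetilde\beta=\beta .$$ Then, on the open subset $\{p\in M: 1-\kappa(p)(\varkappa_\mu(p)-c(p))\neq0\}$, $(\widetilde\gamma,\widetilde\kappa,\widetilde\beta)$ is again a Poisson triple.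
   Context: All objects are smooth. A fiber bundle $\pi:M\to B$ is a surjective submersion; $\mathbb V=\ker d\pi\subset TM$ is the vertical subbundle (rank 3 here). An Ehresmann connection is a bundle morphism $\gamma:TM\to\mathbb V$ with $\gamma|_{\mathbb V}=\mathrm{id}$; $\mathbb H=\ker\gamma$ is the horizontal subbundle, so $TM=\mathbb H\oplus\mathbb V$ and $T^*M=\mathbb V^\circ\oplus\mathbb H^\circ$ (annihilators). These splittings bigrade multivector fields and forms: a multivector field has bidegree $(p,q)$ if it is a section of $\wedge^p\mathbb H\otimes\wedge^q\mathbb V$, and a form has bidegree $(p,q)$ if it is a section of $\wedge^p\mathbb V^\circ\otimes\wedge^q\mathbb H^\circ$. The exterior differential splits as $d=d_{1,0}+d_{0,1}+d_{2,-1}$, where for a $(p,q)$-form $\alpha$, $d_{i,j}\alpha$ is the bidegree $(p+i,q+j)$ component of $d\alpha$ (depending on $\gamma$; write $d_{1,0}^\gamma$ for emphasis). For a vector field $u$ on $B$, $\mathrm{hor}^\gamma u$ is its $\gamma$-horizontal lift. Interior products: $\mathbf i_{X\wedge Y}=\mathbf i_X\circ\mathbf i_Y$ for vector fields acting on forms; similarly $\mathbf i_{\alpha\wedge\alpha'}=\mathbf i_\alpha\circ\mathbf i_{\alpha'}$ for 1-forms acting on multivector fields, with $\mathbf i_\alpha$ inserting $\alpha$ in the first slot. Let $\Omega^{\mathrm H}=\pi^*\omega$ and let $\Omega^{\mathrm V}\in\Gamma\wedge^3\mathbb H^\circ$ be the unique form with $\Omega=\Omega^{\mathrm H}\wedge\Omega^{\mathrm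 V}$. Let $Q_{\mathrm H}\in\Gamma\wedge^2\mathbb H$, $Q_{\mathrm V}\in\Gamma\wedge^3\mathbb V$ be determined by $\mathbf i_{Q_{\mathrm H}}\Omega^{\mathrm H}=1$, $\mathbf i_{Q_{\mathrm V}}\Omega^{\mathrm V}=1$ ($Q_{\mathrm V}$ does not depend on $\gamma$). Put $P_\beta=-\mathbf i_\beta Q_{\mathrm V}$, $\theta=-\mathbf i_{Q_{\mathrm V}}d_{1,0}\Omega^{\mathrm V}$, $\varrho=\mathbf i_{Q_{\mathrm H}}d_{2,-1}\Omega^{\mathrm V}$. A triple $(\gamma,\kappa,\beta)$, consisting of an Ehresmann connection $\gamma$, a smooth function $\kappa$ and $\beta\in\Gamma\mathbb H^\circ$, is a Poisson triple (relative to $(\Omega,\omega)$) if $$d_{0,1}\beta\wedge\beta=0,\quad \kappa\,(d_{1,0}\beta-\theta\wedge\beta)=0,\quad d_{0,1}\kappa\wedge\beta-\kappa^2\varrho=0,$$ all $\gamma$-dependent objects being taken with respect to the connection of the triple. The bracket of $P_\beta$ is $\{f_1,f_2\}_\beta=-Q_{\mathrm V}(\beta,df_1,df_2)=P_\beta(df_1,df_2)$. For a horizontal 1-form $\mu$, $\{\mu\wedge\mu\}_\beta$ is the 2-form of bidegree $(2,0)$ with $\{\mu\wedge\mu\}_\beta(Y_1,Y_2)=\{\mu(Y_1),\mu(Y_2)\}_\beta-\{\mu(Y_2),\mu(Y_1)\}_\beta$ for $Y_i=\mathrm{hor}^\gamma u_i$, $u_i$ vector fields on $B$. The function $\varkappa_\mu\in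 C^\infty(M)$ is defined by $$d_{1,0}^\gamma\mu+\tfrac12\{\mu\wedge\mu\}_\beta=\varkappa_\mu\,\Omega^{\mathrm H}.$$ *)

(* Defs.v *)
From HB Require Import structures.
From mathcomp Require Import all_boot all_order all_algebra all_fingroup.
From mathcomp Require Import all_classical all_reals all_analysis.
Import Order.TTheory GRing.Theory Num.Theory.
Import numFieldNormedType.Exports.

Set Implicit Arguments.
Unset Strict Implicit.
Unset Printing Implicit Defensive.

Local Open Scope classical_set_scope.
Local Open Scope ring_scope.

(* Tensors on a manifold are represented classically, by their components in
   the charts of an atlas (subject to the usual transformation laws).  Tangent
   vectors and covectors of R^n are both row vectors, paired by the dot
   product; a Jacobian acts on tangent vectors from the right. *)

Section Alternating.
Variables (R : realType) (n : nat).

Definition dotp (u v : 'rV[R]_n) : R := \sum_j u 0 j * v 0 j.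

Definition unitv (j : 'I_n) : 'rV[R]_n := delta_mx 0 j.

(* A k-form is an alternating map of k tangent vectors, a k-vector is an
   alternating map of k covectors. *)
Definition alt (k : nat) := ('I_k -> 'rV[R]_n) -> R.

Definition upd k (v : 'I_k -> 'rV[R]_n) (i : 'I_k) (u : 'rV[R]_n) :=
  fun j => if j == i then u else v j.

Definition alternating k (A : alt k) : Prop :=
  (forall v i a u w,
     A (upd v i (a *: u + w)) = a * A (upd v i u) + A (upd v i w)) /\
  (forall v i j, i != j -> v i = v j -> A v = 0).

(* Normalized so that (a /\ b)(X, Y) = a(X) b(Y) - a(Y) b(X) for 1-forms. *)
Definition wedge k l (A : alt k) (B : alt l) : alt (k + l) := fun v =>
  (k`! * l`!)%:R^-1 *
  \sum_(s : 'S_(k + l)) (-1) ^+ s *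
     (A (fun i => v (s (lshift l i))) * B (fun j => v (s (rshift k j)))).

(* Interior product of B by A, extended linearly from i_{X /\ Y} = i_X o i_Y,
   where i_X inserts X in the first slot: i_{X_1 /\ ... /\ X_k} B is
   B(X_k, ..., X_1, -), whence the reversal.  A is expanded in the standard
   basis as 1/k! times the sum of the A(e_I) e_{I 0} /\ ... /\ e_{I (k-1)}.
   Used both for k-vectors acting on forms and for k-forms acting on
   multivectors. *)
Definition iprod k l (A : alt k) (B : alt (k + l)) : alt l := fun w =>
  (k`!)%:R^-1 *
  \sum_(I : {ffun 'I_k -> 'I_n})
     A (fun i => unitv (I i)) *
     B (fun m => match fintype.split m with
                 | inl i => unitv (I (rev_ord i))
                 | inr j => w j
                 end).

Definition alt_of_row (v : 'rV[R]_n) : alt 1 := fun w => dotp v (w ord0).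
Definition row_of_alt (A : alt 1) : 'rV[R]_n := \row_j A (fun=> unitv j).

Definition args2 (u v : 'rV[R]_n) : 'I_2 -> 'rV[R]_n :=
  fun i => if i == ord0 then u else v.

(* Component of bidegree (p, k - p) of a k-form, for the decomposition
   X = (X - G X) + G X of tangent vectors. *)
Definition bicomp k (G : 'rV[R]_n -> 'rV[R]_n) (p : nat) (A : alt k) : alt k :=
  fun v => \sum_(S : {set 'I_k} | #|S| == p)
    A (fun i => if i \in S then v i - G (v i) else G (v i)).

End Alternating.

Section Local.
Variables (R : realType) (n : nat).

Definition partial (i : 'I_n) (f : 'rV[R]_n -> R) : 'rV[R]_n -> R :=
  fun x => 'D_(unitv R i) (f : 'rV[R]_n -> R^o) x.

Definition gradient (f : 'rV[R]_n -> R) (x : 'rV[R]_n) : 'rV[R]_n :=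
  \row_i partial i f x.

Fixpoint class_C (r : nat) (D : set 'rV[R]_n) (f : 'rV[R]_n -> R) : Prop :=
  (forall x, D x -> {for x, continuous f}) /\
  match r with
  | 0%N => True
  | r'.+1 => forall i,
      (forall x, D x -> derivable (f : 'rV[R]_n -> R^o) x (unitv R i)) /\
      class_C r' D (partial i f)
  end.

(* D is meant to be open. *)
Definition smooth_on (D : set 'rV[R]_n) (f : 'rV[R]_n -> R) : Prop :=
  forall r, class_C r D f.

Definition smooth_map m (D : set 'rV[R]_n) (f : 'rV[R]_n -> 'rV[R]_m) : Prop :=
  forall j, smooth_on D (fun x => f x 0 j).

Definition ext_diff k (a : 'rV[R]_n -> alt R n k) : 'rV[R]_n -> alt R n k.+1 :=
  fun x v => \sum_(i < k.+1) (-1) ^+ i *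
    'D_(v i) ((fun y => a y (fun j => v (lift i j))) : 'rV[R]_n -> R^o) x.

End Local.

Section Manifolds.
Variable R : realType.

Record chart (T : topologicalType) (n : nat) := Chart {
  cdom : set T;
  coord : T -> 'rV[R]_n;
  param : 'rV[R]_n -> T }.

Record manifold (n : nat) := Manifold {
  points :> topologicalType;
  atlas : set (chart points n);
  points_hausdorff : hausdorff_space points;
  points_second_countable : @second_countable points;
  atlas_cover : forall p : points, exists2 c, atlas c & cdom c p;
  cdom_open : forall c, atlas c -> open (cdom c);
  cimg_open : forall c, atlas c -> open (coord c @` cdom c);
  coordK : forall c p, atlas c -> cdom c p -> param c (coord c p) = p;
  coord_continuous :
    forall c p, atlas c -> cdom c p -> {for p, continuous (coord c)};
  param_continuous :
    forall c p, atlas c -> cdom c p -> {for coord c p, continuous (param c)};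
  atlas_compatible : forall c c', atlas c -> atlas c' ->
    smooth_map (coord c @` (cdom c `&` cdom c')) (coord c' \o param c) }.

End Manifolds.

Section Fields.
Variables (R : realType) (n : nat) (M : manifold R n).

Definition chart_at (p : M) : chart R M n := s2val (cid2 (atlas_cover p)).

Definition loc (U : set M) (c : chart R M n) : set 'rV[R]_n :=
  coord c @` (U `&` cdom c).

Definition field (X : Type) := chart R M n -> 'rV[R]_n -> X.

Definition on_charts (U : set M) (P : chart R M n -> 'rV[R]_n -> Prop) : Prop :=
  forall c x, atlas c -> loc U c x -> P c x.

(* P c c' x x' J: the point of U has coordinates x in c and x' in c', and J is
   the Jacobian at x of the change of coordinates from c to c'. *)
Definition on_overlaps (U : set M)
    (P : chart R M n -> chart R M n -> 'rV[R]_n -> 'rV[R]_n ->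
         'M[R]_n -> Prop) : Prop :=
  forall c c' p, atlas c -> atlas c' -> U p -> cdom c p -> cdom c' p ->
    P c c' (coord c p) (coord c' p) ('J (coord c' \o param c) (coord c p)).

Definition smooth_fun (U : set M) (f : M -> R) : Prop :=
  forall c, atlas c -> smooth_on (loc U c) (f \o param c).

Definition vector_field (U : set M) (Y : field 'rV[R]_n) : Prop :=
  (forall c, atlas c -> smooth_map (loc U c) (Y c)) /\
  on_overlaps U (fun c c' x x' J => Y c' x' = Y c x *m J).

Definition diff_form k (U : set M) (a : field (alt R n k)) : Prop :=
  [/\ on_charts U (fun c x => alternating (a c x)),
      forall c v, atlas c -> smooth_on (loc U c) (fun x => a c x v) &
      on_overlaps U (fun c c' x x' J =>
        forall v, a c x v = a c' x' (fun i => v i *m J))].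

Definition multivector_field k (U : set M) (Q : field (alt R n k)) : Prop :=
  [/\ on_charts U (fun c x => alternating (Q c x)),
      forall c v, atlas c -> smooth_on (loc U c) (fun x => Q c x v) &
      on_overlaps U (fun c c' x x' J =>
        forall v, Q c' x' v = Q c x (fun i => v i *m J^T))].

(* Such a form also orients the manifold, so no separate orientation is
   carried. *)
Definition volume_form (a : field (alt R n n)) : Prop :=
  diff_form setT a /\ on_charts setT (fun c x => exists v, a c x v != 0).

Definition form0 (f : M -> R) : field (alt R n 0) := fun c x _ => f (param c x).

Definition ext_diff_field k (a : field (alt R n k)) : field (alt R n k.+1) :=
  fun c => ext_diff (a c).

(* Components of d relative to the fibrewise projection g; the integer p is
   the first index of the bidegree (p, k - p) of the k-form a. *)
Definition d10 (g : field ('rV[R]_n -> 'rV[R]_n)) k (p : nat)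
    (a : field (alt R n k)) : field (alt R n k.+1) :=
  fun c x => bicomp (g c x) p.+1 (ext_diff_field a c x).

Definition d01 (g : field ('rV[R]_n -> 'rV[R]_n)) k (p : nat)
    (a : field (alt R n k)) : field (alt R n k.+1) :=
  fun c x => bicomp (g c x) p (ext_diff_field a c x).

Definition d2m1 (g : field ('rV[R]_n -> 'rV[R]_n)) k (p : nat)
    (a : field (alt R n k)) : field (alt R n k.+1) :=
  fun c x => bicomp (g c x) p.+2 (ext_diff_field a c x).

End Fields.

Section Bundles.
Variables (R : realType) (n m : nat) (M : manifold R n) (B : manifold R m).
Variable proj : M -> B.

(* Differential of proj at the point of coordinates x in c, expressed in the
   chart of B selected around its image; none of the notions below depends on
   this selection. *)
Definition dproj (c : chart R M n) (x : 'rV[R]_n) : 'M[R]_(n, m) :=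
  'J (coord (chart_at (proj (param c x))) \o proj \o param c) x.

Definition base_value X (u : field B X) (c : chart R M n) (x : 'rV[R]_n) : X :=
  let q := proj (param c x) in u (chart_at q) (coord (chart_at q) q).

Definition fiber_bundle : Prop :=
  [/\ continuous proj,
      forall c b, atlas c -> atlas b ->
        smooth_map (coord c @` (cdom c `&` proj @^-1` cdom b))
          (coord b \o proj \o param c),
      forall q, exists p, proj p = q &
      on_charts setT (fun c x => row_full (dproj c x))].

Definition pullback k (w : field B (alt R m k)) : field M (alt R n k) :=
  fun c x v => base_value w c x (fun i => v i *m dproj c x).

Definition vertical (c : chart R M n) (x v : 'rV[R]_n) : Prop :=
  v *m dproj c x = 0.

Definition connection (U : set M) (g : field M ('rV[R]_n -> 'rV[R]_n)) : Prop :=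
  [/\ on_charts U (fun c x => forall a u v,
        g c x (a *: u + v) = a *: g c x u + g c x v),
      forall c v, atlas c -> smooth_map (loc U c) (fun x => g c x v),
      on_overlaps U (fun c c' x x' J =>
        forall v, g c x v *m J = g c' x' (v *m J)),
      on_charts U (fun c x => forall v, vertical c x (g c x v)) &
      on_charts U (fun c x => forall v, vertical c x v -> g c x v = v)].

(* Sections of the exterior powers of the annihilators of V = ker d(proj)
   and of H = ker g. *)
Definition annihilates_V k (U : set M) (a : field M (alt R n k)) : Prop :=
  on_charts U (fun c x => forall v i, vertical c x (v i) -> a c x v = 0).

Definition annihilates_H (g : field M ('rV[R]_n -> 'rV[R]_n)) k (U : set M)
    (a : field M (alt R n k)) : Prop :=
  on_charts U (fun c x => forall v i, g c x (v i) = 0 -> a c x v = 0).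

(* A k-vector lies in the k-th exterior power of a subspace W iff it vanishes
   as soon as one of its arguments annihilates W. *)
Definition tangent_to_V k (U : set M) (Q : field M (alt R n k)) : Prop :=
  on_charts U (fun c x => forall h i,
    (forall v, vertical c x v -> dotp v (h i) = 0) -> Q c x h = 0).

Definition tangent_to_H (g : field M ('rV[R]_n -> 'rV[R]_n)) k (U : set M)
    (Q : field M (alt R n k)) : Prop :=
  on_charts U (fun c x => forall h i,
    (forall v, g c x v = 0 -> dotp v (h i) = 0) -> Q c x h = 0).

(* Y is the g-horizontal lift, over the preimage of W, of the vector field u
   on W. *)
Definition horizontal_lift (g : field M ('rV[R]_n -> 'rV[R]_n)) (W : set B)
    (u : field B 'rV[R]_m) (Y : field M 'rV[R]_n) : Prop :=
  on_charts (proj @^-1` W) (fun c x =>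
    g c x (Y c x) = 0 /\ Y c x *m dproj c x = base_value u c x).

End Bundles.

Section PoissonTriples.
Variables (R : realType) (M : manifold R 5) (B : manifold R 2) (proj : M -> B).
Variables (Omega : field M (alt R 5 5)) (omega : field B (alt R 2 2)).

Notation OmegaH := (pullback proj omega).

Definition is_OmegaV (U : set M) (g : field M ('rV[R]_5 -> 'rV[R]_5))
    (OV : field M (alt R 5 3)) : Prop :=
  [/\ diff_form U OV, annihilates_H g U OV &
      on_charts U (fun c x => forall v,
        Omega c x v = wedge (OmegaH c x) (OV c x) v)].

Definition is_QV (U : set M) (OV QV : field M (alt R 5 3)) : Prop :=
  [/\ multivector_field U QV, tangent_to_V proj U QV &
      on_charts U (fun c x => forall v,
        @iprod R 5 3 0 (QV c x) (OV c x) v = 1)].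

Definition is_QH (U : set M) (g : field M ('rV[R]_5 -> 'rV[R]_5))
    (QH : field M (alt R 5 2)) : Prop :=
  [/\ multivector_field U QH, tangent_to_H g U QH &
      on_charts U (fun c x => forall v,
        @iprod R 5 2 0 (QH c x) (OmegaH c x) v = 1)].

Definition theta (g : field M ('rV[R]_5 -> 'rV[R]_5))
    (OV QV : field M (alt R 5 3)) : field M (alt R 5 1) :=
  fun c x v => - @iprod R 5 3 1 (QV c x) (d10 g 0 OV c x) v.

Definition varrho (g : field M ('rV[R]_5 -> 'rV[R]_5))
    (OV : field M (alt R 5 3)) (QH : field M (alt R 5 2)) :
    field M (alt R 5 2) :=
  fun c x v => @iprod R 5 2 2 (QH c x) (d2m1 g 0 OV c x) v.

Definition poisson_triple (U : set M) (g : field M ('rV[R]_5 -> 'rV[R]_5))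
    (kappa : M -> R) (beta : field M (alt R 5 1)) : Prop :=
  [/\ connection proj U g, smooth_fun U kappa,
      diff_form U beta, annihilates_H g U beta &
      exists OV QV QH,
        [/\ is_OmegaV U g OV, is_QV U OV QV, is_QH U g QH &
          [/\ on_charts U (fun c x => forall v,
                wedge (d01 g 0 beta c x) (beta c x) v = 0),
              on_charts U (fun c x => forall v,
                kappa (param c x) *
                  (d10 g 0 beta c x v - wedge (theta g OV QV c x) (beta c x) v)
                  = 0) &
              on_charts U (fun c x => forall v,
                wedge (d01 g 0 (form0 kappa) c x) (beta c x) v
                  - kappa (param c x) ^+ 2 * varrho g OV QH c x v = 0)]]].

Definition P_ (QV : field M (alt R 5 3)) (beta : field M (alt R 5 1)) :
    field M (alt R 5 2) :=
  fun c x h => - @iprod R 5 1 2 (beta c x) (QV c x) h.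

Definition casimir (g : field M ('rV[R]_5 -> 'rV[R]_5))
    (beta : field M (alt R 5 1)) (f : M -> R) : Prop :=
  on_charts setT (fun c x => forall v,
    wedge (d01 g 0 (form0 f) c x) (beta c x) v = 0).

Definition bracket (QV : field M (alt R 5 3)) (beta : field M (alt R 5 1))
    (f1 f2 : field M R) : field M R :=
  fun c x => P_ QV beta c x (args2 (gradient (f1 c) x) (gradient (f2 c) x)).

Definition pairing (mu : field M (alt R 5 1)) (Y : field M 'rV[R]_5) :
    field M R := fun c x => mu c x (fun=> Y c x).

(* The form {mu /\ mu}_beta; the vector fields on B need only be defined on
   an open subset W, which makes no difference since the condition is local. *)
Definition is_bracket_form (g : field M ('rV[R]_5 -> 'rV[R]_5))
    (QV : field M (alt R 5 3)) (beta mu : field M (alt R 5 1))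
    (mm : field M (alt R 5 2)) : Prop :=
  [/\ diff_form setT mm, annihilates_V proj setT mm &
      forall (W : set B) u1 u2 Y1 Y2, open W ->
        vector_field W u1 -> vector_field W u2 ->
        horizontal_lift proj g W u1 Y1 -> horizontal_lift proj g W u2 Y2 ->
        on_charts (proj @^-1` W) (fun c x =>
          mm c x (args2 (Y1 c x) (Y2 c x)) =
            bracket QV beta (pairing mu Y1) (pairing mu Y2) c x
            - bracket QV beta (pairing mu Y2) (pairing mu Y1) c x)].

Definition is_varkappa (g : field M ('rV[R]_5 -> 'rV[R]_5))
    (QV : field M (alt R 5 3)) (beta mu : field M (alt R 5 1))
    (vk : M -> R) : Prop :=
  smooth_fun setT vk /\
  exists2 mm, is_bracket_form g QV beta mu mm &
    on_charts setT (fun c x => forall v,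
      d10 g 1 mu c x v + 2^-1 * mm c x v =
        vk (param c x) * OmegaH c x v).

Definition tilde_connection (g : field M ('rV[R]_5 -> 'rV[R]_5))
    (QV : field M (alt R 5 3)) (beta mu : field M (alt R 5 1)) :
    field M ('rV[R]_5 -> 'rV[R]_5) :=
  fun c x X => g c x X +
    row_of_alt (@iprod R 5 3 1 (wedge (d01 g 1 mu c x) (beta c x))
                               (wedge (QV c x) (alt_of_row X))).

Definition tilde_kappa (kappa vk f : M -> R) : M -> R :=
  fun p => kappa p / (1 - kappa p * (vk p - f p)).

End PoissonTriples.

(* Main.v *)
(** Around each point choose a commuting frame E_0, ..., E_4 with E_2, E_3, E_4
    vertical, and write Gam_i^a for the coefficients of the connection (so that
    h_i = E_i + sum_a Gam_i^a E_a is horizontal), rho = Omega^V(E_2, E_3, E_4),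
    w = Omega^H(E_0, E_1), beta_a = beta(E_a) and R = [h_0, h_1].  The three
    equations of a Poisson triple become beta . curl beta = 0,
      kappa (h_i beta_a + sum_b (E_a Gam_i^b) beta_b
             - (h_i rho / rho + sum_b E_b Gam_i^b) beta_a) = 0,
      d kappa x beta + kappa^2 (rho / w) R = 0.
    Passing from gamma to its modification adds to Gam_i the vertical field
    X_i = rho^-1 (beta x d mu_i), where mu_i = mu(E_i).  By the first equation,
    X_i preserves the pair (beta, rho) in the sense of the second equation,
    which is therefore inherited.  By the second equation, the bracket of h_i
    with the field of f is the field of h_i f, and by the first one the bracket
    of two such fields is the field of the bracket; hence R changes by the field
    of w varkappa_mu.  As 1 / kappa decreases by varkappa_mu - c and c is a
    Casimir function, the third equation is inherited as well. *)

From HB Require Import structures.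
From mathcomp Require Import all_boot all_order all_algebra all_fingroup.
From mathcomp Require Import all_classical all_reals all_analysis.
From mathcomp Require Import ring lra.
Require Import Defs.
Import Order.TTheory GRing.Theory Num.Theory.
Import numFieldNormedType.Exports.

Set Implicit Arguments.
Unset Strict Implicit.
Unset Printing Implicit Defensive.

Local Open Scope classical_set_scope.
Local Open Scope ring_scope.

(** * Smooth functions on open sets *)

(** The tensors of a triple are existentially quantified, so the [OmegaV] that normalizes [QV] and
    the one inside the given triple are a priori different. They are compared through rho: w rho is
    the value of Omega on the frame, hence rho is the same for every connection. The new Omega^V and
    Q_H must be global fields; they are transported from the old ones by the new vertical projection
    and by the transpose of the new horizontal one.

    The function kappa may vanish. At a zero of kappa the new kappa vanishes as well, and with it
    the curvature terms of the third equation. At any other point the second equation can be divided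
    by kappa, and the computation of the curvature uses it at that point only, never its
    derivatives.

    The frame needs no inverse function theorem: the Jacobian of the projection in charts is
    completed by constant columns, and the rows of the inverse matrix commute by symmetry of second
    derivatives.

    The reversal of arguments in [iprod] gives Q_V(eps_2, eps_3, eps_4) = -1/rho and Q_H(eps_0,
    eps_1) = -1/w; most signs below come from there. *)

Section Calculus.
Variables (R : realType) (n : nat).
Implicit Types (f g : 'rV[R]_n -> R^o) (x u v w : 'rV[R]_n) (D : set 'rV[R]_n).

Lemma line_derive f x v (s : R) : derivable f (x + s *: v) v ->
  is_derive s 1 (fun t : R => f (x + t *: v)) ('D_v f (x + s *: v)).
Proof.
move=> df; have e : (fun h : R => h^-1 *: (f (h *: v + (x + s *: v)) - f (x + s *: v)))
   = (fun h : R => h^-1 *: (f (x + (h *: 1 + s) *: v) - f (x + s *: v))).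
  by apply/funext => h; rewrite [h *: 1]mulr1 scalerDl addrCA.
by apply: DeriveDef; rewrite /derivable /derive /= -e.
Qed.

(** The one-dimensional mean value theorem for t -> f (x + t v), on [0, h] or on [h, 0]. Only a
    bound on the intermediate [s] is kept, so that the sign of [h] disappears. *)
Lemma mvt_line f x v (h : R) :
  (forall s : R, `|s| <= `|h| -> derivable f (x + s *: v) v) ->
  exists2 s : R, `|s| <= `|h| & f (x + h *: v) - f x = h * 'D_v f (x + s *: v).
Proof.
move=> df.
have dl (s : R) : `|s| <= `|h| ->
    is_derive s 1 (fun t : R => f (x + t *: v)) ('D_v f (x + s *: v)).
  by move=> /df; exact: line_derive.
have cl (a b : R) : (forall s : R, s \in `[a, b] -> `|s| <= `|h|) ->
    {within `[a, b]%classic, continuous (fun t : R => f (x + t *: v))}.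
  move=> ab; apply: derivable_within_continuous => s /ab/dl ds.
  exact: ex_derive.
case: (leP 0 h) => h0.
- have ab (s : R) : s \in `[0, h] -> `|s| <= `|h|.
    by rewrite in_itv/= => /andP[s0 sh]; rewrite !ger0_norm.
  have [s sab E] := MVT_segment h0 (fun s H => dl s (ab s (subset_itv_oo_cc H))) (cl _ _ ab).
  exists s; first exact: ab.
  by move: E; rewrite scale0r addr0 subr0 mulrC.
- have ab (s : R) : s \in `[h, 0] -> `|s| <= `|h|.
    by rewrite in_itv/= => /andP[s0 sh]; rewrite !ler0_norm ?lerN2// ltW.
  have [s sab E] := MVT_segment (ltW h0) (fun s H => dl s (ab s (subset_itv_oo_cc H))) (cl _ _ ab).
  exists s; first exact: ab.
  apply: oppr_inj; rewrite opprB; move: E; rewrite scale0r addr0 sub0r => ->.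
  by rewrite mulrC mulNr.
Qed.

Definition lcomb (a : 'I_n -> R) (v : 'rV[R]_n) : R^o := \sum_j v 0 j * a j.

Lemma lcomb_linear a : linear (lcomb a).
Proof.
move=> k u v; rewrite /lcomb scaler_sumr -big_split/=.
by apply: eq_bigr => j _; rewrite !mxE mulrDl -mulrA.
Qed.

Lemma lcomb_continuous a : continuous (lcomb a).
Proof.
move=> x; rewrite (_ : lcomb a = \sum_j (fun v : 'rV[R]_n => v 0 j * a j : R^o)).
  apply: differentiable_continuous; apply: differentiable_sum => j.
  by apply: differentiableM => //; exact: differentiable_coord.
by apply/funext => v; rewrite /lcomb fct_sumE.
Qed.

(** The estimate is a first-order expansion with remainder o(h), and uniqueness of such an expansion
    identifies the differential. *)
Lemma differentiable_lcomb f x (a : 'I_n -> R) :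
  (forall e, 0 < e -> \forall h \near (0 : 'rV[R]_n),
     `|f (x + h) - f x - lcomb a h| <= e * `|h|) ->
  differentiable f x /\ 'd f x = lcomb a :> ('rV[R]_n -> R^o).
Proof.
move=> H.
pose L : {linear 'rV[R]_n -> R^o} := HB.pack (lcomb a)
  (GRing.isLinear.Build _ _ _ _ _ (lcomb_linear a)).
have cL : continuous L by exact: lcomb_continuous.
have E : forall e : R, 0 < e -> \forall h \near nbhs (0 : 'rV[R]_n),
    `|(f \o shift x - (cst (f x) + (L : 'rV[R]_n -> R^o))) h| <= e * `|id h|.
  move=> e e0; near=> h.
  have -> : (f \o shift x - (cst (f x) + (L : 'rV[R]_n -> R^o))) h = f (x + h) - f x - lcomb a h.
    by rewrite /= !fctE /= opprD addrA [h + x]addrC.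
  by near: h; exact: H.
move/(@eqaddoP R _ R^o 'rV[R]_n (nbhs (0 : 'rV[R]_n))) : E => E.
have dE := @diff_unique R _ R^o f L x cL E.
split; last exact: dE.
apply/diff_locallyP; split; first by rewrite dE.
by rewrite dE.
Unshelve. all: by end_near. Qed.

(** The displacement [h] is carried out one coordinate at a time; this is the position reached after
    [k] steps. *)
Definition trunc (k : nat) (h : 'rV[R]_n) : 'rV[R]_n :=
  \row_j if (j < k)%N then h 0 j else 0.

Lemma trunc0 (h : 'rV[R]_n) : trunc 0 h = 0.
Proof. by apply/rowP => j; rewrite !mxE. Qed.

Lemma truncT (h : 'rV[R]_n) : trunc n h = h.
Proof. by apply/rowP => j; rewrite !mxE ltn_ord. Qed.

Lemma truncS (j : 'I_n) (h : 'rV[R]_n) : trunc j.+1 h = trunc j h + h 0 j *: unitv R j.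
Proof.
apply/rowP => k; rewrite !mxE ltnS eqxx /=.
case: (ltngtP k j) => kj /=.
- by rewrite -val_eqE/= (ltn_eqF kj) mulr0 addr0.
- by rewrite -val_eqE/= (gtn_eqF kj) mulr0 addr0.
- by rewrite (val_inj kj) eqxx mulr1 add0r.
Qed.

Lemma coord_le_norm (h : 'rV[R]_n) j : `|h 0 j| <= `|h|.
Proof.
rewrite [leRHS]/Num.Def.normr/= mx_normrE.
exact: (le_bigmax _ (fun ij : 'I_1 * 'I_n => `|h ij.1 ij.2|) (ord0, j)).
Qed.

Lemma norm_le_coord (h : 'rV[R]_n) e : 0 <= e -> (forall j, `|h 0 j| <= e) -> `|h| <= e.
Proof.
move=> e0 H; rewrite [leLHS]/Num.Def.normr/= mx_normrE bigmax_le// => -[i j] _ /=.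
by rewrite (ord1 i).
Qed.

Lemma trunc_shift_norm (j : 'I_n) (h : 'rV[R]_n) (s : R) : `|s| <= `|h 0 j| ->
  `|trunc j h + s *: unitv R j| <= `|h|.
Proof.
move=> sh; apply: norm_le_coord => // k; rewrite !mxE eqxx /=.
case: (ltngtP k j) => kj /=.
- by rewrite -val_eqE/= (ltn_eqF kj) mulr0 addr0 coord_le_norm.
- by rewrite -val_eqE/= (gtn_eqF kj) mulr0 addr0 normr0.
- by rewrite (val_inj kj) eqxx mulr1 add0r (le_trans sh) ?coord_le_norm.
Qed.

(** The increment telescopes over the displacements [trunc j h]. Each step moves one coordinate, so
    by the mean value theorem it is [h 0 j] times a partial derivative at a point near [x], which
    continuity compares with the value at [x]. *)
Lemma C1_differentiable f x :
  (\forall y \near x, forall i, derivable f y (unitv R i)) ->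
  (forall i, {for x, continuous (partial i f)}) ->
  differentiable f x /\ 'd f x = lcomb (fun i => partial i f x) :> ('rV[R]_n -> R^o).
Proof.
move=> df cf; apply: differentiable_lcomb => e e0.
(* The [n] coordinate steps share the tolerance [e]; the denominator [n.+1] also covers [n = 0]. *)
have e'0 : 0 < e / n.+1%:R by rewrite divr_gt0.
have : \forall y \near x, forall i, derivable f y (unitv R i) /\
    `|partial i f x - partial i f y| < e / n.+1%:R.
  near=> y => i; split; first by move: i; near: y; exact: df.
  move: i; near: y; apply: filter_forall => i.
  by have /cvgrPdist_lt := cf i; apply.
move=> /nbhs_ballP[d /= d0 Hd].
have HN : \forall h \near (0 : 'rV[R]_n), `|h| < d.
  apply/nbhs_ballP; exists d => //= h.
  by rewrite -ball_normE /= sub0r normrN.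
near=> h.
have hd : `|h| < d by near: h.
have Hd' u : `|u| <= `|h| -> ball x d (x + u).
  by move=> uh; rewrite -ball_normE /= opprD addrA subrr sub0r normrN (le_lt_trans uh).
have step (j : 'I_n) : `|f (x + trunc j.+1 h) - f (x + trunc j h) - h 0 j * partial j f x|
   <= `|h| * (e / n.+1%:R).
  have [|s sh E] := @mvt_line f (x + trunc j h) (unitv R j) (h 0 j).
    move=> s sh; rewrite -addrA.
    have /Hd/(_ j)[] // := Hd' _ (trunc_shift_norm sh).
  rewrite truncS addrA E -mulrBr normrM ler_pM//.
    exact: coord_le_norm.
  rewrite distrC ltW// -addrA.
  by have /Hd/(_ j)[] := Hd' _ (trunc_shift_norm sh).
have -> : f (x + h) - f x = \sum_(j < n) (f (x + trunc j.+1 h) - f (x + trunc j h)).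
  rewrite -(big_mkord xpredT (fun j => f (x + trunc j.+1 h) - f (x + trunc j h))).
  by rewrite (telescope_sumr (fun j => f (x + trunc j h)))// trunc0 truncT addr0.
rewrite /lcomb -sumrB (le_trans (ler_norm_sum _ _ _))//.
apply: le_trans (ler_sum _ (fun j _ => step j)) _.
rewrite sumr_const card_ord -[leLHS]mulr_natr -mulrA [leRHS]mulrC ler_wpM2l//.
by rewrite -mulrA ger_pMr// mulrC ler_pdivrMr// mul1r ler_nat.
Unshelve. all: by end_near. Qed.

End Calculus.

Lemma dist_half_trans (R : realFieldType) (a b c e : R) :
  `|a - b| < e / 2 -> `|c - b| < e / 2 -> `|a - c| <= e.
Proof. by rewrite ler_norml !ltr_norml => /andP[? ?] /andP[? ?]; apply/andP; split; lra. Qed.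

Section SmoothFunctions.
Variables (R : realType) (n : nat).
Implicit Types (f g : 'rV[R]_n -> R^o) (x u v w : 'rV[R]_n) (D : set 'rV[R]_n).

Lemma near_open D x : open D -> D x -> \forall y \near x, D y.
Proof. by move=> oD Dx; exact: open_nbhs_nbhs. Qed.

Lemma class_C_continuous r D f x : class_C r D f -> D x -> {for x, continuous f}.
Proof. by case: r => [|r] [cf _] /cf. Qed.

Lemma class_C_derivable r D f x i :
  class_C r.+1 D f -> D x -> derivable f x (unitv R i).
Proof. by move=> [_ /(_ i)[df _]] /df. Qed.

Lemma class_C_partial r D f i : class_C r.+1 D f -> class_C r D (partial i f).
Proof. by move=> [_ /(_ i)[]]. Qed.

Lemma class_C_pred r D f : class_C r.+1 D f -> class_C r D f.
Proof.
elim: r f => [f [cf _]|r IH f Cf]; first by split.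
split; first by move=> x; exact: class_C_continuous Cf.
move=> i; split; first by move=> x; exact: class_C_derivable Cf.
exact/IH/(class_C_partial i Cf).
Qed.

Lemma class_C_differentiable r D f x : open D -> class_C r.+1 D f -> D x ->
  differentiable f x /\ 'd f x = lcomb (fun i => partial i f x) :> ('rV[R]_n -> R^o).
Proof.
move=> oD Cf Dx; apply: C1_differentiable.
  near=> y => i; apply: class_C_derivable Cf _.
  by near: y; exact: near_open.
by move=> i; apply: class_C_continuous (class_C_partial i Cf) Dx.
Unshelve. all: by end_near. Qed.

Lemma partial_eq_near f g x i : (\forall y \near x, f y = g y) -> partial i f x = partial i g x.
Proof. by move=> fg; rewrite /partial (near_eq_derive _ fg). Qed.

Lemma continuous_eq_near f g x : (\forall y \near x, f y = g y) ->
  {for x, continuous f} -> {for x, continuous g}.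
Proof.
move=> fg cf; rewrite /prop_for /continuous_at -(nbhs_singleton fg).
exact: cvg_trans (near_eq_cvg fg) cf.
Qed.

(** Openness of [D] turns equality on [D] into equality near each point, which passes to partial
    derivatives. *)
Lemma class_C_eq r D f g : open D -> (forall x, D x -> f x = g x) ->
  class_C r D f -> class_C r D g.
Proof.
move=> oD; elim: r f g => [|r IH] f g fg Cf.
  split=> // x Dx; apply: continuous_eq_near (class_C_continuous Cf Dx).
  by near=> y; rewrite fg//; near: y; exact: near_open.
have fg' x : D x -> \forall y \near x, f y = g y.
  by move=> Dx; near=> y; apply: fg; near: y; exact: near_open.
split=> [x Dx|i].
  by apply: continuous_eq_near (class_C_continuous Cf Dx); exact: fg'.
split=> [x Dx|]; first by
  apply: (@near_eq_derivable R _ R^o f g); [exact: fg'|exact: class_C_derivable Cf Dx].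
apply: IH (class_C_partial i Cf) => x Dx; exact/partial_eq_near/fg'.
Unshelve. all: by end_near. Qed.

Lemma class_C_sub r D D' f : D' `<=` D -> class_C r D f -> class_C r D' f.
Proof.
move=> D'D; elim: r f => [|r IH] f Cf.
  by split=> // x /D'D; exact: class_C_continuous Cf.
split=> [x /D'D|i]; first exact: class_C_continuous Cf.
split=> [x /D'D|]; first exact: class_C_derivable Cf.
exact/IH/(class_C_partial i Cf).
Qed.

Lemma class_C_cst r D (a : R) : class_C r D (fun=> a).
Proof.
elim: r a => [|r IH] a; first by split=> // x _; exact: cst_continuous.
split=> [x _|i]; first exact: cst_continuous.
split=> [x _|]; first exact: derivable_cst.
rewrite (_ : partial i _ = fun=> 0)//; apply/funext => x.
by rewrite /partial derive_cst.
Qed.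

Lemma class_CD r D f g : open D -> class_C r D f -> class_C r D g ->
  class_C r D (fun x => f x + g x).
Proof.
move=> oD; elim: r f g => [|r IH] f g Cf Cg.
  split=> // x Dx.
  by apply: (@continuousD _ _ _ f g); [exact: class_C_continuous Cf Dx|exact: class_C_continuous Cg Dx].
split=> [x Dx|i].
  by apply: (@continuousD _ _ _ f g); [exact: class_C_continuous Cf Dx|exact: class_C_continuous Cg Dx].
split=> [x Dx|].
  by apply: derivableD; [exact: class_C_derivable Cf Dx|exact: class_C_derivable Cg Dx].
apply: (class_C_eq oD _ (IH _ _ (class_C_partial i Cf) (class_C_partial i Cg))).
move=> x Dx; rewrite /partial -deriveD//.
  exact: class_C_derivable Cf Dx.
exact: class_C_derivable Cg Dx.
Qed.

Lemma class_CM r D f g : open D -> class_C r D f -> class_C r D g ->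
  class_C r D (fun x => f x * g x).
Proof.
move=> oD; elim: r f g => [|r IH] f g Cf Cg.
  split=> // x Dx.
  by apply: (@continuousM _ _ f g); [exact: class_C_continuous Cf Dx|exact: class_C_continuous Cg Dx].
split=> [x Dx|i].
  by apply: (@continuousM _ _ f g); [exact: class_C_continuous Cf Dx|exact: class_C_continuous Cg Dx].
split=> [x Dx|].
  by apply: derivableM; [exact: class_C_derivable Cf Dx|exact: class_C_derivable Cg Dx].
have := class_CD oD (IH _ _ (class_C_pred Cf) (class_C_partial i Cg))
                     (IH _ _ (class_C_pred Cg) (class_C_partial i Cf)).
apply: class_C_eq => // x Dx; rewrite /partial -[LHS]/(f x *: _ + g x *: _) -deriveM//.
  exact: class_C_derivable Cf Dx.
exact: class_C_derivable Cg Dx.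
Qed.

Lemma class_CV r D f : open D -> (forall x, D x -> f x != 0) -> class_C r D f ->
  class_C r D (fun x => (f x)^-1).
Proof.
move=> oD f0; elim: r => [|r IH] Cf.
  split=> // x Dx.
  by apply: (@continuousV _ _ f); [exact: f0|exact: class_C_continuous Cf Dx].
split=> [x Dx|i].
  by apply: (@continuousV _ _ f); [exact: f0|exact: class_C_continuous Cf Dx].
split=> [x Dx|].
  by apply: derivableV; [exact: f0|exact: class_C_derivable Cf Dx].
(* A partial derivative of 1/f is the product of -1, 1/f, 1/f and a partial derivative of f, and the
   induction hypothesis applies to 1/f. *)
have C1 := IH (class_C_pred Cf).
have := class_CM oD (class_CM oD (class_CM oD (class_C_cst r D (-1)) C1) C1)
   (class_C_partial i Cf).
apply: class_C_eq => // x Dx; rewrite /partial deriveV//; last 2 first.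
  exact: f0.
  exact: class_C_derivable Cf Dx.
by rewrite -[_ *: _]/(_ * _) mulN1r mulNr -exprVn expr2 !mulNr.
Qed.

Lemma derivable_translate f x a v : derivable f (x + a) v ->
  is_derive x v (fun y => f (y + a)) ('D_v f (x + a)).
Proof.
move=> df; have e : (fun h : R => h^-1 *: (f (h *: v + (x + a)) - f (x + a)))
   = (fun h : R => h^-1 *: (f (h *: v + x + a) - f (x + a))).
  by apply/funext => h; rewrite addrA.
by apply: DeriveDef; rewrite /derivable /derive /= -e.
Qed.

(** The mean value theorem is used twice: along [e_i] for y -> f (y + h e_j) - f y, then along [e_j]
    for the partial derivative just obtained. The bound 2|h| allows a displacement in both
    directions. *)
Lemma second_difference D f x i j (h : R) : class_C 2 D f ->
  (forall u, `|u| <= 2 * `|h| -> D (x + u)) ->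
  exists2 u, `|u| <= 2 * `|h| &
    (f (x + h *: unitv R i + h *: unitv R j) - f (x + h *: unitv R i)) -
    (f (x + h *: unitv R j) - f x) = h * (h * partial j (partial i f) (x + u)).
Proof.
move=> Cf HD.
have nu (k : 'I_n) : `|unitv R k| <= 1.
  by apply: norm_le_coord => // l; rewrite !mxE eqxx/=; case: (_ == _); rewrite ?normr1 ?normr0.
have nZ (a b : R) (k : 'I_n) : `|a| <= b -> `|a *: unitv R k| <= b.
  by move=> ab; rewrite normrZ (le_trans _ ab)// ler_piMr.
have n2 (s t : R) : `|s| <= `|h| -> `|t| <= `|h| ->
    `|s *: unitv R i + t *: unitv R j| <= 2 * `|h|.
  by move=> sh th; rewrite (le_trans (ler_normD _ _))// mulr2n mulrDl mul1r lerD// nZ.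
have n1 (s : R) (k : 'I_n) : `|s| <= `|h| -> `|s *: unitv R k| <= 2 * `|h|.
  by move=> sh; rewrite nZ// (le_trans sh)// ler_peMl// ler1n.
pose g := (fun y => f (y + h *: unitv R j)) - f.
have dg (s : R) : `|s| <= `|h| -> is_derive (x + s *: unitv R i) (unitv R i) g
    (partial i f (x + s *: unitv R i + h *: unitv R j) - partial i f (x + s *: unitv R i)).
  move=> sh; apply: is_deriveB.
    apply: derivable_translate; rewrite -addrA.
    exact: class_C_derivable Cf (HD _ (n2 _ _ sh (lexx _))).
  apply: (@derivableP _ _ _ f); exact: class_C_derivable Cf (HD _ (n1 _ _ sh)).
have [s sh E] := @mvt_line _ _ g x (unitv R i) h (fun s sh => @ex_derive _ _ _ _ _ _ _ (dg s sh)).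
have [t th E'] : exists2 t : R, `|t| <= `|h| &
    partial i f (x + s *: unitv R i + h *: unitv R j) - partial i f (x + s *: unitv R i)
    = h * partial j (partial i f) (x + s *: unitv R i + t *: unitv R j).
  apply: mvt_line => t th; rewrite -addrA.
  exact: class_C_derivable (class_C_partial i Cf) (HD _ (n2 s t sh th)).
exists (s *: unitv R i + t *: unitv R j); first exact: n2.
by rewrite addrA -E' -(@derive_val _ _ _ _ _ _ _ (dg s sh)) -E.
Qed.

(** The second difference is symmetric in [i] and [j]. Its two expressions equate the mixed
    derivatives at two points near [x], possibly distinct, and continuity brings both back to
    [x]. *)
Lemma schwarz D f x i j : open D -> class_C 2 D f -> D x ->
  partial j (partial i f) x = partial i (partial j f) x.
Proof.
move=> oD Cf Dx; apply/eqP; rewrite -subr_eq0 -normr_le0.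
suff H (e : R) : 0 < e ->
    `|partial j (partial i f) x - partial i (partial j f) x| <= e.
  by apply/ler_addgt0Pr => e e0; rewrite add0r; exact: H.
move=> e0; have e20 : 0 < e / 2 by rewrite divr_gt0.
have cont (k l : 'I_n) : \forall y \near x,
    `|partial k (partial l f) x - partial k (partial l f) y| < e / 2.
  have /cvgrPdist_lt := class_C_continuous (class_C_partial k (class_C_partial l Cf)) Dx.
  exact.
have [d /= d0 Hd] :=
  (nbhs_ballP _ _).1 (filterI (near_open oD Dx) (filterI (cont j i) (cont i j))).
(* Displacements of norm at most 2|h| = d/2 then stay inside the ball of radius [d]. *)
pose h : R := d / 4.
have h0 : 0 < h by rewrite divr_gt0.
have Hb u : `|u| <= 2 * `|h| -> ball x d (x + u).
  rewrite -ball_normE /= opprD addrA subrr sub0r normrN => /le_lt_trans; apply.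
  by rewrite gtr0_norm// /h; lra.
have HD u : `|u| <= 2 * `|h| -> D (x + u) by move=> /Hb/Hd[].
have [u uh Eu] := second_difference i j Cf HD.
have [v vh Ev] := second_difference j i Cf HD.
have E : partial j (partial i f) (x + u) = partial i (partial j f) (x + v).
  have cancel (d1 d2 a b : R) : d1 = h * (h * a) -> d2 = h * (h * b) -> d1 = d2 -> a = b.
    by move=> -> -> /mulfI H; apply: (mulfI _ (H _)); rewrite gt_eqF.
  have swap (a b c d' : R) : a - b - (c - d') = a - c - (b - d') by ring.
  apply: cancel Eu Ev _; rewrite swap; congr (_ - _ - _); congr (f _); exact: addrAC.
have [_ [H1 _]] := Hd _ (Hb _ uh); have [_ [_ H2]] := Hd _ (Hb _ vh).
apply: dist_half_trans H1 _; rewrite E; exact: H2.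
Qed.

End SmoothFunctions.

(** * Jacobians and the chain rule *)

Section ChainRule.
Variable R : realType.

Lemma unitvE n (i j : 'I_n) : unitv R i 0 j = (j == i)%:R.
Proof. by rewrite mxE eqxx. Qed.

Lemma row_unitv n (v : 'rV[R]_n) : v = \sum_j v 0 j *: unitv R j.
Proof. by rewrite [LHS]row_sum_delta. Qed.

Lemma row_differentiable m n (phi : 'rV[R]_m -> 'rV[R]_n) x :
  (forall j, differentiable (fun y => phi y 0 j : R^o) x) -> differentiable phi x.
Proof.
move=> H; rewrite (_ : phi = \sum_j (fun y => phi y 0 j *: unitv R j)).
  by apply: differentiable_sum => j; exact: differentiableZl.
by apply/funext => y; rewrite fct_sumE [LHS]row_unitv.
Qed.

Lemma derive_coord m n (phi : 'rV[R]_m -> 'rV[R]_n) x v j : differentiable phi x ->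
  ('d phi x v) 0 j = 'D_v (fun y => phi y 0 j : R^o) x.
Proof.
move=> dphi; rewrite -(deriveE _ dphi).
by rewrite (derive_mx (@diff_derivable _ _ _ phi x v dphi)) mxE.
Qed.

Lemma jacobianE m n (phi : 'rV[R]_m -> 'rV[R]_n) x i j : differentiable phi x ->
  'J phi x i j = partial i (fun y => phi y 0 j) x.
Proof. by move=> dphi; rewrite mxE derive_coord. Qed.

#[local] Opaque diff derive jacobian.

Lemma derive_comp m n (f : 'rV[R]_n -> R) (phi : 'rV[R]_m -> 'rV[R]_n) x v :
  differentiable phi x -> differentiable (f : _ -> R^o) (phi x) ->
  'D_v (f \o phi : _ -> R^o) x =
  \sum_j 'D_v (fun y => phi y 0 j : R^o) x * partial j f (phi x).
Proof.
move=> dphi df; have dc := @differentiable_comp _ _ _ R^o phi f x dphi df.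
rewrite (deriveE v dc) (congr1 (@^~ v) (@diff_comp _ _ _ R^o phi f x dphi df)) /=.
rewrite [in LHS](row_unitv ('d phi x v)) linear_sum; apply: eq_bigr => j _.
by rewrite linearZ (derive_coord v j dphi) -(deriveE _ df).
Qed.

Lemma partial_comp m n (f : 'rV[R]_n -> R) (phi : 'rV[R]_m -> 'rV[R]_n) x i :
  differentiable phi x -> differentiable (f : _ -> R^o) (phi x) ->
  partial i (f \o phi) x =
  \sum_j partial i (fun y => phi y 0 j) x * partial j f (phi x).
Proof. exact: derive_comp. Qed.

Lemma differentiable_row_coord m n (phi : 'rV[R]_m -> 'rV[R]_n) x j :
  differentiable phi x -> differentiable (fun y => phi y 0 j : R^o) x.
Proof.
move=> dphi.
exact: (@differentiable_comp _ _ _ R^o phi (fun y => y 0 j)) dphi (differentiable_coord _ _ _).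
Qed.

Lemma jacobian_comp m n p (phi : 'rV[R]_m -> 'rV[R]_n) (psi : 'rV[R]_n -> 'rV[R]_p) x :
  differentiable phi x -> differentiable psi (phi x) ->
  'J (psi \o phi) x = 'J phi x *m 'J psi (phi x).
Proof.
move=> dphi dpsi; have dc := @differentiable_comp _ _ _ _ phi psi x dphi dpsi.
apply/matrixP => i k; rewrite [RHS]mxE (jacobianE i k dc).
have dk := differentiable_row_coord k dpsi.
rewrite (@partial_comp _ _ (fun y => psi y 0 k) phi x i dphi dk).
by apply: eq_bigr => j _; rewrite (jacobianE i j dphi) (jacobianE j k dpsi).
Qed.

Lemma jacobian_eq_near m n (phi psi : 'rV[R]_m -> 'rV[R]_n) x :
  differentiable phi x -> differentiable psi x -> (\forall y \near x, phi y = psi y) ->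
  'J phi x = 'J psi x.
Proof.
move=> dphi dpsi e; apply/matrixP => i j.
apply: (etrans (jacobianE i j dphi)); apply: (etrans _ (esym (jacobianE i j dpsi))).
apply: partial_eq_near; by apply: filterS e => y ->.
Qed.

Lemma jacobian_id n (x : 'rV[R]_n) : 'J id x = 1%:M.
Proof.
have did : differentiable (@id 'rV[R]_n) x by exact: ex_diff.
apply/matrixP => i j; rewrite (jacobianE i j did) /partial -(derive_coord _ _ did) -(deriveE _ did) derive_id !mxE.
by rewrite eqxx eq_sym.
Qed.

Lemma smooth_map_differentiable m n D (phi : 'rV[R]_m -> 'rV[R]_n) x :
  open D -> smooth_map D phi -> D x -> differentiable phi x.
Proof.
move=> oD sphi Dx; apply: row_differentiable => j.
exact: (class_C_differentiable oD (sphi j 1%N) Dx).1.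
Qed.

End ChainRule.

(** * Closure properties of smooth functions *)

Section SmoothClosure.
Variables (R : realType) (n : nat) (D : set 'rV[R]_n).
Hypothesis oD : open D.
Implicit Types (f g : 'rV[R]_n -> R).

Lemma smooth_eq f g : (forall x, D x -> f x = g x) -> smooth_on D f -> smooth_on D g.
Proof. by move=> fg sf r; exact: class_C_eq (sf r). Qed.

Lemma smooth_sub D' f : D' `<=` D -> smooth_on D f -> smooth_on D' f.
Proof. by move=> DD sf r; exact: class_C_sub (sf r). Qed.

Lemma smooth_cst a : smooth_on D (fun=> a).
Proof. by move=> r; exact: class_C_cst. Qed.

Lemma smoothD f g : smooth_on D f -> smooth_on D g -> smooth_on D (fun x => f x + g x).
Proof. by move=> sf sg r; exact: class_CD. Qed.

Lemma smoothM f g : smooth_on D f -> smooth_on D g -> smooth_on D (fun x => f x * g x).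
Proof. by move=> sf sg r; exact: class_CM. Qed.

Lemma smoothN f : smooth_on D f -> smooth_on D (fun x => - f x).
Proof.
move=> sf; apply: smooth_eq (smoothM (smooth_cst (-1)) sf) => x _.
by rewrite mulN1r.
Qed.

Lemma smoothB f g : smooth_on D f -> smooth_on D g -> smooth_on D (fun x => f x - g x).
Proof. by move=> sf sg; apply: smoothD sf (smoothN sg). Qed.

Lemma smoothV f : (forall x, D x -> f x != 0) -> smooth_on D f ->
  smooth_on D (fun x => (f x)^-1).
Proof. by move=> f0 sf r; exact: class_CV. Qed.

Lemma smooth_sum I (r : seq I) (P : pred I) (F : I -> 'rV[R]_n -> R) :
  (forall i, smooth_on D (F i)) -> smooth_on D (fun x => \sum_(i <- r | P i) F i x).
Proof.
move=> sF; elim: r => [|i r IH].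
  by apply: smooth_eq (smooth_cst 0) => x _; rewrite big_nil.
case Pi : (P i).
- by apply: smooth_eq (smoothD (sF i) IH) => x _; rewrite big_cons Pi.
- by apply: smooth_eq IH => x _; rewrite big_cons Pi.
Qed.

Lemma smooth_prod I (r : seq I) (P : pred I) (F : I -> 'rV[R]_n -> R) :
  (forall i, smooth_on D (F i)) -> smooth_on D (fun x => \prod_(i <- r | P i) F i x).
Proof.
move=> sF; elim: r => [|i r IH].
  by apply: smooth_eq (smooth_cst 1) => x _; rewrite big_nil.
case Pi : (P i).
- by apply: smooth_eq (smoothM (sF i) IH) => x _; rewrite big_cons Pi.
- by apply: smooth_eq IH => x _; rewrite big_cons Pi.
Qed.

Lemma smooth_partial i f : smooth_on D f -> smooth_on D (partial i f).
Proof. by move=> sf r; exact: class_C_partial (sf r.+1). Qed.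

Lemma smooth_differentiable f x : smooth_on D f -> D x -> differentiable (f : _ -> R^o) x.
Proof. by move=> sf Dx; exact: (class_C_differentiable oD (sf 1%N) Dx).1. Qed.

Lemma smooth_derivable f x v : smooth_on D f -> D x -> derivable (f : _ -> R^o) x v.
Proof. by move=> sf Dx; exact/diff_derivable/smooth_differentiable. Qed.

Lemma smooth_deriveE f x v : smooth_on D f -> D x ->
  'D_v (f : _ -> R^o) x = \sum_j v 0 j * partial j f x.
Proof.
move=> sf Dx; have [df E] := class_C_differentiable oD (sf 1%N) Dx.
by rewrite deriveE// E.
Qed.

Lemma smooth_det k (A : 'rV[R]_n -> 'M[R]_k) :
  (forall i j, smooth_on D (fun x => A x i j)) -> smooth_on D (fun x => \det (A x)).
Proof.
by move=> sA; apply: smooth_sum => s; apply: smoothM; [exact: smooth_cst|exact: smooth_prod].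
Qed.

(** Cramer's rule: the entries of the inverse are cofactors divided by the determinant. *)
Lemma smooth_invmx k (A : 'rV[R]_n -> 'M[R]_k) :
  (forall x, D x -> A x \in unitmx) ->
  (forall i j, smooth_on D (fun x => A x i j)) ->
  forall i j, smooth_on D (fun x => invmx (A x) i j).
Proof.
move=> uA sA i j; have sdA := smooth_det sA.
apply: (@smooth_eq (fun x => (\det (A x))^-1 * ((-1) ^+ (j + i) * \det (row' j (col' i (A x)))))).
  by move=> x Dx; rewrite /invmx uA// !mxE.
apply: smoothM; first by apply: smoothV => // x /uA; rewrite unitmxE unitfE.
apply: smoothM; first exact: smooth_cst.
apply: smooth_det => a b; apply: smooth_eq (sA (lift j a) (lift i b)) => x _.
by rewrite !mxE.
Qed.

End SmoothClosure.

Section SmoothComp.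
Variables (R : realType) (m n : nat).

(** The map [phi] is taken one class higher than [f] because its continuity is deduced from its
    differentiability, already at [r = 0]. *)
Lemma class_C_comp r D D' (f : 'rV[R]_n -> R) (phi : 'rV[R]_m -> 'rV[R]_n) :
  open D -> open D' -> (forall x, D x -> D' (phi x)) ->
  (forall j, class_C r.+1 D (fun x => phi x 0 j)) -> class_C r D' f ->
  class_C r D (f \o phi).
Proof.
move=> oD oD' DD'.
have cont r' (g : 'rV[R]_n -> R) : (forall j, class_C r'.+1 D (fun x => phi x 0 j)) ->
    class_C r' D' g -> forall x, D x -> {for x, continuous (g \o phi)}.
  move=> Cphi Cg x Dx; apply: continuous_comp.
    apply: differentiable_continuous; apply: row_differentiable => j.
    exact: (class_C_differentiable oD (Cphi j) Dx).1.
  exact: class_C_continuous Cg (DD' _ Dx).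
elim: r f => [|r IH] f Cphi Cf.
  by split=> //; exact: (cont 0%N).
have dphi x : D x -> differentiable phi x.
  by move=> Dx; apply: row_differentiable => j; exact: (class_C_differentiable oD (Cphi j) Dx).1.
have df x : D x -> differentiable (f : _ -> R^o) (phi x).
  by move=> /DD' Dx; exact: (class_C_differentiable oD' Cf Dx).1.
split=> [|i]; first exact: (cont r.+1).
split=> [x Dx|].
  by apply: diff_derivable; apply: differentiable_comp; [exact: dphi|exact: df].
have : class_C r D (fun x => \sum_j partial i (fun y => phi y 0 j) x * (partial j f \o phi) x).
  elim: (index_enum _) => [|j s IHs].
    by apply: class_C_eq (class_C_cst r D 0) => // x _; rewrite big_nil.
  have C1 : class_C r D (partial i (fun y => phi y 0 j)).
    exact/class_C_pred/(class_C_partial i (Cphi j)).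
  have C2 : class_C r D (partial j f \o phi).
    by apply: IH (class_C_partial j Cf) => k; exact/class_C_pred/Cphi.
  apply: class_C_eq (class_CD oD (class_CM oD C1 C2) IHs) => // x _.
  by rewrite big_cons.
apply: class_C_eq => // x Dx; rewrite partial_comp//; [exact: dphi|exact: df].
Qed.

Lemma smooth_comp D D' (f : 'rV[R]_n -> R) (phi : 'rV[R]_m -> 'rV[R]_n) :
  open D -> open D' -> (forall x, D x -> D' (phi x)) ->
  smooth_map D phi -> smooth_on D' f -> smooth_on D (f \o phi).
Proof. by move=> oD oD' DD' sphi sf r; apply: class_C_comp (sf r) => // j; exact: sphi. Qed.

End SmoothComp.

(** * Alternating forms *)

Section SumPerm.
Variable R : comNzRingType.

(** A permutation of n + 1 points is the image [j] of [i0] together with a permutation of the other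
    points. Injectivity and (n + 1)! = (n + 1) n! give the bijection. *)
Lemma sum_perm_lift n (i0 : 'I_n.+1) (F : 'S_n.+1 -> R) :
  \sum_s F s = \sum_j \sum_(s : 'S_n) F (lift_perm i0 j s).
Proof.
rewrite pair_big /= (reindex (fun p : 'I_n.+1 * 'S_n => lift_perm i0 p.1 p.2))//=.
apply: onW_bij; apply: inj_card_bij; last first.
  by rewrite card_prod !card_Sn card_ord factS.
move=> [j s] [j' s'] /= /permP e.
have ej : j = j' by have := e i0; rewrite !lift_perm_id.
rewrite -ej in e *; congr (_, _); apply/permP => k.
by have := e (lift i0 k); rewrite !lift_perm_lift => /lift_inj.
Qed.

End SumPerm.

Lemma sign_lift_perm (R : comNzRingType) k (i j : 'I_k.+1) (s : 'S_k) :
  (-1) ^+ lift_perm i j s = (-1) ^+ (i + j) * (-1) ^+ s :> R.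
Proof.
rewrite odd_lift_perm exprD -(signr_odd _ i) -(signr_odd _ j).
by move: (odd_perm s) => b; rewrite !signr_addb.
Qed.

Lemma sign_sq (R : comNzRingType) (b : bool) (x : R) : (-1) ^+ b * ((-1) ^+ b * x) = x.
Proof. by case: b; rewrite ?mul1r// !mulN1r opprK. Qed.

Section Multilinear.
Variables (R : realType) (n : nat).
Notation V := 'rV[R]_n.

(** Argument tuples are written as literal sequences, padded by 0; replacing one argument then
    computes as [set_nth]. *)
Definition argl k (s : seq V) : 'I_k -> V := fun i => nth 0 s i.

Lemma upd_argl k (s : seq V) (i : 'I_k) u :
  upd (@argl k s) i u = argl (set_nth 0 s i u).
Proof. by apply/funext => j; rewrite /upd /argl nth_set_nth /= -val_eqE. Qed.

Lemma upd_id k (v : 'I_k -> V) i : upd v i (v i) = v.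
Proof. by apply/funext => j; rewrite /upd; case: eqP => [->|]. Qed.

Section Alt.
Variables (k : nat) (A : alt R n k).
Hypothesis hA : alternating A.

Lemma alt_eq0 v i j : i != j -> v i = v j -> A v = 0.
Proof. exact: hA.2. Qed.

Lemma altP v i a u w : A (upd v i (a *: u + w)) = a * A (upd v i u) + A (upd v i w).
Proof. exact: hA.1. Qed.

Lemma alt_upd0 v i : A (upd v i 0) = 0.
Proof.
have := altP v i 1 0 0; rewrite scale1r addr0 mul1r => /eqP.
by rewrite -subr_eq0 opprD addrA subrr sub0r oppr_eq0 => /eqP.
Qed.

Lemma alt0 v i : v i = 0 -> A v = 0.
Proof. by move=> v0; rewrite -(upd_id v i) v0 alt_upd0. Qed.

Lemma altD v i u w : A (upd v i (u + w)) = A (upd v i u) + A (upd v i w).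
Proof. by rewrite -[u]scale1r altP mul1r scale1r. Qed.

Lemma altZ v i a u : A (upd v i (a *: u)) = a * A (upd v i u).
Proof. by rewrite -[a *: u]addr0 altP alt_upd0 addr0. Qed.

Lemma alt_sum v i (I : Type) (r : seq I) (P : pred I) (F : I -> V) :
  A (upd v i (\sum_(j <- r | P j) F j)) = \sum_(j <- r | P j) A (upd v i (F j)).
Proof.
elim: r => [|j r IH]; first by rewrite !big_nil alt_upd0.
by rewrite !big_cons; case: ifP => _; rewrite ?altD IH.
Qed.

(** Polarization: [f a b] is the value with [a] and [b] in the two slots, and f (v i + v j) (v i + v
    j) = 0 is expanded. *)
Lemma alt_tperm v i j : i != j -> A (fun l => v (tperm i j l)) = - A v.
Proof.
move=> ij; pose f a b := A (upd (upd v i a) j b).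
have U a b : upd (upd v i a) j b = upd (upd v j b) i a.
  apply/funext => l; rewrite /upd; case: (eqVneq l j) => [->|//].
  by rewrite eq_sym (negbTE ij).
have f0 a : f a a = 0.
  by apply: (@alt_eq0 _ i j) => //; rewrite /upd (negbTE ij) !eqxx.
have fl a a' b : f (a + a') b = f a b + f a' b by rewrite /f !U altD.
have fr a b b' : f a (b + b') = f a b + f a b' by rewrite /f altD.
have := f0 (v i + v j); rewrite fl !fr !f0 addr0 add0r => /eqP.
rewrite addrC addr_eq0 {1 2}/f.
have -> : upd (upd v i (v i)) j (v j) = v by rewrite !upd_id.
have -> : upd (upd v i (v j)) j (v i) = (fun l => v (tperm i j l)).
  apply/funext => l; rewrite /upd; case: tpermP => [->|->|/eqP /negbTE li /eqP /negbTE lj].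
  - by rewrite (negbTE ij) eqxx.
  - by rewrite eqxx.
  - by rewrite lj li.
by move=> /eqP.
Qed.

Lemma alt_perm v (s : 'S_k) : A (fun l => v (s l)) = (-1) ^+ s * A v.
Proof.
have [ts -> dts] := prod_tpermP s; elim: ts v dts => [|t ts IH] v /=.
  move=> _; rewrite big_nil odd_perm1 mul1r; congr A; apply/funext => l.
  by rewrite perm1.
move=> /andP[dt dts]; rewrite big_cons odd_permM odd_tperm dt signr_addb.
set p := (\prod_(t0 <- ts) _)%g.
have -> : (fun l => v ((tperm t.1 t.2 * p)%g l)) = (fun l => (v \o p) (tperm t.1 t.2 l)).
  by apply/funext => i; rewrite /= permM.
by rewrite alt_tperm// [A _](IH v dts) mulN1r mulNr.
Qed.

(* Applied to the difference of two top-degree forms that agree on a basis. *)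
Lemma alt_top_eq0 (b : 'I_k -> V) : (forall u, exists c, u = \sum_j c j *: b j) ->
  A b = 0 -> forall v, A v = 0.
Proof.
move=> hb Ab.
have H m v : (forall i : 'I_k, (m <= i)%N -> exists j, v i = b j) -> A v = 0.
  elim: m v => [|m IH] v hv.
    have /choice[J vJ] : forall i, exists j, v i = b j by move=> i; exact: hv.
    have -> : v = b \o J by apply/funext.
    have [/injectiveP Jinj|] := boolP (injectiveb J).
      rewrite (_ : b \o J = fun l => b (perm Jinj l)).
        by rewrite alt_perm Ab mulr0.
      by apply/funext => l; rewrite permE.
    by move=> /injectivePn[i [j ij Jij]]; apply: (@alt_eq0 _ i j) => //=; rewrite Jij.
  have [mk|km] := ltnP m k; last first.
    apply: IH => i mi; have := ltn_ord i.
    by rewrite ltnNge (leq_trans km mi).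
  have [c vm] := hb (v (Ordinal mk)).
  rewrite -(upd_id v (Ordinal mk)) vm alt_sum big1// => j _.
  rewrite altZ IH ?mulr0// => i mi; rewrite /upd; case: eqP => [_|/eqP im]; first by exists j.
  by apply: hv; rewrite ltn_neqAle mi andbT; apply: contraNneq im => mi'; apply/eqP/val_inj.
by move=> v; apply: (H k) => i; rewrite leqNgt ltn_ord.
Qed.

End Alt.

Section Wedge.
Variables (k l : nat) (A : alt R n k) (B : alt R n l).
Hypotheses (hA : alternating A) (hB : alternating B).

Lemma alternating_wedge : alternating (wedge A B).
Proof.
split=> [v i a u w|v i j ij vij].
  rewrite /wedge mulrCA -mulrDr; congr (_ * _); rewrite mulr_sumr -big_split/=.
  apply: eq_bigr => s _; rewrite [a * _]mulrCA -mulrDr; congr (_ * _).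
  have out m (f : 'I_m -> 'I_(k + l)) (x : V) : (forall p, s (f p) != i) ->
      (fun p => upd v i x (s (f p))) = (fun p => v (s (f p))).
    by move=> H; apply/funext => p; rewrite /upd (negbTE (H p)).
  have inn m (f : 'I_m -> 'I_(k + l)) (x : V) q : injective f -> s (f q) = i ->
      (fun p => upd v i x (s (f p))) = upd (fun p => v (s (f p))) q x.
    move=> fi H; apply/funext => p; rewrite /upd -H (inj_eq perm_inj) (inj_eq fi).
    by [].
  (* The argument [i] goes to exactly one of the two factors, decided by the preimage of [i] under
     [s]; the other factor does not see the update. *)
  case: (splitP (s^-1 i)%g) => q eq.
    have e : s (lshift l q) = i.
      by rewrite -[i in RHS](permKV s); congr (s _); apply: val_inj.
    have o p : s (rshift k p) != i.
      by rewrite -e (inj_eq perm_inj) eq_rlshift.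
    rewrite !(out _ (@rshift k l))// !(inn _ (@lshift k l) _ q)//; try exact: lshift_inj.
    by rewrite altP// mulrDl mulrA.
  have e : s (rshift k q) = i.
    by rewrite -[i in RHS](permKV s); congr (s _); apply: val_inj.
  have o p : s (lshift l p) != i.
    by rewrite -e (inj_eq perm_inj) eq_lrshift.
  rewrite !(out _ (@lshift k l))// !(inn _ (@rshift k l) _ q)//; try exact: rshift_inj.
  by rewrite altP// mulrDr mulrCA.
rewrite /wedge; set S := \sum_s _; suff -> : S = 0 by rewrite mulr0.
have : S = - S.
  (* Composing with the transposition of [i] and [j] reverses the sign of every permutation and
     changes no argument, since [v i = v j]. *)
  rewrite {1}/S (reindex_inj (mulIg (tperm i j))) /= -sumrN; apply: eq_bigr => s _.
  rewrite odd_permM odd_tperm ij signr_addb mulrN1 mulNr.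
  have vt p : v ((s * tperm i j)%g p) = v (s p).
    by rewrite permM; case: tpermP => // ->.
  congr (- (_ * (_ * _))); [congr A|congr B]; apply/funext => p; exact: vt.
by move=> /eqP; rewrite -subr_eq0 opprK -mulr2n mulrn_eq0 => /eqP.
Qed.

End Wedge.

Lemma alternating_sub k (A B : alt R n k) : alternating A -> alternating B ->
  alternating (fun v => A v - B v).
Proof.
move=> hA hB; split=> [v i a u w|v i j ij vij].
  by rewrite !altP// mulrBr opprD addrACA.
by rewrite (alt_eq0 hA ij vij) (alt_eq0 hB ij vij) subrr.
Qed.

(** Permutations are grouped by the image [j] of the last slot; the k! members of a group contribute
    equally because [A] is alternating. *)
Lemma sum_last_perm k (A : alt R n k) (b : V -> R) (v : 'I_k.+1 -> V) : alternating A ->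
  \sum_(s : 'S_k.+1) (-1) ^+ s * (A (fun i => v (s (lift ord_max i))) * b (v (s ord_max)))
  = (k`!)%:R * \sum_(j < k.+1) (-1) ^+ (k + j) * (A (fun i => v (lift j i)) * b (v j)).
Proof.
move=> hA; rewrite (sum_perm_lift ord_max) mulr_sumr; apply: eq_bigr => j _.
rewrite (eq_bigr (fun=> (-1) ^+ (k + j) * (A (fun i => v (lift j i)) * b (v j)))).
  by rewrite sumr_const [RHS]mulr_natl -card_Sn.
move=> s _; rewrite lift_perm_id.
rewrite (_ : (fun i => _) = fun i => (v \o lift j) (s i)); last first.
  by apply/funext => i; rewrite /= lift_perm_lift.
by rewrite alt_perm// sign_lift_perm -!mulrA sign_sq.
Qed.

(** The same grouping, now by the images of the first two slots. The index [j] numbers the points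
    left once [i] is removed, whence [lift i j]. *)
Lemma sum_first_two_perm k (a : V -> V -> R) (B : alt R n k) (v : 'I_k.+2 -> V) :
  alternating B ->
  \sum_(s : 'S_k.+2) (-1) ^+ s *
    (a (v (s ord0)) (v (s (lift ord0 ord0))) * B (fun i => v (s (lift ord0 (lift ord0 i)))))
  = (k`!)%:R * \sum_(i < k.+2) \sum_(j < k.+1) (-1) ^+ (i + j) *
     (a (v i) (v (lift i j)) * B (fun p => v (lift i (lift j p)))).
Proof.
move=> hB; rewrite (sum_perm_lift ord0) mulr_sumr; apply: eq_bigr => i _.
rewrite (sum_perm_lift ord0) mulr_sumr; apply: eq_bigr => j _.
rewrite (eq_bigr (fun=> (-1) ^+ (i + j) *
     (a (v i) (v (lift i j)) * B (fun p => v (lift i (lift j p)))))).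
  by rewrite sumr_const [RHS]mulr_natl -card_Sn.
move=> s _; rewrite !lift_perm_id !lift_perm_lift !lift_perm_id.
have -> : B (fun p => v (lift_perm ord0 i (lift_perm ord0 j s) (lift ord0 (lift ord0 p))))
    = (-1) ^+ s * B (fun p => v (lift i (lift j p))).
  rewrite -[RHS](alt_perm hB (fun p => v (lift i (lift j p)))); congr B.
  by apply/funext => p; rewrite !lift_perm_lift.
rewrite !sign_lift_perm !add0n exprD -!mulrA.
by do 2!congr (_ * _); rewrite [a _ _ * _]mulrCA sign_sq.
Qed.

End Multilinear.

Ltac argl_ext := apply/funext => -[[|[|[|[|[|m]]]]] hm]; by [].

(** * Forms of degree one, two and three on explicit arguments *)

Section SmallForms.
Variables (R : realType) (n : nat).
Notation V := 'rV[R]_n.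
Notation "\< s \>" := (argl s) (format "\<  s  \>").

Lemma argl1E (v : 'I_1 -> V) : v = argl [:: v ord0].
Proof. by apply/funext => i; rewrite ord1. Qed.

Lemma argl1_cst (u : V) : (fun=> u) = argl [:: u] :> ('I_1 -> V).
Proof. by apply/funext => i; rewrite ord1. Qed.

Lemma argl2E (v : 'I_2 -> V) : exists a b, v = argl [:: a; b].
Proof.
exists (v ord0), (v (lift ord0 ord0)).
by apply/funext => -[[|[|m]] hm]//=; rewrite /argl /=; congr v; apply: val_inj.
Qed.

Lemma argl3E (v : 'I_3 -> V) : exists a b c, v = argl [:: a; b; c].
Proof.
exists (v ord0), (v (lift ord0 ord0)), (v (lift ord0 (lift ord0 ord0))).
by apply/funext => -[[|[|[|m]]] hm]//=; rewrite /argl /=; congr v; apply: val_inj.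
Qed.

Lemma argl4E (v : 'I_4 -> V) : exists a b c d, v = argl [:: a; b; c; d].
Proof.
exists (v ord0), (v (lift ord0 ord0)), (v (lift ord0 (lift ord0 ord0))), (v ord_max).
by apply/funext => -[[|[|[|[|m]]]] hm]//=; rewrite /argl /=; congr v; apply: val_inj.
Qed.

Lemma args2E (u v : V) : args2 u v = argl [:: u; v].
Proof. by apply/funext => -[[|[|m]] hm]. Qed.

Section OneForms.
Variable A : alt R n 1.
Hypothesis hA : alternating A.

Lemma form1P a u w : A (argl [:: a *: u + w]) = a * A (argl [:: u]) + A (argl [:: w]).
Proof.
have := altP hA (argl [:: 0]) ord0 a u w; rewrite !upd_argl /=.
exact.
Qed.

Lemma form1D u w : A (argl [:: u + w]) = A (argl [:: u]) + A (argl [:: w]).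
Proof. by rewrite -[u]scale1r form1P scale1r mul1r. Qed.

Lemma form1_0 : A (argl [:: 0]) = 0.
Proof. exact: (@alt0 _ _ _ _ hA _ ord0). Qed.

Lemma form1Z a u : A (argl [:: a *: u]) = a * A (argl [:: u]).
Proof. by rewrite -[a *: u]addr0 form1P form1_0 addr0. Qed.

Lemma form1N u : A (argl [:: - u]) = - A (argl [:: u]).
Proof. by rewrite -scaleN1r form1Z mulN1r. Qed.

Lemma form1_sum (I : Type) (r : seq I) (P : pred I) (F : I -> V) :
  A (argl [:: \sum_(j <- r | P j) F j]) = \sum_(j <- r | P j) A (argl [:: F j]).
Proof.
have E (u : V) : A (upd (argl [:: 0]) ord0 u) = A (argl (set_nth 0 [:: 0] 0 u)) by rewrite upd_argl.
by have := alt_sum hA (argl [:: 0]) ord0 r P F; rewrite E (eq_bigr _ (fun j _ => E (F j))).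
Qed.

Lemma form1E u : A (argl [:: u]) = dotp (row_of_alt A) u.
Proof.
rewrite [in LHS](row_unitv u) form1_sum; apply: eq_bigr => j _.
by rewrite form1Z mxE mulrC argl1_cst.
Qed.

End OneForms.

Section TwoForms.
Variable A : alt R n 2.
Hypothesis hA : alternating A.

Lemma form2_alt u : A (argl [:: u; u]) = 0.
Proof. exact: (@alt_eq0 _ _ _ _ hA _ ord0 (lift ord0 ord0)). Qed.

Lemma form2_Pl a u w x : A (argl [:: a *: u + w; x]) = a * A (argl [:: u; x]) + A (argl [:: w; x]).
Proof. by have := altP hA (argl [:: 0; x]) ord0 a u w; rewrite !upd_argl. Qed.

Lemma form2_Pr a u w x : A (argl [:: x; a *: u + w]) = a * A (argl [:: x; u]) + A (argl [:: x; w]).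
Proof. by have := altP hA (argl [:: x; 0]) (lift ord0 ord0) a u w; rewrite !upd_argl. Qed.

Lemma form2_0l x : A (argl [:: 0; x]) = 0.
Proof. exact: (@alt0 _ _ _ _ hA _ ord0). Qed.

Lemma form2_0r x : A (argl [:: x; 0]) = 0.
Proof. exact: (@alt0 _ _ _ _ hA _ (lift ord0 ord0)). Qed.

Lemma form2_Dl u w x : A (argl [:: u + w; x]) = A (argl [:: u; x]) + A (argl [:: w; x]).
Proof. by rewrite -[u]scale1r form2_Pl scale1r mul1r. Qed.

Lemma form2_Dr u w x : A (argl [:: x; u + w]) = A (argl [:: x; u]) + A (argl [:: x; w]).
Proof. by rewrite -[u]scale1r form2_Pr scale1r mul1r. Qed.

Lemma form2_Zl a u x : A (argl [:: a *: u; x]) = a * A (argl [:: u; x]).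
Proof. by rewrite -[a *: u]addr0 form2_Pl form2_0l addr0. Qed.

Lemma form2_Zr a u x : A (argl [:: x; a *: u]) = a * A (argl [:: x; u]).
Proof. by rewrite -[a *: u]addr0 form2_Pr form2_0r addr0. Qed.

Lemma form2_anti u w : A (argl [:: u; w]) = - A (argl [:: w; u]).
Proof.
have := form2_alt (u + w); rewrite form2_Dl !form2_Dr !form2_alt add0r addr0.
by move/eqP; rewrite addr_eq0 => /eqP.
Qed.

Lemma form2_suml (I : Type) (r : seq I) (P : pred I) (F : I -> V) x :
  A (argl [:: \sum_(j <- r | P j) F j; x]) = \sum_(j <- r | P j) A (argl [:: F j; x]).
Proof.
have E (u : V) : A (upd (argl [:: 0; x]) ord0 u) = A (argl (set_nth 0 [:: 0; x] 0 u)) by rewrite upd_argl.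
by have := alt_sum hA (argl [:: 0; x]) ord0 r P F; rewrite E (eq_bigr _ (fun j _ => E (F j))).
Qed.

Lemma form2_sumr (I : Type) (r : seq I) (P : pred I) (F : I -> V) x :
  A (argl [:: x; \sum_(j <- r | P j) F j]) = \sum_(j <- r | P j) A (argl [:: x; F j]).
Proof. by rewrite form2_anti form2_suml -sumrN; apply: eq_bigr => j _; rewrite -form2_anti. Qed.

End TwoForms.

Section ThreeForms.
Variable A : alt R n 3.
Hypothesis hA : alternating A.

Lemma form3_alt12 u x : A (argl [:: u; u; x]) = 0.
Proof. exact: (@alt_eq0 _ _ _ _ hA _ ord0 (lift ord0 ord0)). Qed.

Lemma form3_alt13 u x : A (argl [:: u; x; u]) = 0.
Proof. exact: (@alt_eq0 _ _ _ _ hA _ ord0 ord_max). Qed.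

Lemma form3_alt23 u x : A (argl [:: x; u; u]) = 0.
Proof. exact: (@alt_eq0 _ _ _ _ hA _ (lift ord0 ord0) ord_max). Qed.

Lemma form3_P1 a u w x y : A (argl [:: a *: u + w; x; y])
  = a * A (argl [:: u; x; y]) + A (argl [:: w; x; y]).
Proof. by have := altP hA (argl [:: 0; x; y]) ord0 a u w; rewrite !upd_argl. Qed.

Lemma form3_P2 a u w x y : A (argl [:: x; a *: u + w; y])
  = a * A (argl [:: x; u; y]) + A (argl [:: x; w; y]).
Proof. by have := altP hA (argl [:: x; 0; y]) (lift ord0 ord0) a u w; rewrite !upd_argl. Qed.

Lemma form3_P3 a u w x y : A (argl [:: x; y; a *: u + w])
  = a * A (argl [:: x; y; u]) + A (argl [:: x; y; w]).
Proof. by have := altP hA (argl [:: x; y; 0]) ord_max a u w; rewrite !upd_argl. Qed.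

Lemma form3_anti12 u w x : A (argl [:: u; w; x]) = - A (argl [:: w; u; x]).
Proof.
have := form3_alt12 (1 *: u + w) x; rewrite form3_P1 !form3_P2 !form3_alt12.
by rewrite !mul1r !add0r !addr0 => /eqP; rewrite addr_eq0 => /eqP.
Qed.

Lemma form3_anti23 u w x : A (argl [:: x; u; w]) = - A (argl [:: x; w; u]).
Proof.
have := form3_alt23 (1 *: u + w) x; rewrite form3_P2 !form3_P3 !form3_alt23.
by rewrite !mul1r !add0r !addr0 => /eqP; rewrite addr_eq0 => /eqP.
Qed.

Lemma form3_sum1 (I : Type) (r : seq I) (P : pred I) (F : I -> V) x y :
  A (argl [:: \sum_(j <- r | P j) F j; x; y]) = \sum_(j <- r | P j) A (argl [:: F j; x; y]).
Proof.
have E (u : V) : A (upd (argl [:: 0; x; y]) ord0 u) = A (argl (set_nth 0 [:: 0; x; y] 0 u)) by rewrite upd_argl.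
by have := alt_sum hA (argl [:: 0; x; y]) ord0 r P F; rewrite E (eq_bigr _ (fun j _ => E (F j))).
Qed.

Lemma form3_sum2 (I : Type) (r : seq I) (P : pred I) (F : I -> V) x y :
  A (argl [:: x; \sum_(j <- r | P j) F j; y]) = \sum_(j <- r | P j) A (argl [:: x; F j; y]).
Proof. by rewrite form3_anti12 form3_sum1 -sumrN; apply: eq_bigr => j _; rewrite -form3_anti12. Qed.

Lemma form3_sum3 (I : Type) (r : seq I) (P : pred I) (F : I -> V) x y :
  A (argl [:: x; y; \sum_(j <- r | P j) F j]) = \sum_(j <- r | P j) A (argl [:: x; y; F j]).
Proof. by rewrite form3_anti23 form3_sum2 -sumrN; apply: eq_bigr => j _; rewrite -form3_anti23. Qed.

Lemma form3_01 x y : A (argl [:: 0; x; y]) = 0.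
Proof. exact: (@alt0 _ _ _ _ hA _ ord0). Qed.

Lemma form3_D1 u w x y : A (argl [:: u + w; x; y]) = A (argl [:: u; x; y]) + A (argl [:: w; x; y]).
Proof. by rewrite -[u]scale1r form3_P1 scale1r mul1r. Qed.

Lemma form3_Z1 a u x y : A (argl [:: a *: u; x; y]) = a * A (argl [:: u; x; y]).
Proof. by rewrite -[a *: u]addr0 form3_P1 form3_01 addr0. Qed.

Lemma form3_Z2 a u x y : A (argl [:: x; a *: u; y]) = a * A (argl [:: x; u; y]).
Proof. by rewrite form3_anti12 form3_Z1 -mulrN -form3_anti12. Qed.

Lemma form3_Z3 a u x y : A (argl [:: x; y; a *: u]) = a * A (argl [:: x; y; u]).
Proof. by rewrite form3_anti23 form3_Z2 -mulrN -form3_anti23. Qed.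

End ThreeForms.

(** The term [T j] collects the permutations that hand the argument [j] to [B]; their number cancels
    the factorials in [wedge]. The expansions [wedge21] and [wedge31] are obtained in the same
    way. *)
Lemma wedge11 (A : alt R n 1) (B : alt R n 1) a b : alternating A ->
  wedge A B (argl [:: a; b]) = A (argl [:: a]) * B (argl [:: b]) - A (argl [:: b]) * B (argl [:: a]).
Proof.
move=> hA; set v := argl [:: a; b].
pose T (j : 'I_2) := (-1) ^+ (1 + j) *
  (A (fun i => v (lift j i)) * (fun u => B (argl [:: u])) (v j)).
have T0 : T ord0 = - (A (argl [:: b]) * B (argl [:: a])).
  rewrite /T -signr_odd /= expr1 mulN1r; congr (- (A _ * B _)); argl_ext.
have T1 : T (lift ord0 ord0) = (A (argl [:: a]) * B (argl [:: b])).
  rewrite /T -signr_odd /= expr0 mul1r; congr (A _ * B _); argl_ext.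
have -> : wedge A B v = \sum_j T j.
  have E : wedge A B v = (1`! * 1`!)%:R^-1 * \sum_(s : 'S_2) (-1) ^+ s *
      (A (fun i => v (s (lift ord_max i))) * (fun u => B (argl [:: u])) (v (s ord_max))).
    congr (_ * _); apply: eq_bigr => s _; congr (_ * (A _ * B _)); apply/funext => i.
      by congr (v (s _)); apply: val_inj; rewrite /= /bump leqNgt ltn_ord.
    by rewrite ord1; congr (v (s _)); apply: val_inj.
  rewrite E (sum_last_perm (fun u => B (argl [:: u])) v hA) mulrA [X in X%:R^-1](muln1 _) mulVf; last first.
    by rewrite pnatr_eq0 -lt0n fact_gt0.
  by rewrite mul1r.
rewrite !big_ord_recl big_ord0 T0 T1 addr0; ring.
Qed.

Lemma wedge21 (A : alt R n 2) (B : alt R n 1) a b c : alternating A ->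
  wedge A B (argl [:: a; b; c]) = A (argl [:: a; b]) * B (argl [:: c]) - A (argl [:: a; c]) * B (argl [:: b]) + A (argl [:: b; c]) * B (argl [:: a]).
Proof.
move=> hA; set v := argl [:: a; b; c].
pose T (j : 'I_3) := (-1) ^+ (2 + j) *
  (A (fun i => v (lift j i)) * (fun u => B (argl [:: u])) (v j)).
have T0 : T ord0 = (A (argl [:: b; c]) * B (argl [:: a])).
  rewrite /T -signr_odd /= expr0 mul1r; congr (A _ * B _); argl_ext.
have T1 : T (lift ord0 ord0) = - (A (argl [:: a; c]) * B (argl [:: b])).
  rewrite /T -signr_odd /= expr1 mulN1r; congr (- (A _ * B _)); argl_ext.
have T2 : T (lift ord0 (lift ord0 ord0)) = (A (argl [:: a; b]) * B (argl [:: c])).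
  rewrite /T -signr_odd /= expr0 mul1r; congr (A _ * B _); argl_ext.
have -> : wedge A B v = \sum_j T j.
  have E : wedge A B v = (2`! * 1`!)%:R^-1 * \sum_(s : 'S_3) (-1) ^+ s *
      (A (fun i => v (s (lift ord_max i))) * (fun u => B (argl [:: u])) (v (s ord_max))).
    congr (_ * _); apply: eq_bigr => s _; congr (_ * (A _ * B _)); apply/funext => i.
      by congr (v (s _)); apply: val_inj; rewrite /= /bump leqNgt ltn_ord.
    by rewrite ord1; congr (v (s _)); apply: val_inj.
  rewrite E (sum_last_perm (fun u => B (argl [:: u])) v hA) mulrA [X in X%:R^-1](muln1 _) mulVf; last first.
    by rewrite pnatr_eq0 -lt0n fact_gt0.
  by rewrite mul1r.
rewrite !big_ord_recl big_ord0 T0 T1 T2 addr0; ring.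
Qed.

Lemma wedge31 (A : alt R n 3) (B : alt R n 1) a b c d : alternating A ->
  wedge A B (argl [:: a; b; c; d]) = A (argl [:: a; b; c]) * B (argl [:: d]) - A (argl [:: a; b; d]) * B (argl [:: c]) + A (argl [:: a; c; d]) * B (argl [:: b]) - A (argl [:: b; c; d]) * B (argl [:: a]).
Proof.
move=> hA; set v := argl [:: a; b; c; d].
pose T (j : 'I_4) := (-1) ^+ (3 + j) *
  (A (fun i => v (lift j i)) * (fun u => B (argl [:: u])) (v j)).
have T0 : T ord0 = - (A (argl [:: b; c; d]) * B (argl [:: a])).
  rewrite /T -signr_odd /= expr1 mulN1r; congr (- (A _ * B _)); argl_ext.
have T1 : T (lift ord0 ord0) = (A (argl [:: a; c; d]) * B (argl [:: b])).
  rewrite /T -signr_odd /= expr0 mul1r; congr (A _ * B _); argl_ext.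
have T2 : T (lift ord0 (lift ord0 ord0)) = - (A (argl [:: a; b; d]) * B (argl [:: c])).
  rewrite /T -signr_odd /= expr1 mulN1r; congr (- (A _ * B _)); argl_ext.
have T3 : T (lift ord0 (lift ord0 (lift ord0 ord0))) = (A (argl [:: a; b; c]) * B (argl [:: d])).
  rewrite /T -signr_odd /= expr0 mul1r; congr (A _ * B _); argl_ext.
have -> : wedge A B v = \sum_j T j.
  have E : wedge A B v = (3`! * 1`!)%:R^-1 * \sum_(s : 'S_4) (-1) ^+ s *
      (A (fun i => v (s (lift ord_max i))) * (fun u => B (argl [:: u])) (v (s ord_max))).
    congr (_ * _); apply: eq_bigr => s _; congr (_ * (A _ * B _)); apply/funext => i.
      by congr (v (s _)); apply: val_inj; rewrite /= /bump leqNgt ltn_ord.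
    by rewrite ord1; congr (v (s _)); apply: val_inj.
  rewrite E (sum_last_perm (fun u => B (argl [:: u])) v hA) mulrA [X in X%:R^-1](muln1 _) mulVf; last first.
    by rewrite pnatr_eq0 -lt0n fact_gt0.
  by rewrite mul1r.
rewrite !big_ord_recl big_ord0 T0 T1 T2 T3 addr0; ring.
Qed.

End SmallForms.

Lemma fact_cancel (R : realFieldType) (x : R) :
  (2`! * 3`!)%:R^-1 * ((3`!)%:R * (x *+ 2)) = x.
Proof.
rewrite (_ : 2`! * 3`! = 12)%N // (_ : 3`! = 6)%N // -mulr_natl.
by field.
Qed.

(** * Bidegree components, interior products and traces *)

Section Contractions.
Variables (R : realType) (n : nat).
Notation V := 'rV[R]_n.

(** As [A] vanishes on [c], [d] and [e], it has to receive [a] and [b]. Their two orders contribute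
    equally and, with the 3! orders of the other arguments, cancel 2! 3!. *)
Lemma wedge23 (A : alt R n 2) (B : alt R n 3) a b c d e :
  alternating A -> alternating B ->
  (forall x, [/\ A (argl [:: x; c]) = 0, A (argl [:: x; d]) = 0 & A (argl [:: x; e]) = 0]) ->
  wedge A B (argl [:: a; b; c; d; e]) = A (argl [:: a; b]) * B (argl [:: c; d; e]).
Proof.
move=> hA hB kA; set v := argl [:: a; b; c; d; e].
pose T (i : 'I_5) (j : 'I_4) := (-1) ^+ (i + j) *
  (A (argl [:: v i; v (lift i j)]) * B (fun p => v (lift i (lift j p)))).
have E : wedge A B v = (2`! * 3`!)%:R^-1 * ((3`!)%:R * \sum_i \sum_j T i j).
  rewrite -(sum_first_two_perm (fun x y => A (argl [:: x; y])) v hB).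
  congr (_ * _); apply: eq_bigr => s _; congr (_ * (A _ * B _)); apply/funext => i.
    by case: i => -[|[|i]] hi //; rewrite /argl /=; congr (v (s _)); apply: val_inj.
  by congr (v (s _)); apply: val_inj.
have kr x y z : A (argl [:: x; z]) = 0 -> A (argl [:: x; z]) * y = 0 by move=> ->; rewrite mul0r.
have kl x y z : A (argl [:: z; x]) = 0 -> A (argl [:: x; z]) * y = 0.
  by move=> H; rewrite form2_anti// H oppr0 mul0r.
have T0 (i : 'I_5) (j : 'I_4) : (2 <= i)%N || (2 <= lift i j)%N -> T i j = 0.
  move=> H; rewrite /T; apply/eqP; rewrite mulf_eq0; apply/orP; right; apply/eqP.
  have kv (l : 'I_5) x : (2 <= l)%N -> A (argl [:: x; v l]) = 0.
    have [? ? ?] := kA x.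
    by case: l => -[|[|[|[|[|l]]]]].
  by case/orP: H => H; [apply: kl|apply: kr]; exact: kv.
have T00 : T ord0 ord0 = A (argl [:: a; b]) * B (argl [:: c; d; e]).
  by rewrite /T expr0 mul1r; congr (A _ * B _); argl_ext.
have T10 : T (lift ord0 ord0) ord0 = A (argl [:: a; b]) * B (argl [:: c; d; e]).
  rewrite /T expr1 mulN1r -mulNr form2_anti// opprK; congr (A _ * B _); argl_ext.
have S : \sum_i \sum_j T i j = (A (argl [:: a; b]) * B (argl [:: c; d; e])) *+ 2.
  rewrite big_ord_recl big_ord_recl [X in _ + (_ + X)]big1; last first.
    by move=> i _; rewrite big1// => j _; rewrite T0.
  rewrite big_ord_recl T00 big1 => [|j _]; last by rewrite T0// orbC.
  rewrite big_ord_recl T10 big1 => [|j _]; last by rewrite T0// orbC.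
  by rewrite !addr0 mulr2n.
by rewrite E S fact_cancel.
Qed.

Section Bicomp.
Variables (g : V -> V) (k : nat) (A : alt R n k).
Hypotheses (hg : forall a u w, g (a *: u + w) = a *: g u + g w) (hA : alternating A).

(** When two arguments are equal, applying their transposition to the set [S] of horizontal slots
    reverses the sign of a term and keeps the cardinal of [S]. The sum is therefore its own
    opposite. *)
Lemma alternating_bicomp p : alternating (bicomp g p A).
Proof.
split=> [v i a u w|v i j ij vij].
  rewrite /bicomp mulr_sumr -big_split/=; apply: eq_bigr => S _.
  have E x : (fun l => if l \in S then upd v i x l - g (upd v i x l) else g (upd v i x l)) =
      upd (fun l => if l \in S then v l - g (v l) else g (v l)) i
          (if i \in S then x - g x else g x).
    by apply/funext => l; rewrite /upd; case: (eqVneq l i) => [->|].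
  rewrite !E -altP//; congr (A (upd _ _ _)); case: ifP => _; rewrite hg//.
  by rewrite scalerBr opprD addrACA.
pose t := tperm i j.
pose F (S : {set 'I_k}) := A (fun l => if l \in S then v l - g (v l) else g (v l)).
have tinv : involutive (fun S : {set 'I_k} => (t @: S)%SET).
  by move=> S; rewrite -imset_comp (eq_imset (g := id)) ?imset_id// => l; rewrite /= tpermK.
have FN (S : {set 'I_k}) : F (t @: S)%SET = - F S.
  rewrite /F -(alt_tperm hA _ ij); congr A; apply/funext => l.
  have -> : (l \in (t @: S)%SET) = (t l \in S).
    by rewrite -[l in LHS](tpermK i j) mem_imset//; exact: perm_inj.
  have -> : v (t l) = v l by rewrite /t; case: tpermP => // ->.
  by [].
have : bicomp g p A v = - bicomp g p A v.
  rewrite {1}/bicomp (reindex_inj (can_inj tinv)) /= -sumrN.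
  apply: eq_big => [S|S _]; first by rewrite card_imset//; exact: perm_inj.
  exact: FN.
by move=> /eqP; rewrite -subr_eq0 opprK -mulr2n mulrn_eq0 => /eqP.
Qed.

(** Each argument is purely horizontal ([b i]) or purely vertical. A set [S] other than that of the
    horizontal slots puts 0 into some slot, so at most one term survives. *)
Lemma bicomp_split p (b : pred 'I_k) v :
  (forall i, if b i then g (v i) = 0 else g (v i) = v i) ->
  bicomp g p A v = if #|b| == p then A v else 0.
Proof.
move=> hb; pose S0 : {set 'I_k} := [set i | b i]%SET.
have E (S : {set 'I_k}) : A (fun i => if i \in S then v i - g (v i) else g (v i)) = if S == S0 then A v else 0.
  case: eqP => [->|/eqP]; first congr A.
    by apply/funext => i; rewrite inE; have := hb i; case: ifP => // _ ->; rewrite subr0.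
  move=> SS; have [i iS] : exists i, (i \in S) != (i \in S0).
    apply/existsP; apply: contraNT SS; rewrite negb_exists => /forallP H.
    by apply/eqP/setP => i; apply/eqP; have := H i; rewrite negbK.
  apply: (@alt0 _ _ _ _ hA _ i); move: iS; rewrite inE.
  by have := hb i; case: (b i); case: (i \in S) => // ->; rewrite ?subrr.
rewrite /bicomp (eq_bigr _ (fun S _ => E S)) -big_mkcondr/=.
rewrite (_ : #|b| = #|S0|); last by rewrite cardsE.
case: ifP => cS0; last first.
  by apply: big1 => S /andP[/eqP cS /eqP SS0]; rewrite -cS SS0 eqxx in cS0.
rewrite (big_pred1 S0)// => S /=; case: (eqVneq S S0) => [->|]; rewrite ?andbT ?andbF//.
Qed.

End Bicomp.

Lemma card_nth k (l : seq bool) : size l = k -> #|(fun i : 'I_k => nth false l i)| = count id l.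
Proof.
move=> <-; rewrite cardE -[in RHS](mkseq_nth false l) /mkseq -val_enum_ord -map_comp count_map.
by rewrite -size_filter enumT; congr size; rewrite /enum_mem; apply: eq_filter.
Qed.

(** The list [l] flags the horizontal arguments; the number of its flags is compared with the first
    index of the bidegree. *)
Lemma bicomp_argl g k (A : alt R n k) p (l : seq bool) (s : seq V) : alternating A ->
  size l = k ->
  (forall i, (i < k)%N -> if nth false l i then g (nth 0 s i) = 0 else g (nth 0 s i) = nth 0 s i) ->
  bicomp g p A (argl s) = if count id l == p then A (argl s) else 0.
Proof.
move=> hA sl H; rewrite (@bicomp_split g k A hA p (fun i => nth false l i)) ?card_nth//.
by move=> i; exact: H.
Qed.

(** This is the argument tuple inside [iprod]: the contracted slots (there in reversed order), then
    the free ones. *)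
Definition cat_args k l (v : 'I_k -> V) (w : 'I_l -> V) : 'I_(k + l) -> V :=
  fun m => match fintype.split m with inl i => v i | inr j => w j end.

Lemma cat_argl k l (s t : seq V) : size s = k ->
  @cat_args k l (argl s) (argl t) = argl (s ++ t).
Proof.
move=> sk; apply/funext => i; rewrite /cat_args /argl nth_cat sk.
by case: splitP => j ->; rewrite ?addKn.
Qed.

Lemma alternating_cat k l (B : alt R n (k + l)) w : alternating B ->
  alternating (fun v : 'I_k -> V => B (cat_args v w)).
Proof.
move=> hB; have E v i u : cat_args (upd v i u) w = upd (cat_args v w) (lshift l i) u.
  apply/funext => m; rewrite /cat_args /upd; case: splitP => j mj.
    by rewrite -!val_eqE/= mj.
  by rewrite -val_eqE/= mj gtn_eqF// ltn_addr.
split=> [v i a u x|v i j ij vij]; first by rewrite !E altP.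
apply: (@alt_eq0 _ _ _ _ hB _ (lshift l i) (lshift l j)); first by rewrite eq_lshift.
by rewrite /cat_args -[lshift l i]/(unsplit (inl i)) -[lshift l j]/(unsplit (inl j)) !unsplitK.
Qed.

Lemma iprod1E l (A : alt R n 1) (B : alt R n (1 + l)) w : alternating B ->
  iprod A B w = B (cat_args (argl [:: row_of_alt A]) w).
Proof.
move=> hB; rewrite /iprod (_ : 1`! = 1)%N // invr1 mul1r.
have hC := alternating_cat w hB.
rewrite [row_of_alt A]row_unitv (form1_sum hC).
rewrite (reindex (fun a : 'I_n => [ffun _ : 'I_1 => a])) /=.
  apply: eq_bigr => a _; rewrite (form1Z hC) mxE; congr (A _ * B _).
    by apply/funext => i; rewrite ffunE.
  apply/funext => m; rewrite /cat_args; case: splitP => // i _.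
  by rewrite ffunE ord1.
exists (fun I : {ffun 'I_1 -> 'I_n} => I ord0) => [a _|I _]; first by rewrite ffunE.
by apply/ffunP => i; rewrite ffunE (ord1 i).
Qed.

Lemma iprod2E l (A : alt R n 2) (B : alt R n (2 + l)) w :
  iprod A B w = 2^-1 * \sum_a \sum_b A (argl [:: unitv R a; unitv R b]) *
     B (cat_args (argl [:: unitv R b; unitv R a]) w).
Proof.
rewrite /iprod; congr (_ * _); rewrite pair_big /=.
pose f (p : 'I_n * 'I_n) := [ffun i : 'I_2 => if i == ord0 then p.1 else p.2].
rewrite (reindex f) /=.
  apply: eq_bigr => -[a b] _; congr (A _ * B _).
    by apply/funext => -[[|[|m]] hm]//; rewrite ffunE.
  apply/funext => m; rewrite /cat_args; case: splitP => // -[[|[|i]] hi] _ //; rewrite ffunE//.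
apply: onW_bij; apply: inj_card_bij; last by rewrite card_ffun card_prod !card_ord.
move=> [a b] [a' b'] /ffunP E; have := E ord0; have := E ord_max.
by rewrite !ffunE /= => -> ->.
Qed.

Lemma iprod3E l (A : alt R n 3) (B : alt R n (3 + l)) w :
  iprod A B w = 6^-1 * \sum_a \sum_b \sum_c A (argl [:: unitv R a; unitv R b; unitv R c]) *
     B (cat_args (argl [:: unitv R c; unitv R b; unitv R a]) w).
Proof.
rewrite /iprod; congr (_ * _); rewrite pair_big pair_big /=.
pose f (p : 'I_n * 'I_n * 'I_n) := [ffun i : 'I_3 => if i == ord0 then p.1.1 else
  if i == ord_max then p.2 else p.1.2].
rewrite (reindex f) /=.
  apply: eq_bigr => -[[a b] c] _; congr (A _ * B _).
    by apply/funext => -[[|[|[|m]]] hm]//; rewrite ffunE.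
  apply/funext => m; rewrite /cat_args; case: splitP => // -[[|[|[|i]]] hi] _ //; rewrite ffunE//.
apply: onW_bij; apply: inj_card_bij; last by rewrite card_ffun !card_prod !card_ord !expnS expn0 muln1 mulnA.
move=> [[a b] c] [[a' b'] c'] /ffunP E; have := E ord0; have := E ord_max.
have := E (lift ord0 ord0); by rewrite !ffunE /= => -> -> ->.
Qed.

(** The duality hypothesis says that the sum of the tensors eps_a (x) e_a equals the same sum for
    the standard basis, and a bilinear map depends only on that sum. *)
Lemma trace_dual_bases (f : V -> V -> R) (eps e : 'I_n -> V) :
  (forall a u w x, f (a *: u + w) x = a * f u x + f w x) ->
  (forall a u w x, f x (a *: u + w) = a * f x u + f x w) ->
  (forall i j, \sum_a eps a 0 i * e a 0 j = (i == j)%:R) ->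
  \sum_a f (unitv R a) (unitv R a) = \sum_a f (eps a) (e a).
Proof.
move=> fl fr dual.
have f0l x : f 0 x = 0.
  have := fl 1 0 0 x; rewrite scale1r addr0 mul1r => /eqP.
  by rewrite -subr_eq0 opprD addrA subrr sub0r oppr_eq0 => /eqP.
have f0r x : f x 0 = 0.
  have := fr 1 0 0 x; rewrite scale1r addr0 mul1r => /eqP.
  by rewrite -subr_eq0 opprD addrA subrr sub0r oppr_eq0 => /eqP.
have suml (r : seq 'I_n) (c : 'I_n -> R) (u : 'I_n -> V) x :
    f (\sum_(j <- r) c j *: u j) x = \sum_(j <- r) c j * f (u j) x.
  by elim: r => [|j r IH]; rewrite ?big_nil// !big_cons fl IH.
have sumr (r : seq 'I_n) (c : 'I_n -> R) (u : 'I_n -> V) x :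
    f x (\sum_(j <- r) c j *: u j) = \sum_(j <- r) c j * f x (u j).
  by elim: r => [|j r IH]; rewrite ?big_nil// !big_cons fr IH.
have E a : f (eps a) (e a) = \sum_i \sum_j (eps a 0 i * e a 0 j) * f (unitv R i) (unitv R j).
  rewrite {1}(row_unitv (eps a)) suml; apply: eq_bigr => i _.
  rewrite {1}(row_unitv (e a)) sumr mulr_sumr; apply: eq_bigr => j _.
  by rewrite mulrA.
rewrite (eq_bigr _ (fun a _ => E a)) exchange_big /=; apply: eq_bigr => i _.
rewrite exchange_big /= (bigD1 i)//= -mulr_suml dual eqxx mul1r big1 ?addr0// => j ji.
by rewrite -mulr_suml dual eq_sym (negbTE ji) mul0r.
Qed.

End Contractions.

(** * Frames of R^5 and contractions with bivectors and trivectors *)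

Section FiveDim.
Variable R : realType.
Notation V := 'rV[R]_5.

Definition o0 : 'I_5 := @Ordinal 5 0 isT.
Definition o1 : 'I_5 := @Ordinal 5 1 isT.
Definition o2 : 'I_5 := @Ordinal 5 2 isT.
Definition o3 : 'I_5 := @Ordinal 5 3 isT.
Definition o4 : 'I_5 := @Ordinal 5 4 isT.

Lemma sum5E (T : zmodType) (F : 'I_5 -> T) : \sum_j F j = F o0 + F o1 + F o2 + F o3 + F o4.
Proof.
rewrite !big_ord_recl big_ord0 addr0 !addrA.
by do ![congr (_ + _)|congr (F _)]; apply: val_inj.
Qed.

Lemma ord5_ind (P : 'I_5 -> Prop) : P o0 -> P o1 -> P o2 -> P o3 -> P o4 -> forall j, P j.
Proof.
move=> P0 P1 P2 P3 P4 [[|[|[|[|[|j]]]]] hj]//.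
- by rewrite (_ : Ordinal hj = o0)//; apply: val_inj.
- by rewrite (_ : Ordinal hj = o1)//; apply: val_inj.
- by rewrite (_ : Ordinal hj = o2)//; apply: val_inj.
- by rewrite (_ : Ordinal hj = o3)//; apply: val_inj.
- by rewrite (_ : Ordinal hj = o4)//; apply: val_inj.
Qed.

Lemma sum_tail (F : 'I_5 -> R) : F o0 = 0 -> F o1 = 0 -> \sum_j F j = F o2 + F o3 + F o4.
Proof. by rewrite sum5E => -> ->; rewrite !add0r. Qed.

Definition det3 (a1 a2 a3 b1 b2 b3 c1 c2 c3 : R) : R :=
  a1 * (b2 * c3 - b3 * c2) - a2 * (b1 * c3 - b3 * c1) + a3 * (b1 * c2 - b2 * c1).

(** Only the six orderings of the indices 2, 3, 4 survive, which gives the Leibniz formula for a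
    determinant of order 3. *)
Lemma det3_alt_sum (f : 'I_5 -> 'I_5 -> 'I_5 -> R) (a b c : 'I_5 -> R) (t : R) :
  (forall i j, f i i j = 0) -> (forall i j, f i j i = 0) -> (forall i j, f j i i = 0) ->
  f o2 o3 o4 = t -> f o2 o4 o3 = - t -> f o3 o2 o4 = - t -> f o3 o4 o2 = t ->
  f o4 o2 o3 = t -> f o4 o3 o2 = - t ->
  (forall i j, [/\ f o0 i j = 0, f o1 i j = 0, f i o0 j = 0, f i o1 j = 0 & f i j o0 = 0 /\ f i j o1 = 0]) ->
  \sum_i a i * \sum_j b j * \sum_k c k * f i j k =
  det3 (a o2) (a o3) (a o4) (b o2) (b o3) (b o4) (c o2) (c o3) (c o4) * t.
Proof.
move=> f1 f2 f3 E1 E2 E3 E4 E5 E6 k.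
have S3 i j : \sum_k c k * f i j k = c o2 * f i j o2 + c o3 * f i j o3 + c o4 * f i j o4.
  by have [_ _ _ _ [k1 k2]] := k i j; rewrite sum_tail ?k1 ?k2 ?mulr0.
have S2 i : \sum_j b j * \sum_k c k * f i j k = b o2 * (\sum_k c k * f i o2 k)
    + b o3 * (\sum_k c k * f i o3 k) + b o4 * (\sum_k c k * f i o4 k).
  rewrite sum_tail// big1 ?mulr0// => l _; have [_ _ z0 z1 _] := k i l; by rewrite ?z0 ?z1 mulr0.
rewrite sum_tail; last 2 first.
- rewrite big1 ?mulr0// => j _; rewrite big1 ?mulr0// => l _; have [-> _ _ _ _] := k j l; by rewrite mulr0.
- rewrite big1 ?mulr0// => j _; rewrite big1 ?mulr0// => l _; have [_ -> _ _ _] := k j l; by rewrite mulr0.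
rewrite !S2 !S3 !f1 !f2 !f3 E1 E2 E3 E4 E5 E6 /det3.
ring.
Qed.

Lemma form3_perms n (A : alt R n 3) x y z : alternating A ->
  [/\ A (argl [:: x; z; y]) = - A (argl [:: x; y; z]),
      A (argl [:: y; x; z]) = - A (argl [:: x; y; z]),
      A (argl [:: y; z; x]) = A (argl [:: x; y; z]),
      A (argl [:: z; x; y]) = A (argl [:: x; y; z]) &
      A (argl [:: z; y; x]) = - A (argl [:: x; y; z])].
Proof.
move=> hA; have a12 := form3_anti12 hA; have a23 := form3_anti23 hA; split.
- exact: a23.
- exact: a12.
- by rewrite a23 a12 opprK.
- by rewrite a12 a23 opprK.
- by rewrite a12 a23 a12 opprK.
Qed.

Lemma form3_comb (A : alt R 5 3) (e : 'I_5 -> V) (a b c : 'I_5 -> R) : alternating A ->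
  (forall x y, A (argl [:: e o0; x; y]) = 0) -> (forall x y, A (argl [:: e o1; x; y]) = 0) ->
  A (argl [:: \sum_i a i *: e i; \sum_i b i *: e i; \sum_i c i *: e i]) =
  det3 (a o2) (a o3) (a o4) (b o2) (b o3) (b o4) (c o2) (c o3) (c o4)
    * A (argl [:: e o2; e o3; e o4]).
Proof.
move=> hA k0 k1.
have a12 := form3_anti12 hA; have a23 := form3_anti23 hA.
have [P1 P2 P3 P4 P5] := form3_perms (e o2) (e o3) (e o4) hA.
rewrite -(@det3_alt_sum (fun i j k => A (argl [:: e i; e j; e k])) a b c (A (argl [:: e o2; e o3; e o4])))//.
- rewrite form3_sum1//; apply: eq_bigr => i _; rewrite form3_Z1//; congr (_ * _).
  rewrite form3_sum2//; apply: eq_bigr => j _; rewrite form3_Z2//; congr (_ * _).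
  by rewrite form3_sum3//; apply: eq_bigr => k _; rewrite form3_Z3.
- by move=> i j; exact: form3_alt12.
- by move=> i j; exact: form3_alt13.
- by move=> i j; exact: form3_alt23.
- move=> i j; split; rewrite ?k0 ?k1//.
  + by rewrite a12 k0 oppr0.
  + by rewrite a12 k1 oppr0.
  + by rewrite !(a23 _ (e o0)) !(a23 _ (e o1)) !(a12 _ (e o0)) !(a12 _ (e o1)) k0 k1 !oppr0.
Qed.

Section Traces.
Variables (eps e : 'I_5 -> V).
Hypothesis dual : forall i j, \sum_a eps a 0 i * e a 0 j = (i == j)%:R.

(** The standard basis is replaced by the dual pair in one summation at a time, from the innermost
    to the outermost. *)
Lemma trace3_frame (A C : alt R 5 3) : alternating A -> alternating C ->
  \sum_a \sum_b \sum_c A (argl [:: unitv R a; unitv R b; unitv R c]) *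
     C (argl [:: unitv R c; unitv R b; unitv R a]) =
  \sum_a \sum_b \sum_c A (argl [:: eps a; eps b; eps c]) * C (argl [:: e c; e b; e a]).
Proof.
move=> hA hC.
have s1 a b : \sum_c A (argl [:: unitv R a; unitv R b; unitv R c]) *
     C (argl [:: unitv R c; unitv R b; unitv R a]) =
   \sum_c A (argl [:: unitv R a; unitv R b; eps c]) * C (argl [:: e c; unitv R b; unitv R a]).
  apply: (@trace_dual_bases _ _ (fun u x => A (argl [:: unitv R a; unitv R b; u]) *
     C (argl [:: x; unitv R b; unitv R a])) eps e) => // x u w y.
    by rewrite form3_P3// mulrDl mulrA.
  by rewrite form3_P1// mulrDr mulrCA.
under eq_bigr do under eq_bigr do rewrite s1.
have s2 a : \sum_b \sum_c A (argl [:: unitv R a; unitv R b; eps c]) *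
     C (argl [:: e c; unitv R b; unitv R a]) =
   \sum_b \sum_c A (argl [:: unitv R a; eps b; eps c]) * C (argl [:: e c; e b; unitv R a]).
  apply: (@trace_dual_bases _ _ (fun u x => \sum_c A (argl [:: unitv R a; u; eps c]) *
     C (argl [:: e c; x; unitv R a])) eps e) => // x u w y.
    rewrite mulr_sumr -big_split; apply: eq_bigr => c _ /=.
    by rewrite form3_P2// mulrDl mulrA.
  rewrite mulr_sumr -big_split; apply: eq_bigr => c _ /=.
  by rewrite form3_P2// mulrDr mulrCA.
under eq_bigr do rewrite s2.
apply: (@trace_dual_bases _ _ (fun u x => \sum_b \sum_c A (argl [:: u; eps b; eps c]) *
     C (argl [:: e c; e b; x])) eps e) => // x u w y.
  rewrite mulr_sumr -big_split; apply: eq_bigr => b _ /=.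
  rewrite mulr_sumr -big_split; apply: eq_bigr => c _ /=.
  by rewrite form3_P1// mulrDl mulrA.
rewrite mulr_sumr -big_split; apply: eq_bigr => b _ /=.
rewrite mulr_sumr -big_split; apply: eq_bigr => c _ /=.
by rewrite form3_P3// mulrDr mulrCA.
Qed.

Lemma trace2_frame (A C : alt R 5 2) : alternating A -> alternating C ->
  \sum_a \sum_b A (argl [:: unitv R a; unitv R b]) * C (argl [:: unitv R b; unitv R a]) =
  \sum_a \sum_b A (argl [:: eps a; eps b]) * C (argl [:: e b; e a]).
Proof.
move=> hA hC.
have s1 a : \sum_b A (argl [:: unitv R a; unitv R b]) * C (argl [:: unitv R b; unitv R a]) =
   \sum_b A (argl [:: unitv R a; eps b]) * C (argl [:: e b; unitv R a]).
  apply: (@trace_dual_bases _ _ (fun u x => A (argl [:: unitv R a; u]) *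
     C (argl [:: x; unitv R a])) eps e) => // x u w y.
    by rewrite form2_Pr// mulrDl mulrA.
  by rewrite form2_Pl// mulrDr mulrCA.
under eq_bigr do rewrite s1.
apply: (@trace_dual_bases _ _ (fun u x => \sum_b A (argl [:: u; eps b]) *
     C (argl [:: e b; x])) eps e) => // x u w y.
  rewrite mulr_sumr -big_split; apply: eq_bigr => b _ /=.
  by rewrite form2_Pl// mulrDl mulrA.
rewrite mulr_sumr -big_split; apply: eq_bigr => b _ /=.
by rewrite form2_Pr// mulrDr mulrCA.
Qed.

(** The six orderings of the indices 2, 3, 4 contribute equally and cancel the factor 1/6. The sign
    is that of the reversal of three arguments in [iprod]. *)
Lemma iprod3_frame l (A : alt R 5 3) (B : alt R 5 (3 + l)) w :
  alternating A -> alternating B ->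
  (forall x y, A (argl [:: eps o0; x; y]) = 0) -> (forall x y, A (argl [:: eps o1; x; y]) = 0) ->
  iprod A B w = - (A (argl [:: eps o2; eps o3; eps o4]) *
                   B (cat_args (argl [:: e o2; e o3; e o4]) w)).
Proof.
move=> hA hB k0 k1; rewrite iprod3E.
have hC := alternating_cat w hB.
rewrite (trace3_frame hA hC); pose C : alt R 5 3 := fun v => B (cat_args v w).
have a12 := form3_anti12 hA; have a23 := form3_anti23 hA.
have [P1 P2 P3 P4 P5] := form3_perms (eps o2) (eps o3) (eps o4) hA.
have [Q1 Q2 Q3 Q4 Q5] := form3_perms (e o2) (e o3) (e o4) hC.
pose f i j k := A (argl [:: eps i; eps j; eps k]) * C (argl [:: e k; e j; e i]).
have S i : \sum_b \sum_c f i b c = f i o2 o2 + f i o2 o3 + f i o2 o4 +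
   (f i o3 o2 + f i o3 o3 + f i o3 o4) + (f i o4 o2 + f i o4 o3 + f i o4 o4).
  have Z j k : f i o0 k = 0 /\ f i o1 k = 0 /\ f i j o0 = 0 /\ f i j o1 = 0.
    by rewrite /f !(a23 _ (eps o0)) !(a23 _ (eps o1)) !(a12 _ (eps o0)) !(a12 _ (eps o1))
         !k0 !k1 !oppr0 !mul0r.
  have T j : \sum_c f i j c = f i j o2 + f i j o3 + f i j o4.
    by have [_ [_ [z0 z1]]] := Z j o2; rewrite sum_tail.
  rewrite sum_tail ?T//.
    by have [z0 _] := Z o2 o2; have [z1 _] := Z o2 o3; have [z2 _] := Z o2 o4; rewrite z0 z1 z2 !addr0.
  by have [_ [z0 _]] := Z o2 o2; have [_ [z1 _]] := Z o2 o3; have [_ [z2 _]] := Z o2 o4;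
     rewrite z0 z1 z2 !addr0.
have Z j k : f o0 j k = 0 /\ f o1 j k = 0 by rewrite /f k0 k1 !mul0r.
rewrite [X in _ * X = _](_ : _ = \sum_a \sum_b \sum_c f a b c)//.
rewrite sum_tail; last 2 first.
- by rewrite S !(Z _ _).1 !addr0.
- by rewrite S !(Z _ _).2 !addr0.
rewrite !S /f !form3_alt12// !form3_alt13// !form3_alt23// P1 P2 P3 P4 P5.
rewrite [C (argl [:: e o4; e o3; e o2])]Q5 [C (argl [:: e o3; e o4; e o2])]Q3
  [C (argl [:: e o4; e o2; e o3])]Q4 [C (argl [:: e o2; e o4; e o3])]Q1
  [C (argl [:: e o3; e o2; e o4])]Q2.
rewrite -/(C (argl [:: e o2; e o3; e o4])).
move: (A _) (C _) => a c; by field.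
Qed.

(** Two equal terms cancel the factor 1/2; the reversal in [iprod] is kept as the order [e o1],
    [e o0]. *)
Lemma iprod2_frame l (A : alt R 5 2) (B : alt R 5 (2 + l)) w :
  alternating A -> alternating B ->
  (forall (i : 'I_5) x, (2 <= i)%N -> A (argl [:: x; eps i]) = 0) ->
  iprod A B w = A (argl [:: eps o0; eps o1]) * B (cat_args (argl [:: e o1; e o0]) w).
Proof.
move=> hA hB k; rewrite iprod2E.
have hC := alternating_cat w hB.
rewrite (trace2_frame hA hC) !sum5E !form2_alt// !(k o2)// !(k o3)// !(k o4)//.
rewrite !(form2_anti hA (eps o2)) !(form2_anti hA (eps o3)) !(form2_anti hA (eps o4)).
rewrite !(k o2)// !(k o3)// !(k o4)// (form2_anti hA (eps o1)).
have flip : B (cat_args (argl [:: e o0; e o1]) w) = - B (cat_args (argl [:: e o1; e o0]) w).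
  exact: (form2_anti hC (e o0) (e o1)).
rewrite flip !mul0r !oppr0 !mul0r !(add0r, addr0).
move: (A _) (B (cat_args (argl [:: e o1; _]) _)) => a c; by field.
Qed.

End Traces.

(** The last hypothesis says that contracting [W] with two slots of [Q] gives 0. Of the four terms
    of Q /\ X this removes the two in which [W] meets [Q] alone and leaves the two in which it also
    meets [X]. *)
Lemma iprod31_wedge (W : alt R 5 2) (b : alt R 5 1) (Q : alt R 5 3) X w :
  alternating W -> alternating b -> alternating Q ->
  (forall x, \sum_p \sum_q W (argl [:: unitv R p; unitv R q]) *
                Q (argl [:: x; unitv R q; unitv R p]) = 0) ->
  @iprod R 5 3 1 (wedge W b) (wedge Q (alt_of_row X)) (argl [:: w]) =
  - Q (argl [:: row_of_alt b; \row_q W (argl [:: X; unitv R q]); w]).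
Proof.
move=> hW hb hQ tr.
have hX : alternating (alt_of_row X).
  split=> [v i a u x|v i j]; last by rewrite !ord1 eqxx.
  rewrite /alt_of_row /upd (ord1 i) eqxx /dotp mulr_sumr -big_split; apply: eq_bigr => j _ /=.
  by rewrite !mxE mulrDr mulrCA.
pose QX : alt R 5 (3 + 1) := wedge Q (alt_of_row X).
have hT := alternating_cat (argl [:: w]) (alternating_wedge hQ hX : @alternating R 5 (3 + 1) QX).
set T := (fun v : 'I_3 -> V => _) in hT.
rewrite iprod3E.
have TE x y z : T (argl [:: x; y; z]) = Q (argl [:: x; y; z]) * dotp X w
   - Q (argl [:: x; y; w]) * dotp X z + Q (argl [:: x; z; w]) * dotp X y
   - Q (argl [:: y; z; w]) * dotp X x.
  by rewrite /T cat_argl// /QX wedge31.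
pose F a b' c := W (argl [:: unitv R a; unitv R b']) * b (argl [:: unitv R c]) *
   T (argl [:: unitv R c; unitv R b'; unitv R a]).
(* The three terms of W /\ b become equal once the summation indices are renamed, because [T] is
   alternating. *)
have -> : \sum_a \sum_b' \sum_c wedge W b (argl [:: unitv R a; unitv R b'; unitv R c]) *
     wedge Q (alt_of_row X) (cat_args (argl [:: unitv R c; unitv R b'; unitv R a]) (argl [:: w]))
   = 3 * \sum_a \sum_b' \sum_c F a b' c.
  have -> : 3 * \sum_a \sum_b' \sum_c F a b' c = \sum_a \sum_b' \sum_c F a b' c
    + \sum_a \sum_c \sum_b' F a b' c + \sum_c \sum_a \sum_b' F a b' c.
    have -> : \sum_c \sum_a \sum_b' F a b' c = \sum_a \sum_b' \sum_c F a b' c.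
      by rewrite exchange_big; apply: eq_bigr => a _; rewrite exchange_big.
    have -> : \sum_a \sum_c \sum_b' F a b' c = \sum_a \sum_b' \sum_c F a b' c.
      by apply: eq_bigr => a _; rewrite exchange_big.
    by move: (\sum_a _) => s; ring.
  rewrite -!big_split; apply: eq_bigr => a _ /=; rewrite -!big_split; apply: eq_bigr => b' _ /=.
  rewrite -!big_split; apply: eq_bigr => c _ /=.
  have [P1 P2 P3 P4 P5] := form3_perms (unitv R c) (unitv R b') (unitv R a) hT.
  rewrite wedge21// -/QX -[QX _]/(T (argl [:: unitv R c; unitv R b'; unitv R a])) /F.
  rewrite P2 P4; move: (T _) (W _) (W _) (W _) (b _) (b _) (b _) => t w1 w2 w3 b1 b2 b3.
  by ring.
have SF a b' : \sum_c F a b' c = W (argl [:: unitv R a; unitv R b']) *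
    T (argl [:: row_of_alt b; unitv R b'; unitv R a]).
  rewrite [row_of_alt b]row_unitv (form3_sum1 hT) mulr_sumr; apply: eq_bigr => c _.
  by rewrite (form3_Z1 hT) mxE argl1_cst mulrA.
under eq_bigr do under eq_bigr do rewrite SF.
set bb := row_of_alt b; set Z := \sum_q W (argl [:: X; unitv R q]) * Q (argl [:: bb; unitv R q; w]).
have -> : Q (argl [:: bb; \row_q W (argl [:: X; unitv R q]); w]) = Z.
  rewrite [\row_q _]row_unitv form3_sum2//; apply: eq_bigr => q _.
  by rewrite form3_Z2// mxE.
have dX (q : 'I_5) : dotp X (unitv R q) = X 0 q.
  rewrite /dotp (bigD1 q)//= mxE !eqxx mulr1 big1 ?addr0// => j jq.
  by rewrite mxE (negbTE jq) andbF mulr0.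
have Z1 : \sum_a \sum_b' W (argl [:: unitv R a; unitv R b']) *
    (Q (argl [:: bb; unitv R b'; w]) * dotp X (unitv R a)) = Z.
  rewrite exchange_big; apply: eq_bigr => q _ /=.
  rewrite [X in argl [:: X; _]]row_unitv form2_suml// mulr_suml; apply: eq_bigr => p _.
  by rewrite form2_Zl// dX; move: (W _) (Q _) (X _ _) => ? ? ?; ring.
have Z2 : \sum_a \sum_b' W (argl [:: unitv R a; unitv R b']) *
    (Q (argl [:: bb; unitv R a; w]) * dotp X (unitv R b')) = - Z.
  rewrite /Z -sumrN; apply: eq_bigr => q _ /=; rewrite (form2_anti hW X).
  rewrite [X in argl [:: _; X]]row_unitv form2_sumr// mulNr opprK mulr_suml.
  apply: eq_bigr => p _.
  by rewrite form2_Zr// dX; move: (W _) (Q _) (X _ _) => ? ? ?; ring.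
have tr' : \sum_a \sum_b' W (argl [:: unitv R a; unitv R b']) *
    (Q (argl [:: unitv R b'; unitv R a; w]) * dotp X bb) = 0.
  apply: (etrans _ (etrans (congr1 (fun z => z * dotp X bb) (tr w)) (mul0r _))).
  rewrite mulr_suml; apply: eq_bigr => p _.
  rewrite mulr_suml; apply: eq_bigr => q _.
  by have [_ _ -> _ _] := form3_perms w (unitv R q) (unitv R p) hQ; rewrite mulrA.
have tr1 : \sum_a \sum_b' W (argl [:: unitv R a; unitv R b']) *
    (Q (argl [:: bb; unitv R b'; unitv R a]) * dotp X w) = 0.
  apply: (etrans _ (etrans (congr1 (fun z => z * dotp X w) (tr bb)) (mul0r _))).
  rewrite mulr_suml; apply: eq_bigr => p _.
  by rewrite mulr_suml; apply: eq_bigr => q _; rewrite mulrA.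
have -> : \sum_a \sum_b' W (argl [:: unitv R a; unitv R b']) *
   T (argl [:: bb; unitv R b'; unitv R a]) =
  \sum_a \sum_b' W (argl [:: unitv R a; unitv R b']) *
    (Q (argl [:: bb; unitv R b'; unitv R a]) * dotp X w)
  - \sum_a \sum_b' W (argl [:: unitv R a; unitv R b']) *
    (Q (argl [:: bb; unitv R b'; w]) * dotp X (unitv R a))
  + \sum_a \sum_b' W (argl [:: unitv R a; unitv R b']) *
    (Q (argl [:: bb; unitv R a; w]) * dotp X (unitv R b'))
  - \sum_a \sum_b' W (argl [:: unitv R a; unitv R b']) *
    (Q (argl [:: unitv R b'; unitv R a; w]) * dotp X bb).
  rewrite -!sumrN -!big_split; apply: eq_bigr => p _ /=.
  rewrite -!sumrN -!big_split; apply: eq_bigr => q _ /=.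
  by rewrite TE !mulrDr !mulrN.
(* The two remaining terms add up to -2 [Z], and 3 (-2 [Z]) / 6 is - [Z]. *)
rewrite tr1 Z1 Z2 tr'.
by rewrite sub0r subr0; field.
Qed.

End FiveDim.

Lemma cancel_common (V : zmodType) (a b s : V) : a + s - (b + s) = a - b.
Proof. by rewrite opprD addrACA subrr addr0. Qed.

Lemma row_addE (R : nmodType) n (u v : 'rV[R]_n) l : (u + v) 0 l = u 0 l + v 0 l.
Proof. by rewrite mxE. Qed.

Lemma row_scaleE (R : pzRingType) n a (u : 'rV[R]_n) l : (a *: u) 0 l = a * u 0 l.
Proof. by rewrite mxE. Qed.

Lemma row_oppE (R : zmodType) n (u : 'rV[R]_n) l : (- u) 0 l = - u 0 l.
Proof. by rewrite mxE. Qed.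

(** * Directional derivatives and Cartan formulas *)

(* Sealed: otherwise every failed match of two derivatives unfolds them. *)
HB.lock Definition dird (R : realType) (n : nat) (u : 'rV[R]_n) (f : 'rV[R]_n -> R) (x : 'rV[R]_n) : R :=
  'D_u (f : 'rV[R]_n -> R^o) x.

HB.lock Definition dirdv (R : realType) (n : nat) (u : 'rV[R]_n) (Y : 'rV[R]_n -> 'rV[R]_n) (x : 'rV[R]_n) : 'rV[R]_n :=
  \row_l dird u (fun y => Y y 0 l) x.

Section DirectionalDerivatives.
Variables (R : realType) (n : nat) (N : set 'rV[R]_n).
Hypothesis oN : open N.
Notation V := 'rV[R]_n.
Implicit Types (f g : V -> R).

Lemma dird_def u f x : dird u f x = 'D_u (f : V -> R^o) x.
Proof. by rewrite dird.unlock. Qed.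

Section AtPoint.
Variables (x u : V).
Hypothesis Nx : N x.

Lemma dirdE f : smooth_on N f -> dird u f x = \sum_j u 0 j * partial j f x.
Proof. by move=> sf; rewrite dird_def; exact: (smooth_deriveE oN u sf Nx). Qed.

Lemma dird_eq f g : (forall y, N y -> f y = g y) -> dird u f x = dird u g x.
Proof.
move=> fg; rewrite !dird_def; apply: (@near_eq_derive _ _ R^o f g).
exact: filterS fg (near_open oN Nx).
Qed.

Lemma dird_cst a : dird u (fun=> a) x = 0.
Proof. by rewrite dird_def; exact: (@derive_cst _ V R^o a). Qed.

Lemma dirdD f g : smooth_on N f -> smooth_on N g ->
  dird u (fun y => f y + g y) x = dird u f x + dird u g x.
Proof.
move=> sf sg; rewrite !dird_def; apply: (@deriveD _ _ R^o f g); exact: (smooth_derivable oN).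
Qed.

Lemma dirdN f : smooth_on N f -> dird u (fun y => - f y) x = - dird u f x.
Proof. move=> sf; rewrite !dird_def; apply: (@deriveN _ _ R^o f); exact: (smooth_derivable oN). Qed.

Lemma dirdB f g : smooth_on N f -> smooth_on N g ->
  dird u (fun y => f y - g y) x = dird u f x - dird u g x.
Proof.
move=> sf sg; rewrite !dird_def; apply: (@deriveB _ _ R^o f g); exact: (smooth_derivable oN).
Qed.

Lemma dirdM f g : smooth_on N f -> smooth_on N g ->
  dird u (fun y => f y * g y) x = dird u f x * g x + f x * dird u g x.
Proof.
move=> sf sg; rewrite addrC [dird u f x * _]mulrC.
rewrite !dird_def; apply: (@deriveM _ _ f g); exact: (smooth_derivable oN).
Qed.

Lemma dird_sum (I : Type) (r : seq I) (F : I -> V -> R) :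
  (forall i, smooth_on N (F i)) ->
  dird u (fun y => \sum_(i <- r) F i y) x = \sum_(i <- r) dird u (F i) x.
Proof.
move=> sF; elim: r => [|i r IH].
  rewrite big_nil -[RHS](dird_cst 0); apply: dird_eq => y _; exact: big_nil.
rewrite big_cons -IH -dirdD//; last exact: smooth_sum.
by apply: dird_eq => y _; rewrite big_cons.
Qed.

Lemma dird_dir0 f : dird 0 f x = 0.
Proof. by rewrite dird_def; exact: (@derive0 _ V R^o f). Qed.

End AtPoint.

Lemma dird_args k (a : V -> alt R n k) (s t : 'I_k -> V) u v x : u = v -> s = t ->
  'D_u (fun y => a y s : R^o) x = dird v (fun y => a y t) x.
Proof. by rewrite dird_def => -> ->. Qed.

Lemma dird_dirP f x a u v : smooth_on N f -> N x ->
  dird (a *: u + v) f x = a * dird u f x + dird v f x.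
Proof.
move=> sf Nx; rewrite !dirdE// mulr_sumr -big_split; apply: eq_bigr => j _ /=.
by rewrite !mxE mulrDl mulrA.
Qed.

Lemma dird_dirD f x u v : smooth_on N f -> N x ->
  dird (u + v) f x = dird u f x + dird v f x.
Proof. by move=> sf Nx; rewrite -[u]scale1r dird_dirP// mul1r scale1r. Qed.

Lemma dird_dirZ f x a u : smooth_on N f -> N x -> dird (a *: u) f x = a * dird u f x.
Proof. by move=> sf Nx; rewrite -[a *: u]addr0 dird_dirP// dird_dir0 addr0. Qed.

Lemma dird_dirN f x u : smooth_on N f -> N x -> dird (- u) f x = - dird u f x.
Proof. by move=> sf Nx; rewrite -scaleN1r dird_dirZ// mulN1r. Qed.

Lemma smooth_dird f (Y : V -> V) : smooth_on N f -> smooth_map N Y ->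
  smooth_on N (fun x => dird (Y x) f x).
Proof.
move=> sf sY; have : smooth_on N (fun x => \sum_j Y x 0 j * partial j f x).
  by apply: smooth_sum => // j; apply: smoothM => //; exact: smooth_partial.
by apply: smooth_eq => // x Nx; rewrite dirdE.
Qed.

Lemma dirdvE (u : V) (Y : V -> V) x l : dirdv u Y x 0 l = dird u (fun y => Y y 0 l) x.
Proof. by rewrite dirdv.unlock mxE. Qed.

Lemma dirdv_dirD u v (Y : V -> V) x : smooth_map N Y -> N x ->
  dirdv (u + v) Y x = dirdv u Y x + dirdv v Y x.
Proof.
move=> sY Nx; apply/rowP => l; apply: (etrans (dirdvE _ _ _ _)).
apply: (etrans (dird_dirD _ _ (sY l) Nx)); apply: esym.
by apply: (etrans (row_addE _ _ _)); congr (_ + _); exact: dirdvE.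
Qed.

Lemma dirdv_dirZ a u (Y : V -> V) x : smooth_map N Y -> N x -> dirdv (a *: u) Y x = a *: dirdv u Y x.
Proof.
move=> sY Nx; apply/rowP => l; apply: (etrans (dirdvE _ _ _ _)).
apply: (etrans (dird_dirZ _ _ (sY l) Nx)); apply: esym.
by apply: (etrans (row_scaleE _ _ _)); congr (_ * _); exact: dirdvE.
Qed.

Lemma smooth_mapD (Y Z : V -> V) : smooth_map N Y -> smooth_map N Z -> smooth_map N (fun y => Y y + Z y).
Proof.
move=> sY sZ l; apply: smooth_eq (smoothD oN (sY l) (sZ l)) => // y _.
by rewrite row_addE.
Qed.

Lemma smooth_mapZ f (Y : V -> V) : smooth_on N f -> smooth_map N Y -> smooth_map N (fun y => f y *: Y y).
Proof.
move=> sf sY l; apply: smooth_eq (smoothM oN sf (sY l)) => // y _.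
by rewrite row_scaleE.
Qed.

Lemma dirdvD u (Y Z : V -> V) x : smooth_map N Y -> smooth_map N Z -> N x ->
  dirdv u (fun y => Y y + Z y) x = dirdv u Y x + dirdv u Z x.
Proof.
move=> sY sZ Nx; apply/rowP => l; apply: (etrans (dirdvE _ _ _ _)).
apply: (etrans (dird_eq u Nx (g := fun y => Y y 0 l + Z y 0 l) _)) => [y _|].
  exact: row_addE.
apply: (etrans (dirdD u Nx (sY l) (sZ l))); apply: esym.
by apply: (etrans (row_addE _ _ _)); congr (_ + _); exact: dirdvE.
Qed.

Lemma dirdvZ u f (Y : V -> V) x : smooth_on N f -> smooth_map N Y -> N x ->
  dirdv u (fun y => f y *: Y y) x = dird u f x *: Y x + f x *: dirdv u Y x.
Proof.
move=> sf sY Nx; apply/rowP => l; apply: (etrans (dirdvE _ _ _ _)).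
apply: (etrans (dird_eq u Nx (g := fun y => f y * Y y 0 l) _)) => [y _|].
  exact: row_scaleE.
apply: (etrans (dirdM u Nx sf (sY l))); apply: esym.
apply: (etrans (row_addE _ _ _)); congr (_ + _); first exact: row_scaleE.
by apply: (etrans (row_scaleE _ _ _)); congr (_ * _); exact: dirdvE.
Qed.

Definition lie (Y Z : V -> V) (x : V) : V := dirdv (Y x) Z x - dirdv (Z x) Y x.

(** An iterated derivative is a first-order term plus the Hessian of [f] on the two fields; the
    Hessians cancel by Schwarz's theorem. *)
Lemma dird_comm f Y Z x : smooth_on N f -> smooth_map N Y -> smooth_map N Z -> N x ->
  dird (Y x) (fun y => dird (Z y) f y) x - dird (Z x) (fun y => dird (Y y) f y) x
  = dird (lie Y Z x) f x.
Proof.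
move=> sf sY sZ Nx.
have E U W : smooth_map N U -> smooth_map N W -> dird (U x) (fun y => dird (W y) f y) x =
    dird (dirdv (U x) W x) f x +
    \sum_j \sum_i U x 0 i * W x 0 j * partial i (partial j f) x.
  move=> sU sW.
  rewrite (@dird_eq x _ Nx _ (fun y => \sum_j W y 0 j * partial j f y)); last first.
    by move=> y Ny; rewrite dirdE.
  rewrite dird_sum//; last by move=> j; apply: smoothM => //; exact: smooth_partial.
  rewrite dirdE// -big_split; apply: eq_bigr => j _ /=.
  rewrite dirdM//; last exact: smooth_partial.
  rewrite dirdvE; congr (_ + _); rewrite dirdE//; last exact: smooth_partial.
  by rewrite mulr_sumr; apply: eq_bigr => i _; rewrite mulrA [W x 0 j * _]mulrC.
rewrite !E// dird_dirD// dird_dirN//.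
have -> : \sum_j \sum_i Z x 0 i * Y x 0 j * partial i (partial j f) x
    = \sum_j \sum_i Y x 0 i * Z x 0 j * partial i (partial j f) x.
  rewrite exchange_big; apply: eq_bigr => i _; apply: eq_bigr => j _ /=.
  by rewrite (schwarz j i oN (sf 2%N) Nx) [Z x 0 i * _]mulrC.
exact: cancel_common.
Qed.

Definition smooth_form k (a : V -> alt R n k) : Prop :=
  (forall x, N x -> alternating (a x)) /\ (forall v, smooth_on N (fun x => a x v)).

Lemma form1_field (a : V -> alt R n 1) (Y : V -> V) y : alternating (a y) ->
  a y (argl [:: Y y]) = \sum_l Y y 0 l * a y (argl [:: unitv R l]).
Proof.
move=> ha; rewrite {1}[Y y]row_unitv form1_sum//; apply: eq_bigr => l _.
by rewrite form1Z.
Qed.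

Lemma smooth_form1 (a : V -> alt R n 1) (Y : V -> V) : smooth_form a -> smooth_map N Y ->
  smooth_on N (fun y => a y (argl [:: Y y])).
Proof.
move=> [ha sa] sY.
have : smooth_on N (fun y => \sum_l Y y 0 l * a y (argl [:: unitv R l])).
  by apply: smooth_sum => // l; exact: smoothM.
by apply: smooth_eq => // y Ny; rewrite form1_field//; exact: ha.
Qed.

(** [ext_diff] differentiates with frozen arguments, whereas Cartan's formulas differentiate along
    with moving ones; this accounts for the difference. *)
Lemma leibniz1 (a : V -> alt R n 1) (Y : V -> V) x u : smooth_form a -> smooth_map N Y -> N x ->
  dird u (fun y => a y (argl [:: Y y])) x =
  dird u (fun y => a y (argl [:: Y x])) x + a x (argl [:: dirdv u Y x]).
Proof.
move=> [ha sa] sY Nx.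
have E Z : smooth_map N Z -> dird u (fun y => a y (argl [:: Z y])) x =
    \sum_l (dird u (fun y => Z y 0 l) x * a x (argl [:: unitv R l])
            + Z x 0 l * dird u (fun y => a y (argl [:: unitv R l])) x).
  move=> sZ; rewrite (@dird_eq x _ Nx _ (fun y => \sum_l Z y 0 l * a y (argl [:: unitv R l]))).
    rewrite dird_sum//; last by move=> l; exact: smoothM.
    by apply: eq_bigr => l _; rewrite dirdM.
  by move=> y Ny; rewrite form1_field//; exact: ha.
rewrite (E Y)// (E (fun=> Y x)); last by move=> l; exact: smooth_cst.
rewrite big_split/= addrC; congr (_ + _).
  by apply: eq_bigr => l _; rewrite dird_cst mul0r add0r.
rewrite (form1_field (fun=> dirdv u Y x) (ha _ Nx)); apply: eq_bigr => l _.
by rewrite dirdvE.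
Qed.

Lemma smooth_map_cst (v : V) : smooth_map N (fun=> v).
Proof. by move=> l; exact: smooth_cst. Qed.

Lemma ext_diff1 (a : V -> alt R n 1) x u v :
  ext_diff a x (argl [:: u; v]) =
  dird u (fun y => a y (argl [:: v])) x - dird v (fun y => a y (argl [:: u])) x.
Proof.
rewrite /ext_diff !big_ord_recl big_ord0 addr0 expr0 mul1r expr1 mulN1r.
by congr (_ - _); apply: dird_args => //; apply/funext => i; rewrite (ord1 i).
Qed.

(** The derivatives of the arguments produced by [leibniz1] assemble into the Lie bracket. *)
Lemma cartan1 (a : V -> alt R n 1) (Y Z : V -> V) x :
  smooth_form a -> smooth_map N Y -> smooth_map N Z -> N x ->
  ext_diff a x (argl [:: Y x; Z x]) =
  dird (Y x) (fun y => a y (argl [:: Z y])) x - dird (Z x) (fun y => a y (argl [:: Y y])) x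
  - a x (argl [:: lie Y Z x]).
Proof.
move=> sa sY sZ Nx; have hx := sa.1 x Nx.
rewrite ext_diff1 (leibniz1 _ sa sZ Nx) (leibniz1 _ sa sY Nx) /lie form1D// form1N//.
by rewrite !opprD opprK; move: (dird _ _ _) (dird _ _ _) (a _ _) (a _ _) => p q r s; ring.
Qed.

Lemma ext_diff0 (f : V -> R) x u :
  ext_diff (fun y (_ : 'I_0 -> V) => f y) x (argl [:: u]) = dird u f x.
Proof. by rewrite dird_def /ext_diff big_ord_recl big_ord0 addr0 expr0 mul1r. Qed.

Lemma alternating_ext_diff1 (a : V -> alt R n 1) x : smooth_form a -> N x ->
  alternating (ext_diff a x).
Proof.
move=> [ha sa] Nx; split=> [v i c u w|v i j ij vij].
  have H p q : ext_diff a x (argl [:: p; q]) = - ext_diff a x (argl [:: q; p]).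
    by rewrite !ext_diff1 opprB.
  have L r p q s : ext_diff a x (argl [:: r *: p + q; s]) =
      r * ext_diff a x (argl [:: p; s]) + ext_diff a x (argl [:: q; s]).
    rewrite !ext_diff1 dird_dirP//.
    rewrite (@dird_eq x s Nx (fun y => a y (argl [:: r *: p + q]))
       (fun y => r * a y (argl [:: p]) + a y (argl [:: q]))); last first.
      by move=> y Ny; rewrite form1P//; exact: ha.
    have sr : smooth_on N (fun y => r * a y (argl [:: p])).
      by apply: smoothM => //; exact: smooth_cst.
    rewrite dirdD// dirdM//; last exact: smooth_cst.
    by rewrite dird_cst mul0r add0r; move: (dird _ _ _) (dird _ _ _) (dird _ _ _) (dird _ _ _) => *; ring.
  have [p [q ->]] := argl2E v; rewrite !upd_argl.
  case: i => -[|[|i]] hi; [exact: L| |by []].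
  have L2 r p' q' s : ext_diff a x (argl [:: s; r *: p' + q']) =
      r * ext_diff a x (argl [:: s; p']) + ext_diff a x (argl [:: s; q']).
    by rewrite (H s) L opprD -mulrN -!H.
  exact: L2.
have [p [q E]] := argl2E v; rewrite E in vij *.
have pq : p = q.
  by move: i j ij vij => [[|[|i]] hi] [[|[|j]] hj].
by rewrite pq ext_diff1 subrr.
Qed.

Lemma form3_field (a : V -> alt R n 3) (X Y Z : V -> V) y : alternating (a y) ->
  a y (argl [:: X y; Y y; Z y]) = \sum_i \sum_j \sum_l
    X y 0 i * (Y y 0 j * (Z y 0 l * a y (argl [:: unitv R i; unitv R j; unitv R l]))).
Proof.
move=> ha; rewrite {1}[X y]row_unitv form3_sum1//; apply: eq_bigr => i _.
rewrite form3_Z1// {1}[Y y]row_unitv form3_sum2// mulr_sumr; apply: eq_bigr => j _.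
rewrite form3_Z2// {1}[Z y]row_unitv form3_sum3// !mulr_sumr; apply: eq_bigr => l _.
by rewrite form3_Z3.
Qed.

Lemma smooth_form3 (a : V -> alt R n 3) (X Y Z : V -> V) : smooth_form a ->
  smooth_map N X -> smooth_map N Y -> smooth_map N Z ->
  smooth_on N (fun y => a y (argl [:: X y; Y y; Z y])).
Proof.
move=> [ha sa] sX sY sZ.
have : smooth_on N (fun y => \sum_i \sum_j \sum_l
    X y 0 i * (Y y 0 j * (Z y 0 l * a y (argl [:: unitv R i; unitv R j; unitv R l])))).
  do 3!(apply: smooth_sum => // ?).
  exact: (smoothM oN (sX _) (smoothM oN (sY _) (smoothM oN (sZ _) (sa _)))).
by apply: smooth_eq => // y Ny; rewrite form3_field//; exact: ha.
Qed.

Lemma leibniz3 (a : V -> alt R n 3) (X Y Z : V -> V) x u : smooth_form a ->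
  smooth_map N X -> smooth_map N Y -> smooth_map N Z -> N x ->
  dird u (fun y => a y (argl [:: X y; Y y; Z y])) x =
  dird u (fun y => a y (argl [:: X x; Y x; Z x])) x + a x (argl [:: dirdv u X x; Y x; Z x])
  + a x (argl [:: X x; dirdv u Y x; Z x]) + a x (argl [:: X x; Y x; dirdv u Z x]).
Proof.
move=> [ha sa] sX sY sZ Nx; pose b i j l y := a y (argl [:: unitv R i; unitv R j; unitv R l]).
have E X' Y' Z' : smooth_map N X' -> smooth_map N Y' -> smooth_map N Z' ->
    dird u (fun y => a y (argl [:: X' y; Y' y; Z' y])) x = \sum_i \sum_j \sum_l
    (dird u (fun y => X' y 0 i) x * (Y' x 0 j * (Z' x 0 l * b i j l x)) +
     X' x 0 i * (dird u (fun y => Y' y 0 j) x * (Z' x 0 l * b i j l x)) +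
     X' x 0 i * (Y' x 0 j * (dird u (fun y => Z' y 0 l) x * b i j l x)) +
     X' x 0 i * (Y' x 0 j * (Z' x 0 l * dird u (b i j l) x))).
  move=> sX' sY' sZ'.
  have s1 i j l : smooth_on N (fun y => Z' y 0 l * b i j l y) by exact: (smoothM oN (sZ' _) (sa _)).
  have s2 i j l : smooth_on N (fun y => Y' y 0 j * (Z' y 0 l * b i j l y)) by exact: (smoothM oN (sY' _) (s1 _ _ _)).
  have s3 i j l : smooth_on N (fun y => X' y 0 i * (Y' y 0 j * (Z' y 0 l * b i j l y))) by exact: (smoothM oN (sX' _) (s2 _ _ _)).
  rewrite (@dird_eq x _ Nx _ (fun y => \sum_i \sum_j \sum_l
      X' y 0 i * (Y' y 0 j * (Z' y 0 l * b i j l y)))); last first.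
    by move=> y Ny; rewrite form3_field//; exact: ha.
  rewrite dird_sum//; last by move=> i; do 2!(apply: smooth_sum => // ?).
  apply: eq_bigr => i _; rewrite dird_sum//; last by move=> j; apply: smooth_sum.
  apply: eq_bigr => j _; rewrite dird_sum//; apply: eq_bigr => l _.
  rewrite (dirdM u Nx (sX' _) (s2 i j l)) (dirdM u Nx (sY' _) (s1 i j l)).
  by rewrite (dirdM u Nx (sZ' _) (sa _)) !mulrDr !addrA.
rewrite (E X Y Z)// (E (fun=> X x) (fun=> Y x) (fun=> Z x)); try exact: smooth_map_cst.
have hx := ha _ Nx.
rewrite (form3_field (fun=> dirdv u X x) (fun=> Y x) (fun=> Z x) hx).
rewrite (form3_field (fun=> X x) (fun=> dirdv u Y x) (fun=> Z x) hx).
rewrite (form3_field (fun=> X x) (fun=> Y x) (fun=> dirdv u Z x) hx).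
do 3!(rewrite -!big_split; apply: eq_bigr => ? _ /=).
have rot (p q r s : R) : p + q + r + s = s + p + q + r by rewrite addrC !addrA.
rewrite !dird_cst !dirdvE /b !(mul0r, mulr0) !add0r; exact: rot.
Qed.

Lemma ext_diff3 (a : V -> alt R n 3) x v0 v1 v2 v3 :
  ext_diff a x (argl [:: v0; v1; v2; v3]) =
  dird v0 (fun y => a y (argl [:: v1; v2; v3])) x - dird v1 (fun y => a y (argl [:: v0; v2; v3])) x
  + dird v2 (fun y => a y (argl [:: v0; v1; v3])) x - dird v3 (fun y => a y (argl [:: v0; v1; v2])) x.
Proof.
have e2 : (-1) ^+ lift (@ord0 3) (lift ord0 ord0) = 1 :> R by rewrite -signr_odd.
have e3 : (-1) ^+ lift (@ord0 3) (lift ord0 (lift ord0 ord0)) = -1 :> R by rewrite -signr_odd.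
rewrite /ext_diff !big_ord_recl big_ord0 addr0 expr0 expr1 e2 e3 !mul1r !mulN1r !addrA.
by congr (_ - _ + _ - _); apply: dird_args => //; apply/funext => -[[|[|[|m]]] hm].
Qed.

Lemma cartan3 (a : V -> alt R n 3) (Y0 Y1 Y2 Y3 : V -> V) x :
  smooth_form a -> smooth_map N Y0 -> smooth_map N Y1 -> smooth_map N Y2 -> smooth_map N Y3 ->
  N x ->
  ext_diff a x (argl [:: Y0 x; Y1 x; Y2 x; Y3 x]) =
  dird (Y0 x) (fun y => a y (argl [:: Y1 y; Y2 y; Y3 y])) x
  - dird (Y1 x) (fun y => a y (argl [:: Y0 y; Y2 y; Y3 y])) x
  + dird (Y2 x) (fun y => a y (argl [:: Y0 y; Y1 y; Y3 y])) x
  - dird (Y3 x) (fun y => a y (argl [:: Y0 y; Y1 y; Y2 y])) x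
  - a x (argl [:: lie Y0 Y1 x; Y2 x; Y3 x]) + a x (argl [:: lie Y0 Y2 x; Y1 x; Y3 x])
  - a x (argl [:: lie Y0 Y3 x; Y1 x; Y2 x]) - a x (argl [:: lie Y1 Y2 x; Y0 x; Y3 x])
  + a x (argl [:: lie Y1 Y3 x; Y0 x; Y2 x]) - a x (argl [:: lie Y2 Y3 x; Y0 x; Y1 x]).
Proof.
move=> sa s0 s1 s2 s3 Nx; have hx := sa.1 x Nx.
rewrite ext_diff3 (leibniz3 (Y0 x) sa s1 s2 s3 Nx) (leibniz3 (Y1 x) sa s0 s2 s3 Nx).
rewrite (leibniz3 (Y2 x) sa s0 s1 s3 Nx) (leibniz3 (Y3 x) sa s0 s1 s2 Nx).
rewrite /lie !(form3_D1 hx).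
have N1 p q r : a x (argl [:: - p; q; r]) = - a x (argl [:: p; q; r]).
  by rewrite -scaleN1r form3_Z1// mulN1r.
rewrite !N1.
have P p q r : a x (argl [:: p; q; r]) = - a x (argl [:: q; p; r]) by exact: form3_anti12.
have C p q r : a x (argl [:: p; q; r]) = a x (argl [:: r; p; q]).
  by have [_ _ _ -> _] := form3_perms p q r hx.
(* The differentiated field is moved to the first slot, so that equal terms become literally
   equal. *)
rewrite !(P _ (dirdv _ _ _)) !(C _ _ (dirdv _ _ _)).
do ![move: (dird _ _ _) => ?]; do ![move: (a _ _) => ?].
ring.
Qed.

(** Linearity in the first slot and antisymmetry under the three adjacent transpositions suffice:
    they give linearity in the other slots and, 2 being invertible, vanishing on equal arguments. *)
Lemma alternating_ext_diff3 (a : V -> alt R n 3) x : smooth_form a -> N x ->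
  alternating (ext_diff a x).
Proof.
move=> [ha sa] Nx; pose A p q r s := ext_diff a x (argl [:: p; q; r; s]).
have swap (p q r : V) y : N y -> a y (argl [:: p; q; r]) = - a y (argl [:: q; p; r]).
  by move=> Ny; apply: form3_anti12; exact: ha.
have swap' (p q r : V) y : N y -> a y (argl [:: p; q; r]) = - a y (argl [:: p; r; q]).
  by move=> Ny; apply: form3_anti23; exact: ha.
have L (u p q r s : V) c : A (c *: u + p) q r s = c * A u q r s + A p q r s.
  rewrite /A !ext_diff3 (dird_dirP _ _ _ (sa _) Nx).
  have e k l w : dird w (fun y => a y (argl [:: c *: u + p; k; l])) x =
      c * dird w (fun y => a y (argl [:: u; k; l])) x + dird w (fun y => a y (argl [:: p; k; l])) x.
    rewrite (@dird_eq x w Nx _ (fun y => c * a y (argl [:: u; k; l]) + a y (argl [:: p; k; l]))).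
      rewrite (dirdD w Nx (smoothM oN (smooth_cst N c) (sa _)) (sa _)).
      by rewrite (dirdM w Nx (smooth_cst N c) (sa _)) dird_cst mul0r add0r.
    by move=> y Ny; rewrite form3_P1//; exact: ha.
  rewrite !e.
  by do ![move: (dird _ _ _) => ?]; ring.
have neg (f g : V -> R) w : smooth_on N g -> (forall y, N y -> f y = - g y) ->
    dird w f x = - dird w g x.
  by move=> sg fg; rewrite -(dirdN w Nx sg); exact: dird_eq.
have S12 p q r s : A p q r s = - A q p r s.
  rewrite /A !ext_diff3.
  rewrite (neg _ _ r (sa (argl [:: q; p; s])) (swap p q s)).
  rewrite (neg _ _ s (sa (argl [:: q; p; r])) (swap p q r)).
  by do ![move: (dird _ _ _) => ?]; ring.
have S23 p q r s : A p q r s = - A p r q s.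
  rewrite /A !ext_diff3.
  rewrite (neg _ _ p (sa (argl [:: r; q; s])) (swap q r s)).
  rewrite (neg _ _ s (sa (argl [:: p; r; q])) (swap' p q r)).
  by do ![move: (dird _ _ _) => ?]; ring.
have S34 p q r s : A p q r s = - A p q s r.
  rewrite /A !ext_diff3.
  rewrite (neg _ _ p (sa (argl [:: q; s; r])) (swap' q r s)).
  rewrite (neg _ _ q (sa (argl [:: p; s; r])) (swap' p r s)).
  by do ![move: (dird _ _ _) => ?]; ring.
have Z12 p r s : A p p r s = 0.
  by have /eqP := S12 p p r s; rewrite -subr_eq0 opprK -mulr2n mulrn_eq0 => /eqP.
have Z23 p q s : A q p p s = 0 by rewrite S12 S23 Z12 !oppr0.
have Z13 p q s : A p q p s = 0 by rewrite S23 Z12 oppr0.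
have Z34 p q r : A q r p p = 0 by rewrite S23 S34 Z23 !oppr0.
have Z24 p q r : A q p r p = 0 by rewrite S34 Z23 oppr0.
have Z14 p q r : A p q r p = 0 by rewrite S34 Z13 oppr0.
split=> [v i c u w|v i j ij vij].
  have [p [q [r [s ->]]]] := argl4E v; rewrite !upd_argl.
  case: i => -[|[|[|[|i]]]] hi; last by [].
  - exact: (L u w q r s c).
  - change (A p (c *: u + w) r s = c * A p u r s + A p w r s).
    by rewrite !(S12 p) L; ring.
  - change (A p q (c *: u + w) s = c * A p q u s + A p q w s).
    by rewrite !(S23 p q) !(S12 p) L; ring.
  - change (A p q r (c *: u + w) = c * A p q r u + A p q r w).
    by rewrite !(S34 p q r) !(S23 p q) !(S12 p) L; ring.
have [p [q [r [s E]]]] := argl4E v; rewrite E in vij *.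
rewrite -val_eqE /= in ij; rewrite /argl in vij.
move: i j ij vij => [[|[|[|[|i]]]] hi] [[|[|[|[|j]]]] hj] //= _ <-;
  rewrite -/(A _ _ _ _); move: (A) Z12 Z13 Z14 Z23 Z24 Z34 => A' *;
  match goal with H : forall _, _ |- _ => by rewrite H end.
Qed.

End DirectionalDerivatives.

(** Turns the directional derivatives into independent unknowns: the identities closed after it are
    polynomial in them. *)
Ltac gen_dird := repeat match goal with
  |- context [@dird.body ?R ?n ?u ?f ?x] =>
    let d := fresh "d" in generalize (@dird.body R n u f x); intro d
  end.

Ltac gen_dirdv := repeat match goal with
  |- context [@dirdv.body ?R ?n ?u ?f ?x] =>
    let d := fresh "d" in generalize (@dirdv.body R n u f x); intro d
  end.

(** * Connections in a commuting frame *)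

Section Frame.
Variables (R : realType) (N : set 'rV[R]_5).
Hypothesis oN : open N.
Notation V := 'rV[R]_5.
Variables E eps : 'I_5 -> V -> V.
Hypothesis sE : forall j, smooth_map N (E j).
Hypothesis dual : forall x, N x -> forall i j, \sum_a eps a x 0 i * E a x 0 j = (i == j)%:R.
Hypothesis comm : forall x, N x -> forall i j, lie (E i) (E j) x = 0.

(** The hypothesis [dual] says that one product of two square matrices is the identity; this is the
    product in the other order. *)
Lemma dualC x a b : N x -> dotp (E a x) (eps b x) = (a == b)%:R.
Proof.
move=> Nx; pose P := \matrix_(i < 5, a < 5) eps a x 0 i; pose Q := \matrix_(a < 5, j < 5) E a x 0 j.
have PQ : P *m Q = 1%:M.
  by apply/matrixP => i j; rewrite !mxE -(dual Nx); apply: eq_bigr => k _; rewrite !mxE.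
have /matrixP/(_ a b) := mulmx1C PQ; rewrite !mxE => <-.
by apply: eq_bigr => k _; rewrite !mxE.
Qed.

Lemma frame_expand x (v : V) : N x -> v = \sum_a dotp v (eps a x) *: E a x.
Proof.
move=> Nx; apply/rowP => j; rewrite summxE.
under eq_bigr do rewrite mxE /dotp mulr_suml.
rewrite exchange_big /= (bigD1 j)//= [X in _ + X]big1 ?addr0.
  under eq_bigr do rewrite -mulrA.
  by rewrite -mulr_sumr dual// eqxx mulr1.
move=> i ij; under eq_bigr do rewrite -mulrA.
by rewrite -mulr_sumr dual// (negbTE ij) mulr0.
Qed.

Lemma coframe_expand x (u : V) : N x -> u = \sum_a dotp u (E a x) *: eps a x.
Proof.
move=> Nx; apply/rowP => j; rewrite summxE.
under eq_bigr do rewrite mxE /dotp mulr_suml.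
have H i : \sum_a E a x 0 i * eps a x 0 j = (j == i)%:R.
  by rewrite -(dual Nx); apply: eq_bigr => a _; rewrite mulrC.
rewrite exchange_big /= (bigD1 j)//= [X in _ + X]big1 ?addr0.
  under eq_bigr do rewrite -mulrA.
  by rewrite -mulr_sumr H eqxx mulr1.
move=> i ij; under eq_bigr do rewrite -mulrA.
by rewrite -mulr_sumr H eq_sym (negbTE ij) mulr0.
Qed.

Definition vert (c2 c3 c4 : R) (x : V) : V := c2 *: E o2 x + c3 *: E o3 x + c4 *: E o4 x.

Notation D j f := (fun x => dird (E j x) f x).

Lemma smoothD_ j f : smooth_on N f -> smooth_on N (D j f).
Proof. by move=> sf; exact: smooth_dird. Qed.

Lemma D_comm i j f x : smooth_on N f -> N x -> D i (D j f) x = D j (D i f) x.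
Proof.
move=> sf Nx; apply/eqP; rewrite -subr_eq0; apply/eqP.
by rewrite (dird_comm oN sf (sE i) (sE j) Nx) comm// dird_dir0.
Qed.

Lemma dirdvE_comm x i j : N x -> dirdv (E i x) (E j) x = dirdv (E j x) (E i) x.
Proof. by move=> Nx; apply/eqP; rewrite -subr_eq0; apply/eqP; exact: comm. Qed.

Section Connection.
Variable Gam : 'I_5 -> 'I_5 -> V -> R.
Hypothesis sGam : forall i a, smooth_on N (Gam i a).

Definition hor (i : 'I_5) (x : V) : V :=
  E i x + vert (Gam i o2 x) (Gam i o3 x) (Gam i o4 x) x.

Lemma smooth_vert f2 f3 f4 : smooth_on N f2 -> smooth_on N f3 -> smooth_on N f4 ->
  smooth_map N (fun y => vert (f2 y) (f3 y) (f4 y) y).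
Proof.
move=> s2 s3 s4; have sZ := fun f a sf => smooth_mapZ oN (f := f) sf (sE a).
exact: (smooth_mapD oN (smooth_mapD oN (sZ _ o2 s2) (sZ _ o3 s3)) (sZ _ o4 s4)).
Qed.

Lemma smooth_hor i : smooth_map N (hor i).
Proof. exact: (smooth_mapD oN (sE i) (smooth_vert (sGam _ _) (sGam _ _) (sGam _ _))). Qed.

Definition hop i (f : V -> R) (x : V) : R :=
  D i f x + Gam i o2 x * D o2 f x + Gam i o3 x * D o3 f x + Gam i o4 x * D o4 f x.

Lemma dird_hor i f x : smooth_on N f -> N x -> dird (hor i x) f x = hop i f x.
Proof.
move=> sf Nx; rewrite /hor /vert !(dird_dirD oN _ _ sf Nx) !(dird_dirZ oN _ _ sf Nx).
by rewrite /hop !addrA.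
Qed.

Lemma dirdv_hor_dir i k x : N x -> dirdv (hor i x) (E k) x =
  dirdv (E i x) (E k) x + (Gam i o2 x *: dirdv (E o2 x) (E k) x +
   Gam i o3 x *: dirdv (E o3 x) (E k) x + Gam i o4 x *: dirdv (E o4 x) (E k) x).
Proof.
move=> Nx; have sk := sE k; rewrite /hor /vert (dirdv_dirD oN _ _ sk Nx).
by rewrite 2!(dirdv_dirD oN _ _ sk Nx) 3!(dirdv_dirZ oN _ _ sk Nx).
Qed.

Lemma dirdv_hor u i x : N x -> dirdv u (hor i) x =
  dirdv u (E i) x + vert (dird u (Gam i o2) x) (dird u (Gam i o3) x) (dird u (Gam i o4) x) x
  + (Gam i o2 x *: dirdv u (E o2) x + Gam i o3 x *: dirdv u (E o3) x + Gam i o4 x *: dirdv u (E o4) x).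
Proof.
move=> Nx; have sZ a : smooth_map N (fun y => Gam i a y *: E a y) by exact: (smooth_mapZ oN (sGam i a) (sE a)).
have s2 := smooth_mapD oN (sZ o2) (sZ o3).
rewrite (dirdvD oN u (sE i) (smooth_mapD oN s2 (sZ o4)) Nx) (dirdvD oN u s2 (sZ o4) Nx).
rewrite (dirdvD oN u (sZ o2) (sZ o3) Nx) !(dirdvZ oN u (sGam _ _) (sE _) Nx).
gen_dirdv; gen_dird.
by apply/rowP => l; rewrite /vert !(row_addE, row_oppE, row_scaleE); ring.
Qed.

(** As the frame commutes, only the derivatives of the coefficients of [hor i] are left. *)
Lemma lie_hor_vert i a x : N x -> lie (hor i) (E a) x =
  - vert (D a (Gam i o2) x) (D a (Gam i o3) x) (D a (Gam i o4) x) x.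
Proof.
move=> Nx; rewrite /lie dirdv_hor_dir// dirdv_hor//.
rewrite (dirdvE_comm i a Nx) !(dirdvE_comm _ a Nx).
gen_dirdv; gen_dird.
by apply/rowP => l; rewrite /vert !(row_addE, row_oppE, row_scaleE); ring.
Qed.

(** The component along [E c] of the curvature field [h_0, h_1], by [lie_hor]. *)
Definition curv c x := hop o0 (Gam o1 c) x - hop o1 (Gam o0 c) x.

Lemma lie_hor x : N x -> lie (hor o0) (hor o1) x =
  vert (curv o2 x) (curv o3 x) (curv o4 x) x.
Proof.
move=> Nx; rewrite /lie !dirdv_hor// !dirdv_hor_dir// /curv -!(dird_hor _ (sGam _ _) Nx).
rewrite (dirdvE_comm o1 o0 Nx) (dirdvE_comm o3 o2 Nx) (dirdvE_comm o4 o2 Nx) (dirdvE_comm o4 o3 Nx).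
rewrite !(dirdvE_comm _ o0 Nx) !(dirdvE_comm _ o1 Nx).
gen_dirdv; gen_dird.
by apply/rowP => l; rewrite /vert !(row_addE, row_oppE, row_scaleE); ring.
Qed.

Section OneForm.
Variable b : V -> alt R 5 1.
Hypothesis sb : smooth_form N b.

Definition cmp (j : 'I_5) (x : V) := b x (argl [:: E j x]).

Lemma smooth_cmp j : smooth_on N (cmp j).
Proof. exact: smooth_form1. Qed.

Lemma form1_vert x c2 c3 c4 : N x ->
  b x (argl [:: vert c2 c3 c4 x]) = c2 * cmp o2 x + c3 * cmp o3 x + c4 * cmp o4 x.
Proof.
move=> Nx; have hb := sb.1 x Nx.
by rewrite /vert !(form1D hb) !(form1Z hb).
Qed.

Lemma d1_vert i j x : N x -> ext_diff b x (argl [:: E i x; E j x]) = D i (cmp j) x - D j (cmp i) x.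
Proof.
move=> Nx; rewrite (cartan1 oN sb (sE i) (sE j) Nx) comm// form1_0 ?subr0//.
exact: sb.1.
Qed.

Lemma d1_hor_vert i a x : (forall y, N y -> b y (argl [:: hor i y]) = 0) -> N x ->
  ext_diff b x (argl [:: hor i x; E a x]) =
  hop i (cmp a) x + (D a (Gam i o2) x * cmp o2 x + D a (Gam i o3) x * cmp o3 x
                     + D a (Gam i o4) x * cmp o4 x).
Proof.
move=> bh Nx; have hb := sb.1 x Nx.
rewrite (cartan1 oN sb (smooth_hor i) (sE a) Nx) lie_hor_vert// form1N// form1_vert// opprK.
rewrite -/(cmp a) (dird_hor _ (smooth_cmp a) Nx).
rewrite (@dird_eq _ _ _ oN x _ Nx (fun y => b y (argl [:: hor i y])) (fun=> 0) bh).
by rewrite dird_cst subr0.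
Qed.

Section Horizontal.
Hypothesis bV : forall (a : 'I_5) y, N y -> (2 <= a)%N -> cmp a y = 0.

Lemma form1_vert0 x c2 c3 c4 : N x -> b x (argl [:: vert c2 c3 c4 x]) = 0.
Proof.
move=> Nx; rewrite form1_vert// (bV (a := o2) Nx isT) (bV (a := o3) Nx isT) (bV (a := o4) Nx isT).
by rewrite !mulr0 !addr0.
Qed.

Lemma cmp_hor i y : N y -> b y (argl [:: hor i y]) = cmp i y.
Proof.
move=> Ny; have hb := sb.1 y Ny.
by rewrite form1D// form1_vert0// addr0.
Qed.

Lemma d1h_hor_vert i (a : 'I_5) x : (2 <= a)%N -> N x ->
  ext_diff b x (argl [:: hor i x; E a x]) = - D a (cmp i) x.
Proof.
move=> a2 Nx; have hb := sb.1 x Nx.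
rewrite (cartan1 oN sb (smooth_hor i) (sE a) Nx) lie_hor_vert// form1N// form1_vert0//.
rewrite oppr0 subr0.
rewrite (@dird_eq _ _ _ oN x _ Nx (fun y => b y (argl [:: E a y])) (fun=> 0)); last first.
  by move=> y Ny; exact: bV.
rewrite dird_cst sub0r; congr (- _); apply: (dird_eq oN _ Nx) => y Ny.
exact: cmp_hor.
Qed.

Lemma d1h_hor x : N x ->
  ext_diff b x (argl [:: hor o0 x; hor o1 x]) = hop o0 (cmp o1) x - hop o1 (cmp o0) x.
Proof.
move=> Nx; rewrite (cartan1 oN sb (smooth_hor o0) (smooth_hor o1) Nx) lie_hor// form1_vert0//.
rewrite subr0 -!(dird_hor _ (smooth_cmp _) Nx).
by congr (_ - _); apply: (dird_eq oN _ Nx) => y Ny; exact: cmp_hor.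
Qed.

End Horizontal.
End OneForm.

Section ThreeForm.
Variable W : V -> alt R 5 3.
Hypothesis sW : smooth_form N W.
Hypothesis Wh : forall y (i : 'I_5) p q, N y -> (i < 2)%N -> W y (argl [:: hor i y; p; q]) = 0.

Definition dens x := W x (argl [:: E o2 x; E o3 x; E o4 x]).

Lemma smooth_dens : smooth_on N dens.
Proof. exact: smooth_form3. Qed.

Lemma Wh2 y (i : 'I_5) p q : N y -> (i < 2)%N -> W y (argl [:: p; hor i y; q]) = 0.
Proof. by move=> Ny i2; rewrite (form3_anti12 (sW.1 y Ny)) Wh// oppr0. Qed.

Lemma dird0 u x (f : V -> R) : N x -> (forall y, N y -> f y = 0) -> dird u f x = 0.
Proof. by move=> Nx f0; rewrite (dird_eq oN u Nx f0) dird_cst. Qed.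

Lemma W_vert x c2 c3 c4 p q : N x -> W x (argl [:: vert c2 c3 c4 x; p; q]) =
  c2 * W x (argl [:: E o2 x; p; q]) + c3 * W x (argl [:: E o3 x; p; q])
  + c4 * W x (argl [:: E o4 x; p; q]).
Proof.
move=> Nx; have hW := sW.1 x Nx.
by rewrite /vert !(form3_D1 hW) !(form3_Z1 hW).
Qed.

Lemma WN1 x p q r : N x -> W x (argl [:: - p; q; r]) = - W x (argl [:: p; q; r]).
Proof. by move=> Nx; rewrite -scaleN1r (form3_Z1 (sW.1 x Nx)) mulN1r. Qed.

(** In Cartan's formula [W] kills [hor i]. What remains is the derivative of the density along
    [hor i] and the brackets [h_i, E_a], each of which contributes its component along [E a]. *)
Lemma d3_hor (i : 'I_5) x : (i < 2)%N -> N x ->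
  ext_diff W x (argl [:: hor i x; E o2 x; E o3 x; E o4 x]) =
  hop i dens x + dens x * (D o2 (Gam i o2) x + D o3 (Gam i o3) x + D o4 (Gam i o4) x).
Proof.
move=> i2 Nx; have hW := sW.1 x Nx.
rewrite (cartan3 oN sW (smooth_hor i) (sE o2) (sE o3) (sE o4) Nx).
rewrite -[fun y => W y (argl [:: E o2 y; _; _])]/dens (dird_hor _ smooth_dens Nx).
have Z u p q : dird u (fun y => W y (argl [:: hor i y; E p y; E q y])) x = 0.
  by apply: dird0 => // y Ny; exact: Wh.
rewrite !Z.
rewrite !comm// !(form3_01 hW) !lie_hor_vert// !WN1// !W_vert//.
rewrite !(form3_alt12 hW) !(form3_alt13 hW).
rewrite (form3_anti12 hW (E o3 x)) -/(dens x).
have -> : W x (argl [:: E o4 x; E o2 x; E o3 x]) = dens x.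
  by have [_ _ _ -> _] := form3_perms (E o2 x) (E o3 x) (E o4 x) hW.
gen_dird; ring.
Qed.

(** A term that keeps a horizontal argument vanishes, and so does the bracket of [E a] and [E c];
    the bracket of the two horizontal fields is all that remains. *)
Lemma d3_hor2 (a c : 'I_5) x : (2 <= a)%N -> (2 <= c)%N -> N x ->
  ext_diff W x (argl [:: hor o0 x; hor o1 x; E a x; E c x]) =
  - W x (argl [:: vert (curv o2 x) (curv o3 x) (curv o4 x) x; E a x; E c x]).
Proof.
move=> a2 c2 Nx; have hW := sW.1 x Nx.
rewrite (cartan3 oN sW (smooth_hor o0) (smooth_hor o1) (sE a) (sE c) Nx).
have Z0 u p q : dird u (fun y => W y (argl [:: hor o0 y; p y; q y])) x = 0.
  by apply: dird0 => // y Ny; exact: Wh.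
have Z1 u p q : dird u (fun y => W y (argl [:: hor o1 y; p y; q y])) x = 0.
  by apply: dird0 => // y Ny; exact: Wh.
rewrite !Z0 Z1.
rewrite !comm// !(form3_01 hW) !(Wh2 (i := o0))// !(Wh2 (i := o1))// lie_hor//.
by rewrite !(addr0, subr0, sub0r).
Qed.

End ThreeForm.

End Connection.
End Frame.

Section DotProduct.
Variables (R : realType) (n : nat).
Implicit Types u v z : 'rV[R]_n.

Lemma dotpDl u v z : dotp (u + v) z = dotp u z + dotp v z.
Proof. by rewrite /dotp -big_split; apply: eq_bigr => l _; rewrite row_addE mulrDl. Qed.

Lemma dotpZl a u z : dotp (a *: u) z = a * dotp u z.
Proof. by rewrite /dotp mulr_sumr; apply: eq_bigr => l _; rewrite row_scaleE mulrA. Qed.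

Lemma dotpC u z : dotp u z = dotp z u.
Proof. by apply: eq_bigr => l _; rewrite mulrC. Qed.

End DotProduct.

(** * The equations of a Poisson triple in frame components *)

Section FrameEquations.
Variable R : realType.
Notation V := 'rV[R]_5.

Lemma alternating_scale n k (A : alt R n k) a : alternating A -> alternating (fun v => a * A v).
Proof.
move=> hA; split=> [v i c u w|v i j ij vij]; first by rewrite altP// mulrDr mulrCA.
by rewrite (alt_eq0 hA ij vij) mulr0.
Qed.

Lemma alternating_cat_r n k l (B : alt R n (k + l)) v : alternating B ->
  alternating (fun w : 'I_l -> 'rV[R]_n => B (cat_args v w)).
Proof.
move=> hB; have E w i u : cat_args v (upd w i u) = upd (cat_args v w) (rshift k i) u.
  apply/funext => m; rewrite /cat_args /upd; case: splitP => j mj.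
    by rewrite -val_eqE/= mj ltn_eqF// (leq_trans (ltn_ord j))// leq_addr.
  by rewrite -!val_eqE/= mj eqn_add2l.
split=> [w i a u x|w i j ij vij]; first by rewrite !E altP.
apply: (@alt_eq0 _ _ _ _ hB _ (rshift k i) (rshift k j)); first by rewrite eq_rshift.
by rewrite /cat_args -[rshift k i]/(unsplit (inr i)) -[rshift k j]/(unsplit (inr j)) !unsplitK.
Qed.

Lemma form2_frame0 (A : alt R 5 2) (f : 'I_5 -> V) : alternating A ->
  (forall u, exists c, u = \sum_j c j *: f j) -> (forall i j, A (argl [:: f i; f j]) = 0) ->
  forall v, A v = 0.
Proof.
move=> hA hf H v; have [p [q ->]] := argl2E v.
have [c ->] := hf p; have [d ->] := hf q.
rewrite form2_suml// big1// => i _; rewrite form2_Zl// form2_sumr// big1 ?mulr0// => j _.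
by rewrite form2_Zr// H mulr0.
Qed.

Lemma form4_anti n (A : alt R n 4) p q r s : alternating A ->
  [/\ A (argl [:: p; q; r; s]) = - A (argl [:: q; p; r; s]),
      A (argl [:: p; q; r; s]) = - A (argl [:: p; r; q; s]) &
      A (argl [:: p; q; r; s]) = - A (argl [:: p; q; s; r])].
Proof.
move=> hA.
have E (i j : 'I_4) (t : seq 'rV[R]_n) : i != j ->
    (forall l : 'I_4, nth 0 t (tperm i j l) = nth 0 [:: p; q; r; s] l) ->
    A (argl [:: p; q; r; s]) = - A (argl t).
  move=> ij H; rewrite -(alt_tperm hA (argl t) ij); congr A; apply/funext => l.
  by rewrite /argl H.
by split; [apply: (E (@Ordinal 4 0 isT) (@Ordinal 4 1 isT))|
  apply: (E (@Ordinal 4 1 isT) (@Ordinal 4 2 isT))|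
  apply: (E (@Ordinal 4 2 isT) (@Ordinal 4 3 isT))] => // -[[|[|[|[|l]]]] hl] //;
  case: tpermP => [/(congr1 val)|/(congr1 val)|/eqP + /eqP +] //=; rewrite -!val_eqE.
Qed.

Lemma form4_cyc n (A : alt R n 4) p q r s : alternating A ->
  A (argl [:: p; q; r; s]) = - A (argl [:: s; p; q; r]).
Proof.
move=> hA; have [_ _ ->] := form4_anti p q r s hA.
have [_ -> _] := form4_anti p q s r hA.
by have [-> _ _] := form4_anti p s q r hA; rewrite !opprK.
Qed.

Variable N : set 'rV[R]_5.
Hypothesis oN : open N.
Variables E eps : 'I_5 -> V -> V.
Hypothesis sE : forall j, smooth_map N (E j).
Hypothesis dual : forall x, N x -> forall i j, \sum_a eps a x 0 i * E a x 0 j = (i == j)%:R.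
Hypothesis comm : forall x, N x -> forall i j, lie (E i) (E j) x = 0.
Variable Gam : 'I_5 -> 'I_5 -> V -> R.
Hypothesis sGam : forall i a, smooth_on N (Gam i a).
Variable G : V -> V -> V.
Hypothesis Glin : forall x, N x -> forall a u v, G x (a *: u + v) = a *: G x u + G x v.
Hypothesis GV : forall x (a : 'I_5), N x -> (2 <= a)%N -> G x (E a x) = E a x.
Hypothesis GH : forall x (i : 'I_5), N x -> (i < 2)%N -> G x (hor E Gam i x) = 0.

Variables (W Q : V -> alt R 5 3) (b : V -> alt R 5 1) (K : V -> alt R 5 2) (k : V -> R) (w : V -> R).
Hypothesis sW : smooth_form N W.
Hypothesis Wh : forall y (i : 'I_5) p q, N y -> (i < 2)%N -> W y (argl [:: hor E Gam i y; p; q]) = 0.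
Hypothesis sb : smooth_form N b.
Hypothesis bh : forall (i : 'I_5) y, N y -> (i < 2)%N -> b y (argl [:: hor E Gam i y]) = 0.
Hypothesis sk : smooth_on N k.

Variable x : V.
Hypothesis Nx : N x.
Hypothesis hQ : alternating (Q x).
Hypothesis Q0 : forall p q, Q x (argl [:: eps o0 x; p; q]) = 0.
Hypothesis Q1 : forall p q, Q x (argl [:: eps o1 x; p; q]) = 0.
Hypothesis QW : Q x (argl [:: eps o2 x; eps o3 x; eps o4 x]) * dens E W x = -1.
Hypothesis hK : alternating (K x).
Hypothesis KH : forall p u, dotp (hor E Gam o0 x) u = 0 -> dotp (hor E Gam o1 x) u = 0 ->
  K x (argl [:: p; u]) = 0.
Hypothesis Kw : K x (argl [:: eps o0 x; eps o1 x]) * w x = -1.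

Notation h i := (hor E Gam i x).
Notation D j f := (dird (E j x) f x).
Notation rho := (dens E W).
Notation bet := (cmp E b).

(** The basis h_0, h_1, E_2, E_3, E_4 consists of purely horizontal and purely vertical vectors, so
    bidegree components can be read off on it. *)
Definition adapted (j : 'I_5) : V := if (j < 2)%N then h j else E j x.

Lemma adapted_span u : exists c, u = \sum_j c j *: adapted j.
Proof.
pose c a := dotp u (eps a x).
exists (fun a => c a - (2 <= a)%N%:R * (c o0 * Gam o0 a x + c o1 * Gam o1 a x)).
rewrite [LHS](frame_expand dual u Nx) -/(c _).
rewrite !sum5E /adapted /= /hor /vert.
move: (E o0 x) (E o1 x) (E o2 x) (E o3 x) (E o4 x) => e0 e1 e2 e3 e4.
by apply/rowP => l; rewrite !(row_addE, row_scaleE) /c; ring.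
Qed.

(** The coframe dual to [adapted]: replacing E_i by h_i alters eps_2, eps_3, eps_4 and leaves eps_0,
    eps_1 as they are. *)
Definition dualh (a : 'I_5) : V :=
  if (a < 2)%N then eps a x else eps a x - Gam o0 a x *: eps o0 x - Gam o1 a x *: eps o1 x.

Lemma dualh_dual i j : \sum_a dualh a 0 i * adapted a 0 j = (i == j)%:R.
Proof.
rewrite -(dual Nx) !sum5E /dualh /adapted /= /hor /vert.
rewrite !(row_addE, row_oppE, row_scaleE); ring.
Qed.

Lemma K_dualh (a : 'I_5) p : (2 <= a)%N -> K x (argl [:: p; dualh a]) = 0.
Proof.
move=> a2; have dd i : dotp (adapted i) (dualh a) = (i == a)%:R.
  exact: (@dualC R [set x] (fun j _ => adapted j) (fun j _ => dualh j)
           (fun _ _ => dualh_dual) x i a erefl).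
by apply: KH; [have := dd o0|have := dd o1]; rewrite /adapted /= => ->;
  rewrite -val_eqE /= eq_sym gtn_eqF// (leq_trans _ a2).
Qed.

Definition dW := ext_diff W x.
Definition db := ext_diff b x.

Lemma hdW : alternating dW. Proof. exact: (alternating_ext_diff3 oN). Qed.
Lemma hdb : alternating db. Proof. exact: (alternating_ext_diff1 oN). Qed.

Lemma rho_neq0 : rho x != 0.
Proof.
apply: contraTN isT => /eqP r0; move: QW; rewrite r0 mulr0 => /eqP.
by rewrite eq_sym oppr_eq0 oner_eq0.
Qed.

Lemma QE : Q x (argl [:: eps o2 x; eps o3 x; eps o4 x]) = - (rho x)^-1.
Proof. by apply: (mulIf rho_neq0); rewrite QW mulNr mulVf// rho_neq0. Qed.

Definition th : alt R 5 1 := fun v => - @iprod R 5 3 1 (Q x) (bicomp (G x) 1 dW) v.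

Lemma thE : th = fun v => - (rho x)^-1 * bicomp (G x) 1 dW (@cat_args _ _ 3 1 (argl [:: E o2 x; E o3 x; E o4 x]) v).
Proof.
apply/funext => v; rewrite /th.
rewrite (iprod3_frame (dual Nx) (A := Q x) (B := bicomp (G x) 1 dW : alt R 5 (3 + 1)))//.
  by rewrite opprK QE.
by apply: alternating_bicomp hdW _ => //; exact: Glin.
Qed.

Lemma hth : alternating th.
Proof.
rewrite thE; apply: alternating_scale; apply: (@alternating_cat_r 5 3 1).
by apply: alternating_bicomp hdW _ => //; exact: Glin.
Qed.

(** The value is the divergence of h_i with respect to the density rho. The sign of [QE] is
    compensated by moving h_i past three arguments. *)
Lemma th_hor (i : 'I_5) : (i < 2)%N -> th (argl [:: h i]) =
  (rho x)^-1 * hop E Gam i rho x + (D o2 (Gam i o2) + D o3 (Gam i o3) + D o4 (Gam i o4)).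
Proof.
move=> i2; rewrite thE (@cat_argl _ _ 3 1)//.
rewrite (@bicomp_argl _ _ _ _ _ _ [:: false; false; false; true] _ hdW)//; last first.
  by move=> -[|[|[|[|l]]]]// _; [exact: GV|exact: GV|exact: GV|exact: GH].
rewrite /= (form4_cyc _ _ _ _ hdW) mulrNN /dW (d3_hor oN sE comm sGam sW Wh i2 Nx) mulrDr mulrA.
by rewrite mulVf ?mul1r// rho_neq0.
Qed.

Lemma th_vert (a : 'I_5) : (2 <= a)%N -> th (argl [:: E a x]) = 0.
Proof.
move=> a2; rewrite thE (@cat_argl _ _ 3 1)//.
rewrite (@bicomp_argl _ _ _ _ _ _ [:: false; false; false; false] _ hdW)//; last first.
  by move=> -[|[|[|[|l]]]]// _; exact: GV.
by rewrite mulr0.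
Qed.

Definition eq2 (i a : 'I_5) : R := k x * (hop E Gam i (bet a) x
   + (D a (Gam i o2) * bet o2 x + D a (Gam i o3) * bet o3 x + D a (Gam i o4) * bet o4 x)
   - ((rho x)^-1 * hop E Gam i rho x + (D o2 (Gam i o2) + D o3 (Gam i o3) + D o4 (Gam i o4))) * bet a x).

Lemma bic_split p (l : seq bool) (s : seq V) m (A : alt R 5 m) : alternating A -> size l = m ->
  (forall i, (i < m)%N -> if nth false l i then exists2 j : 'I_5, (j < 2)%N & nth 0 s i = h j
                          else exists2 j : 'I_5, (2 <= j)%N & nth 0 s i = E j x) ->
  bicomp (G x) p A (argl s) = if count id l == p then A (argl s) else 0.
Proof.
move=> hA sl H; apply: bicomp_argl => // i im; have := H i im.
by case: ifP => _ [j j2 ->]; [exact: GH|exact: GV].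
Qed.

(** The form is of bidegree (1, 1). On two horizontal arguments [b] vanishes, on two vertical ones
    [th] does, and the first term vanishes in both cases; only the mixed pairs impose a
    condition. *)
Lemma eq2_iff :
  (forall v, k x * (bicomp (G x) 1 db v - wedge th (b x) v) = 0) <->
  (forall i a : 'I_5, (i < 2)%N -> (2 <= a)%N -> eq2 i a = 0).
Proof.
have hb := sb.1 x Nx.
have hB : alternating (bicomp (G x) 1 db).
  by apply: alternating_bicomp hdb _; exact: Glin.
have hv (i a : 'I_5) : (i < 2)%N -> (2 <= a)%N ->
    k x * (bicomp (G x) 1 db (argl [:: h i; E a x]) - wedge th (b x) (argl [:: h i; E a x])) = eq2 i a.
  move=> i2 a2; rewrite (bic_split 1 (l := [:: true; false]) hdb)//; last first.
    by move=> -[|[|l]]// _; [exists i|exists a].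
  rewrite (wedge11 _ _ _ hth) th_hor// th_vert// mul0r subr0 /db.
  by rewrite (d1_hor_vert oN sE comm sGam sb _ (fun y Ny => bh Ny i2) Nx).
split=> [H i a i2 a2|H]; first by rewrite -hv// H.
have hA : alternating (fun v => k x * (bicomp (G x) 1 db v - wedge th (b x) v)).
  apply: alternating_scale; apply: alternating_sub => //.
  by apply: (@alternating_wedge _ _ 1 1); [exact: hth|].
apply: (form2_frame0 hA adapted_span).
have hh (i j : 'I_5) : (i < 2)%N -> (j < 2)%N ->
    k x * (bicomp (G x) 1 db (argl [:: h i; h j]) - wedge th (b x) (argl [:: h i; h j])) = 0.
  move=> i2 j2; rewrite (bic_split 1 (l := [:: true; true]) hdb)//; last first.
    by move=> -[|[|l]]// _; [exists i|exists j].
  by rewrite (wedge11 _ _ _ hth) !bh// !mulr0 !subr0 mulr0.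
have vv (a c : 'I_5) : (2 <= a)%N -> (2 <= c)%N ->
    k x * (bicomp (G x) 1 db (argl [:: E a x; E c x]) - wedge th (b x) (argl [:: E a x; E c x])) = 0.
  move=> i2 j2; rewrite (bic_split 1 (l := [:: false; false]) hdb)//; last first.
    by move=> -[|[|l]]// _; [exists a|exists c].
  by rewrite (wedge11 _ _ _ hth) !th_vert// !mul0r !subr0 mulr0.
have vh (i a : 'I_5) : (i < 2)%N -> (2 <= a)%N ->
    k x * (bicomp (G x) 1 db (argl [:: E a x; h i]) - wedge th (b x) (argl [:: E a x; h i])) = 0.
  by move=> i2 a2; rewrite (form2_anti hA) hv// H// oppr0.
by move=> i j; rewrite /adapted; case: ltnP => i2; case: ltnP => j2;
  [exact: hh|rewrite hv// H|exact: vh|exact: vv].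
Qed.

Definition dk : alt R 5 1 := ext_diff (fun y (_ : 'I_0 -> V) => k y) x.

Lemma hdk : alternating dk.
Proof.
split=> [v i c u z|v i j]; last by rewrite !ord1 eqxx.
rewrite [v]argl1E !upd_argl (ord1 i) /= /dk !ext_diff0.
exact: (dird_dirP oN).
Qed.

Definition vrho : alt R 5 2 := fun v => @iprod R 5 2 2 (K x) (bicomp (G x) 2 dW) v.

Lemma w_neq0 : w x != 0.
Proof.
apply: contraTN isT => /eqP r0; move: Kw; rewrite r0 mulr0 => /eqP.
by rewrite eq_sym oppr_eq0 oner_eq0.
Qed.

Lemma KE : K x (argl [:: eps o0 x; eps o1 x]) = - (w x)^-1.
Proof. by apply: (mulIf w_neq0); rewrite Kw mulNr mulVf// w_neq0. Qed.

Lemma vrhoE : vrho = fun v => - (w x)^-1 * bicomp (G x) 2 dW (@cat_args _ _ 2 2 (argl [:: h o1; h o0]) v).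
Proof.
apply/funext => v; rewrite /vrho.
rewrite (iprod2_frame dualh_dual (A := K x) (B := bicomp (G x) 2 dW : alt R 5 (2 + 2)))//.
- by rewrite /dualh /= KE.
- by apply: alternating_bicomp hdW _ => //; exact: Glin.
- by move=> i p i2; exact: K_dualh.
Qed.

Lemma hvrho : alternating vrho.
Proof.
rewrite vrhoE; apply: alternating_scale; apply: (@alternating_cat_r 5 2 2).
by apply: alternating_bicomp hdW _ => //; exact: Glin.
Qed.

(** The contraction has already inserted h_1 and h_0, and a third horizontal argument exceeds the
    bidegree (2, 2). *)
Lemma vrho_hor (i : 'I_5) u : (i < 2)%N -> vrho (argl [:: h i; u]) = 0.
Proof.
move=> i2; have [c ->] := adapted_span u.
rewrite (form2_sumr hvrho) big1// => j _; rewrite (form2_Zr hvrho).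
rewrite vrhoE (@cat_argl _ _ 2 2)// /adapted; case: ltnP => j2.
  rewrite (bic_split 2 (l := [:: true; true; true; true]) hdW) ?mulr0//.
  by move=> -[|[|[|[|l]]]]// _; [exists o1|exists o0|exists i|exists j].
rewrite (bic_split 2 (l := [:: true; true; true; false]) hdW) ?mulr0//.
by move=> -[|[|[|[|l]]]]// _; [exists o1|exists o0|exists i|exists j].
Qed.

Lemma vrho_vert (a c : 'I_5) : (2 <= a)%N -> (2 <= c)%N -> vrho (argl [:: E a x; E c x]) =
  - (w x)^-1 * W x (argl [:: vert E (curv E Gam o2 x) (curv E Gam o3 x) (curv E Gam o4 x) x; E a x; E c x]).
Proof.
move=> a2 c2; rewrite vrhoE (@cat_argl _ _ 2 2)//.
rewrite (bic_split 2 (l := [:: true; true; false; false]) hdW)//; last first.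
  by move=> -[|[|[|[|l]]]]// _; [exists o1|exists o0|exists a|exists c].
rewrite /=; have [-> _ _] := form4_anti (h o1) (h o0) (E a x) (E c x) hdW.
by rewrite /dW (d3_hor2 oN sE comm sGam sW Wh a2 c2 Nx) opprK.
Qed.

Definition eq3 (a c : 'I_5) : R := D a k * bet c x - D c k * bet a x
  + k x ^+ 2 * ((w x)^-1 * W x (argl [:: vert E (curv E Gam o2 x) (curv E Gam o3 x) (curv E Gam o4 x) x; E a x; E c x])).

(** Both terms are of bidegree (0, 2), so the conditions come from pairs of vertical frame fields
    only. *)
Lemma eq3_iff :
  (forall v, wedge (bicomp (G x) 0 dk) (b x) v - k x ^+ 2 * vrho v = 0) <->
  (forall a c : 'I_5, (2 <= a)%N -> (2 <= c)%N -> eq3 a c = 0).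
Proof.
have hb := sb.1 x Nx.
have hB : alternating (bicomp (G x) 0 dk).
  by apply: alternating_bicomp hdk _; exact: Glin.
have vv (a c : 'I_5) : (2 <= a)%N -> (2 <= c)%N ->
    wedge (bicomp (G x) 0 dk) (b x) (argl [:: E a x; E c x])
    - k x ^+ 2 * vrho (argl [:: E a x; E c x]) = eq3 a c.
  move=> a2 c2; rewrite (wedge11 _ _ _ hB) vrho_vert//.
  rewrite (bic_split 0 (l := [:: false]) hdk)//; last by move=> -[|l]// _; exists a.
  rewrite (bic_split 0 (l := [:: false]) hdk)//; last by move=> -[|l]// _; exists c.
  by rewrite /= /dk !ext_diff0 mulNr mulrN opprK.
split=> [H a c a2 c2|H]; first by rewrite -vv// H.
have hA : alternating (fun v => wedge (bicomp (G x) 0 dk) (b x) v - k x ^+ 2 * vrho v).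
  apply: alternating_sub; last exact/alternating_scale/hvrho.
  exact: (@alternating_wedge _ _ 1 1).
apply: (form2_frame0 hA adapted_span).
have hu (i : 'I_5) u : (i < 2)%N -> wedge (bicomp (G x) 0 dk) (b x) (argl [:: h i; u])
    - k x ^+ 2 * vrho (argl [:: h i; u]) = 0.
  move=> i2; rewrite vrho_hor// (wedge11 _ _ _ hB) bh// !mulr0 !subr0.
  rewrite (bic_split 0 (l := [:: true]) hdk) ?mul0r//.
  by move=> -[|l]// _; exists i.
move=> i j; rewrite /adapted; case: ltnP => i2; first exact: hu.
case: ltnP => j2; last by rewrite vv// H.
by rewrite (form2_anti hA) hu// oppr0.
Qed.

End FrameEquations.

(** * Hamiltonian shift of a connection *)

(** For a cyclic triple (a, p, q) of vertical indices this is the component along E_a of X_f =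
    rho^-1 (beta x df), the vertical field g -> {f, g} of the bracket of P_beta. *)
HB.lock Definition hamiltonian (R : realType) (E : 'I_5 -> 'rV[R]_5 -> 'rV[R]_5)
    (bet : 'I_5 -> 'rV[R]_5 -> R) (rho : 'rV[R]_5 -> R) (p q : 'I_5) (f : 'rV[R]_5 -> R) : 'rV[R]_5 -> R :=
  fun y => (rho y)^-1 * (bet p y * dird (E q y) f y - bet q y * dird (E p y) f y).

Section HamiltonianShift.
Variables (R : realType) (N : set 'rV[R]_5).
Hypothesis oN : open N.
Notation V := 'rV[R]_5.
Variable E : 'I_5 -> V -> V.
Hypothesis sE : forall j, smooth_map N (E j).
Hypothesis comm : forall x, N x -> forall i j, lie (E i) (E j) x = 0.
Variable Gam : 'I_5 -> 'I_5 -> V -> R.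
Hypothesis sGam : forall i a, smooth_on N (Gam i a).
Variables (bet : 'I_5 -> V -> R) (rho : V -> R).
Hypothesis sbet : forall a, smooth_on N (bet a).
Hypothesis srho : smooth_on N rho.
Hypothesis rho0 : forall y, N y -> rho y != 0.

Notation D j f := (fun x => dird (E j x) f x).
Notation hop := (hop E).

Let sD j f : smooth_on N f -> smooth_on N (D j f).
Proof. exact: smoothD_. Qed.

Lemma dirdV f x u : (forall y, N y -> f y != 0) -> smooth_on N f -> N x ->
  dird u (fun y => (f y)^-1) x = - ((f x)^-1 ^+ 2 * dird u f x).
Proof.
move=> f0 sf Nx; have sV := smoothV oN f0 sf.
have : dird u (fun y => (f y)^-1 * f y) x = 0.
  rewrite -[RHS](dird_cst x u 1); apply: (dird_eq oN u Nx) => y Ny.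
  by rewrite mulVf// f0.
rewrite (dirdM oN u Nx sV sf) => /eqP; rewrite addr_eq0 => /eqP H.
by apply: (mulIf (f0 x Nx)); rewrite H mulNr expr2 -mulrA mulrAC mulrA mulVf ?f0// mul1r mulrC.
Qed.

Notation ham := (hamiltonian E bet rho).

Lemma hamE p q f : ham p q f = fun y => (rho y)^-1 * (bet p y * D q f y - bet q y * D p f y).
Proof. by rewrite hamiltonian.unlock. Qed.

Let sri := smoothV oN rho0 srho.

Lemma smooth_ham p q f : smooth_on N f -> smooth_on N (ham p q f).
Proof.
move=> sf; rewrite hamE; apply: (smoothM oN sri).
exact: (smoothB oN (smoothM oN (sbet _) (sD _ sf)) (smoothM oN (sbet _) (sD _ sf))).
Qed.

Lemma dird_ham p q f x u : smooth_on N f -> N x -> dird u (ham p q f) x =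
  - ((rho x)^-1 ^+ 2 * dird u rho x) * (bet p x * D q f x - bet q x * D p f x)
  + (rho x)^-1 * (dird u (bet p) x * D q f x + bet p x * dird u (D q f) x
                  - (dird u (bet q) x * D p f x + bet q x * dird u (D p f) x)).
Proof.
move=> sf Nx; have sm p' q' := smoothM oN (sbet p') (sD q' sf); rewrite hamE.
rewrite (dirdM oN u Nx sri (smoothB oN (sm p q) (sm q p))) (dirdV u rho0 srho Nx).
by rewrite (dirdB oN u Nx (sm p q) (sm q p)) !(dirdM oN u Nx (sbet _) (sD _ sf)).
Qed.

Lemma smooth_hop G' i f : (forall i a, smooth_on N (G' i a)) -> smooth_on N f -> smooth_on N (hop G' i f).
Proof.
move=> sG sf; have sm a := smoothM oN (sG i a) (sD a sf).
exact: (smoothD oN (smoothD oN (smoothD oN (sD _ sf) (sm _)) (sm _)) (sm _)).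
Qed.

(** The correction is the bracket [h_i, E_a] applied to [f]. *)
Lemma hop_D i a f x : smooth_on N f -> N x -> hop Gam i (D a f) x =
  D a (hop Gam i f) x - (D a (Gam i o2) x * D o2 f x + D a (Gam i o3) x * D o3 f x
                        + D a (Gam i o4) x * D o4 f x).
Proof.
move=> sf Nx; have sm a' := smoothM oN (sGam i a') (sD a' sf).
have P a' : dird (E a x) (fun y => Gam i a' y * D a' f y) x =
    D a (Gam i a') x * D a' f x + Gam i a' x * D a' (D a f) x.
  by apply: (etrans (dirdM oN _ Nx (sGam i a') (sD a' sf))); rewrite (D_comm oN sE comm a a' sf Nx).
have e : dird (E a x) (hop Gam i f) x = dird (E a x) (D i f) x
    + dird (E a x) (fun y => Gam i o2 y * D o2 f y) x + dird (E a x) (fun y => Gam i o3 y * D o3 f y) x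
    + dird (E a x) (fun y => Gam i o4 y * D o4 f y) x.
  have s2 := smoothD oN (sD i sf) (sm o2).
  apply: (etrans (dirdD oN _ Nx (smoothD oN s2 (sm o3)) (sm o4))); congr (_ + _).
  apply: (etrans (dirdD oN _ Nx s2 (sm o3))); congr (_ + _).
  exact: (dirdD oN _ Nx (sD i sf) (sm o2)).
have c := D_comm oN sE comm a i sf Nx; rewrite /= in c.
rewrite /= e !P c /hop; gen_dird; ring.
Qed.

(** The components of a cross product are permuted cyclically, so each identity is proved once for
    an arbitrary cyclic triple of vertical indices. *)
Definition cyclic3 (p q s : 'I_5) :=
  (p, q, s) \in [:: (o2, o3, o4); (o3, o4, o2); (o4, o2, o3)].

Lemma cyclic3_rot p q s : cyclic3 p q s -> cyclic3 q s p.
Proof. by rewrite /cyclic3 !inE => /or3P[] /eqP[-> -> ->]. Qed.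

Lemma cyclic3_first (a : 'I_5) : (2 <= a)%N -> exists q s, cyclic3 a q s.
Proof.
by case: (a) => -[|[|[|[|[|l]]]]] hl // _; [exists o3, o4|exists o4, o2|exists o2, o3].
Qed.

Lemma cyclic3_sum p q s (F : 'I_5 -> R) : cyclic3 p q s ->
  F o2 + F o3 + F o4 = F p + F q + F s.
Proof. by rewrite /cyclic3 !inE => /or3P[] /eqP[-> -> ->]//; ring. Qed.

Lemma hopE Gm i f p q s y : cyclic3 p q s -> hop Gm i f y =
  D i f y + (Gm i p y * D p f y + Gm i q y * D q f y + Gm i s y * D s f y).
Proof. by move=> /(cyclic3_sum (fun a => Gm i a y * D a f y)) <-; rewrite /hop !addrA. Qed.

(** The component along E_a of X_f for a = 2, 3, 4, the last branch being that of [o4]. *)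
Definition shift (f : V -> R) (a : 'I_5) : V -> R :=
  if a == o2 then ham o3 o4 f else if a == o3 then ham o4 o2 f else ham o2 o3 f.

Lemma shiftE f p q s : cyclic3 p q s -> shift f p = ham q s f.
Proof. by rewrite /cyclic3 !inE => /or3P[] /eqP[-> -> ->]. Qed.

Lemma smooth_shift f a : smooth_on N f -> smooth_on N (shift f a).
Proof. by move=> sf; rewrite /shift; case: ifP => _; [|case: ifP => _]; exact: smooth_ham. Qed.

Variable x : V.
Hypothesis Nx : N x.
Notation ri := (rho x)^-1.
Notation b a := (bet a x).
Notation Dx j f := (dird (E j x) f x).

(** The component on E_a of L_h beta - div(h) beta, with h = h_i and the divergence taken with
    respect to rho. It measures the failure of h to preserve the bivector P_beta. *)
Definition inv2 Gm i a := hop Gm i (bet a) x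
   + (Dx a (Gm i o2) * b o2 + Dx a (Gm i o3) * b o3 + Dx a (Gm i o4) * b o4)
   - (ri * hop Gm i rho x + (Dx o2 (Gm i o2) + Dx o3 (Gm i o3) + Dx o4 (Gm i o4))) * b a.

(** This is beta . curl beta, the obstruction to the Jacobi identity for P_beta. *)
Definition jacob p q s := b p * (Dx q (bet s) - Dx s (bet q)) + b q * (Dx s (bet p) - Dx p (bet s))
  + b s * (Dx p (bet q) - Dx q (bet p)).

(** For cyclic indices the left side is [inv2] for the field X_f in place of h_i. The second
    derivatives of [f] cancel and the Jacobi obstruction is left. *)
Lemma ham_preserves p q s f : smooth_on N f ->
  ham q s f x * Dx p (bet p) + ham s p f x * Dx q (bet p) + ham p q f x * Dx s (bet p)
  + (Dx p (ham q s f) * b p + Dx p (ham s p f) * b q + Dx p (ham p q f) * b s)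
  - (ri * (ham q s f x * Dx p rho + ham s p f x * Dx q rho + ham p q f x * Dx s rho)
     + (Dx p (ham q s f) + Dx q (ham s p f) + Dx s (ham p q f))) * b p
  = - ri * Dx p f * jacob p q s.
Proof.
move=> sf; rewrite !(dird_ham _ _ _ sf Nx) !hamE /jacob.
have c i j := D_comm oN sE comm i j sf Nx; rewrite /= in c.
rewrite (c q p) (c s p) (c s q).
gen_dird; move: (b p) (b q) (b s) ri => ? ? ? ?; ring.
Qed.

(** Pure elimination for [ham_hop]: [r] is 1/rho, [hr] is h_i rho, [T] the divergence of h_i, and
    the letters [app] to [ass] are derivatives of the coefficients of h_i. The hypotheses are the
    second equation and [hop_D]. *)
Lemma ham_hop_alg (r T hp hq h1 h2 app aqp aqq aqs asp asq ass bp bq bs fp fq fs Fq Fs hr : R) :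
  r * hr = T - (app + aqq + ass) ->
  hp = T * bq - (aqp * bp + aqq * bq + aqs * bs) ->
  hq = T * bs - (asp * bp + asq * bq + ass * bs) ->
  h1 = Fs - (asp * fp + asq * fq + ass * fs) ->
  h2 = Fq - (aqp * fp + aqq * fq + aqs * fs) ->
  - (r ^+ 2 * hr) * (bq * fs - bs * fq) + r * (hp * fs + bq * h1 - (hq * fq + bs * h2))
  - (r * (bq * fs - bs * fq) * app + r * (bs * fp - bp * fs) * aqp + r * (bp * fq - bq * fp) * asp)
  = r * (bq * Fs - bs * Fq).
Proof.
move=> e1 -> -> -> ->.
have -> : r ^+ 2 * hr = r * (T - (app + aqq + ass)) by rewrite -e1 expr2 mulrA.
ring.
Qed.

Lemma inv2E Gm i a p q s : cyclic3 p q s -> inv2 Gm i a = hop Gm i (bet a) x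
   + (Dx a (Gm i p) * b p + Dx a (Gm i q) * b q + Dx a (Gm i s) * b s)
   - (ri * hop Gm i rho x + (Dx p (Gm i p) + Dx q (Gm i q) + Dx s (Gm i s))) * b a.
Proof.
move=> h; rewrite /inv2 (cyclic3_sum (fun c => Dx a (Gm i c) * b c) h).
by rewrite (cyclic3_sum (fun c => Dx c (Gm i c)) h).
Qed.

Lemma hop_DE i a f p q s : cyclic3 p q s -> smooth_on N f -> hop Gam i (D a f) x =
  Dx a (hop Gam i f) - (Dx a (Gam i p) * Dx p f + Dx a (Gam i q) * Dx q f
                        + Dx a (Gam i s) * Dx s f).
Proof.
move=> h sf; apply: (etrans (hop_D i a sf Nx)); congr (_ - _).
exact: (cyclic3_sum (fun c => Dx a (Gam i c) * Dx c f) h).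
Qed.

(** The subtracted sum is X_f applied to the coefficient Gam_i^p, so the left side is the component
    along E_p of [h_i, X_f]. Invariance of P_beta under h_i enters at the point [x] only. *)
Lemma ham_hop p q s i f : cyclic3 p q s -> smooth_on N f ->
  (forall a : 'I_5, (2 <= a)%N -> inv2 Gam i a = 0) ->
  hop Gam i (ham q s f) x - (ham q s f x * Dx p (Gam i p) + ham s p f x * Dx q (Gam i p)
      + ham p q f x * Dx s (Gam i p)) = ham q s (hop Gam i f) x.
Proof.
move=> h sf i0.
have ge2 a q' s' : cyclic3 a q' s' -> (2 <= a)%N by rewrite /cyclic3 !inE => /or3P[] /eqP[-> _ _].
have hq := cyclic3_rot h; have hs := cyclic3_rot hq.
have eq_ := i0 q (ge2 _ _ _ hq); have es_ := i0 s (ge2 _ _ _ hs).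
rewrite (inv2E _ _ _ h) in eq_; rewrite (inv2E _ _ _ h) in es_.
rewrite -(dird_hor oN E Gam i (smooth_ham q s sf) Nx) (dird_ham q s (hor E Gam i x) sf Nx).
rewrite (dird_hor oN E Gam i srho Nx) !(dird_hor oN E Gam i (sbet _) Nx).
rewrite !(dird_hor oN E Gam i (sD _ sf) Nx) !hamE.
have H := @ham_hop_alg ri (ri * hop Gam i rho x + (Dx p (Gam i p) + Dx q (Gam i q) + Dx s (Gam i s)))
  (hop Gam i (bet q) x) (hop Gam i (bet s) x) (hop Gam i (D s f) x) (hop Gam i (D q f) x)
  (Dx p (Gam i p)) (Dx q (Gam i p)) (Dx q (Gam i q)) (Dx q (Gam i s))
  (Dx s (Gam i p)) (Dx s (Gam i q)) (Dx s (Gam i s)) (b p) (b q) (b s) (Dx p f) (Dx q f) (Dx s f)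
  (Dx q (hop Gam i f)) (Dx s (hop Gam i f)) (hop Gam i rho x).
have swap (u v t : R) : u + v - t = 0 -> u = t - v.
  by move=> e; apply/eqP; rewrite -subr_eq0 opprB addrA e.
apply: H.
- by rewrite addrK.
- exact: swap.
- exact: swap.
- exact: hop_DE.
- exact: hop_DE.
Qed.

Lemma ham_bracket p q s f g : cyclic3 p q s -> smooth_on N f -> smooth_on N g ->
  jacob p q s = 0 ->
  let B := fun y => (rho y)^-1 * (bet p y * (D q f y * D s g y - D s f y * D q g y)
     + bet q y * (D s f y * D p g y - D p f y * D s g y)
     + bet s y * (D p f y * D q g y - D q f y * D p g y)) in
  ham q s f x * Dx p (ham q s g) + ham s p f x * Dx q (ham q s g) + ham p q f x * Dx s (ham q s g)
  - (ham q s g x * Dx p (ham q s f) + ham s p g x * Dx q (ham q s f) + ham p q g x * Dx s (ham q s f))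
  = ham q s B x.
Proof.
move=> h sf sg J0 B.
have sc a c : smooth_on N (fun y => D a f y * D c g y) by exact: (smoothM oN (sD a sf) (sD c sg)).
have sd a c := smoothB oN (sc a c) (sc c a).
have sm a c e := smoothM oN (sbet a) (sd c e).
have dB u : dird u B x = - (ri ^+ 2 * dird u rho x) *
   (b p * (Dx q f * Dx s g - Dx s f * Dx q g) + b q * (Dx s f * Dx p g - Dx p f * Dx s g)
    + b s * (Dx p f * Dx q g - Dx q f * Dx p g))
  + ri * (dird u (bet p) x * (Dx q f * Dx s g - Dx s f * Dx q g)
          + b p * (dird u (D q f) x * Dx s g + Dx q f * dird u (D s g) x
                   - (dird u (D s f) x * Dx q g + Dx s f * dird u (D q g) x))
          + (dird u (bet q) x * (Dx s f * Dx p g - Dx p f * Dx s g)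
          + b q * (dird u (D s f) x * Dx p g + Dx s f * dird u (D p g) x
                   - (dird u (D p f) x * Dx s g + Dx p f * dird u (D s g) x)))
          + (dird u (bet s) x * (Dx p f * Dx q g - Dx q f * Dx p g)
          + b s * (dird u (D p f) x * Dx q g + Dx p f * dird u (D q g) x
                   - (dird u (D q f) x * Dx p g + Dx q f * dird u (D p g) x)))).
  have s2 := smoothD oN (sm p q s) (sm q s p).
  rewrite (dirdM oN u Nx sri (smoothD oN s2 (sm s p q))) (dirdV u rho0 srho Nx).
  rewrite (dirdD oN u Nx s2 (sm s p q)) (dirdD oN u Nx (sm p q s) (sm q s p)).
  rewrite !(dirdM oN u Nx (sbet _) (sd _ _)) !(dirdB oN u Nx (sc _ _) (sc _ _)).
  by rewrite !(dirdM oN u Nx (sD _ sf) (sD _ sg)).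
rewrite !(dird_ham _ _ _ sf Nx) !(dird_ham _ _ _ sg Nx) !hamE !dB.
have cf i j := D_comm oN sE comm i j sf Nx; rewrite /= in cf.
have cg i j := D_comm oN sE comm i j sg Nx; rewrite /= in cg.
rewrite !(cf q p) !(cf s p) !(cf s q) !(cg q p) !(cg s p) !(cg s q).
apply/eqP; rewrite -subr_eq0; apply/eqP.
(* The two sides differ by this factor times beta . curl beta. *)
rewrite -[RHS](mulr0 (- ri ^+ 2 * (Dx q f * Dx s g - Dx s f * Dx q g))) -J0 /jacob.
gen_dird; move: (b p) (b q) (b s) ri => ? ? ? ?; ring.
Qed.

(** The bracket {f, g} of P_beta, that is rho^-1 beta . (df x dg). *)
Definition brk p q s (f g : V -> R) (y : V) : R :=
  (rho y)^-1 * (bet p y * (D q f y * D s g y - D s f y * D q g y)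
     + bet q y * (D s f y * D p g y - D p f y * D s g y)
     + bet s y * (D p f y * D q g y - D q f y * D p g y)).

Lemma brk_cyclic p q s f g : cyclic3 p q s -> brk p q s f g = brk o2 o3 o4 f g.
Proof.
by rewrite /cyclic3 !inE => /or3P[] /eqP[-> -> ->]//; apply/funext => y; rewrite /brk; congr (_ * _);
  gen_dird; ring.
Qed.

Lemma smooth_brk f g : smooth_on N f -> smooth_on N g -> smooth_on N (brk o2 o3 o4 f g).
Proof.
move=> sf sg; have sc a c : smooth_on N (fun y => D a f y * D c g y) by exact: (smoothM oN (sD a sf) (sD c sg)).
have sd a c := smoothB oN (sc a c) (sc c a).
have sm a c e := smoothM oN (sbet a) (sd c e).
exact: (smoothM oN sri (smoothD oN (smoothD oN (sm _ _ _) (sm _ _ _)) (sm _ _ _))).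
Qed.

Lemma jacob_cyclic p q s : cyclic3 p q s -> jacob p q s = jacob o2 o3 o4.
Proof.
by rewrite /cyclic3 !inE => /or3P[] /eqP[-> -> ->]//; rewrite /jacob; gen_dird; ring.
Qed.

Lemma hamD p q f g y : smooth_on N f -> smooth_on N g -> N y ->
  ham p q (fun z => f z + g z) y = ham p q f y + ham p q g y.
Proof.
move=> sf sg Ny; rewrite !hamE !(dirdD oN _ Ny sf sg).
gen_dird; ring.
Qed.

Lemma hamB p q f g y : smooth_on N f -> smooth_on N g -> N y ->
  ham p q (fun z => f z - g z) y = ham p q f y - ham p q g y.
Proof.
move=> sf sg Ny; rewrite !hamE !(dirdB oN _ Ny sf sg).
gen_dird; ring.
Qed.

Variables (k c vk w : V -> R) (mu : 'I_5 -> V -> R).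
Hypothesis sk : smooth_on N k.
Hypothesis sc : smooth_on N c.
Hypothesis svk : smooth_on N vk.
Hypothesis sw : smooth_on N w.
Hypothesis smu : forall i, smooth_on N (mu i).
Hypothesis J0 : jacob o2 o3 o4 = 0.
Hypothesis H2 : forall i a : 'I_5, (i < 2)%N -> (2 <= a)%N -> k x * inv2 Gam i a = 0.
Hypothesis H3 : forall p q s, cyclic3 p q s ->
  Dx q k * b s - Dx s k * b q + k x ^+ 2 * ((w x)^-1 * (rho x * curv E Gam p x)) = 0.
Hypothesis w0 : w x != 0.
Hypothesis Hw : forall a : 'I_5, (2 <= a)%N -> Dx a w = 0.
Hypothesis Hv : forall y, N y -> vk y * w y =
  hop Gam o0 (mu o1) y - hop Gam o1 (mu o0) y + brk o2 o3 o4 (mu o0) (mu o1) y.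
Hypothesis Hc : forall q s : 'I_5, (2 <= q)%N -> (2 <= s)%N -> Dx q c * b s - Dx s c * b q = 0.
Hypothesis u0 : forall y, N y -> 1 - k y * (vk y - c y) != 0.

Definition kshift (y : V) : R := k y / (1 - k y * (vk y - c y)).
Definition Gshift i a (y : V) : R := Gam i a y + shift (mu i) a y.

Lemma smooth_Gshift i a : smooth_on N (Gshift i a).
Proof. exact: (smoothD oN (sGam i a) (smooth_shift a (smu i))). Qed.

Lemma dird_Gshift i p q s u : cyclic3 p q s ->
  dird u (Gshift i p) x = dird u (Gam i p) x + dird u (ham q s (mu i)) x.
Proof.
move=> h; rewrite -(shiftE (mu i) h).
exact: (dirdD oN u Nx (sGam i p) (smooth_shift p (smu i))).
Qed.

Lemma hop_Gshift i p q s f : cyclic3 p q s -> hop Gshift i f x = hop Gam i f x +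
  (ham q s (mu i) x * Dx p f + ham s p (mu i) x * Dx q f + ham p q (mu i) x * Dx s f).
Proof.
move=> h; have h' := cyclic3_rot h; have h'' := cyclic3_rot h'.
rewrite !(hopE _ _ _ _ h) /Gshift (shiftE _ h) (shiftE _ h') (shiftE _ h'') /=.
gen_dird; ring.
Qed.

(** For fixed beta and rho the expression [inv2] is additive in the field: one hypothesis is for
    h_i, the other for the vertical field added to it. *)
Lemma shift_inv2_alg (h1 h2 r d1 d2 d3 e1 e2 e3 m1 m2 m3 n1 n2 n3 A B b1 b2 b3 : R) :
  h1 + (d1 * b1 + d2 * b2 + d3 * b3) - (r * h2 + (e1 + e2 + e3)) * b1 = 0 ->
  A + (m1 * b1 + m2 * b2 + m3 * b3) - (r * B + (n1 + n2 + n3)) * b1 = 0 ->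
  h1 + A + ((d1 + m1) * b1 + (d2 + m2) * b2 + (d3 + m3) * b3)
   - (r * (h2 + B) + (e1 + n1 + (e2 + n2) + (e3 + n3))) * b1 = 0.
Proof.
move=> e f; rewrite -[RHS](addr0 0) -{1}e -f; ring.
Qed.

Lemma cyclic3_ge2 a p q : cyclic3 a p q -> (2 <= a)%N.
Proof. by rewrite /cyclic3 !inE => /or3P[] /eqP[-> _ _]. Qed.

Lemma shift_eq2 (i a : 'I_5) : (i < 2)%N -> (2 <= a)%N -> kshift x * inv2 Gshift i a = 0.
Proof.
(* At a zero of kappa the new kappa vanishes too; elsewhere the factor kappa can be removed from the
   second equation. *)
move=> i2 a2; have [k0|k0] := eqVneq (k x) 0; first by rewrite /kshift k0 !mul0r.
have i0 := mulfI k0 (etrans (H2 i2 a2) (esym (mulr0 _))).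
have [q [s h]] := cyclic3_first a2.
have h' := cyclic3_rot h; have h'' := cyclic3_rot h'.
have P := ham_preserves a q s (smu i).
rewrite (jacob_cyclic h) J0 mulr0 in P; rewrite (inv2E _ _ _ h) in i0.
rewrite (inv2E _ _ _ h) !(hop_Gshift _ _ h).
rewrite !(dird_Gshift _ _ h) !(dird_Gshift _ _ h') !(dird_Gshift _ _ h'').
by rewrite (shift_inv2_alg i0 P) mulr0.
Qed.

(** With v = 1/(1 - kappa t) and t = varkappa - c one has d(kappa v) = v^2 (d kappa + kappa^2 dt).
    The new left side is thus v^2 times the old one: the change of curvature absorbs d varkappa, and
    dc x beta = 0. *)
Lemma shift_eq3_alg (k' v t Kq Ks Vq Vs Cq Cs bq bs Z Z' : R) :
  v * (1 - k' * t) = 1 -> Kq * bs - Ks * bq + k' ^+ 2 * Z = 0 -> Cq * bs - Cs * bq = 0 ->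
  k' ^+ 2 * Z' = k' ^+ 2 * (Z + (bq * Vs - bs * Vq)) ->
  (Kq * v + k' * - (v ^+ 2 * - (Kq * t + k' * (Vq - Cq)))) * bs
  - (Ks * v + k' * - (v ^+ 2 * - (Ks * t + k' * (Vs - Cs)))) * bq + (k' * v) ^+ 2 * Z' = 0.
Proof.
move=> e1 e2 e3 e4.
have -> : (k' * v) ^+ 2 * Z' = v ^+ 2 * (k' ^+ 2 * (Z + (bq * Vs - bs * Vq))) by rewrite -e4; ring.
have K (y : R) : y * v = y * (v ^+ 2 * (1 - k' * t)) by rewrite expr2 -mulrA e1 mulr1.
rewrite (K Kq) (K Ks).
transitivity (v ^+ 2 * (Kq * bs - Ks * bq + k' ^+ 2 * Z) - v ^+ 2 * k' ^+ 2 * (Cq * bs - Cs * bq)).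
  ring.
by rewrite e2 e3 !mulr0 subr0.
Qed.

(** [h_0 + X_0, h_1 + X_1] - [h_0, h_1] is [h_0, X_1] - [h_1, X_0] + [X_0, X_1], the field of the
    function h_0 mu_1 - h_1 mu_0 + {mu_0, mu_1} = w varkappa. The factor w comes out because it is
    constant along the fibres. *)
Lemma curv_Gshift p q s : cyclic3 p q s -> k x != 0 ->
  rho x * (curv E Gshift p x - curv E Gam p x) = w x * (b q * Dx s vk - b s * Dx q vk).
Proof.
move=> h k0; have i0 (i a : 'I_5) : (i < 2)%N -> (2 <= a)%N -> inv2 Gam i a = 0.
  by move=> i2 a2; exact: (mulfI k0 (etrans (H2 i2 a2) (esym (mulr0 _)))).
have s0 := smooth_hop o0 sGam (smu o1); have s1 := smooth_hop o1 sGam (smu o0).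
have sB := smooth_brk (smu o0) (smu o1).
have L1 := ham_hop h (smu o1) (i0 o0 ^~ isT); have L2 := ham_hop h (smu o0) (i0 o1 ^~ isT).
have L3 := ham_bracket h (smu o0) (smu o1) (etrans (jacob_cyclic h) J0).
rewrite /= -/(brk p q s (mu o0) (mu o1)) (brk_cyclic _ _ h) in L3.
have hS : ham q s (fun y => vk y * w y) x = ham q s (hop Gam o0 (mu o1)) x
    - ham q s (hop Gam o1 (mu o0)) x + ham q s (brk o2 o3 o4 (mu o0) (mu o1)) x.
  rewrite -(hamB q s s0 s1 Nx) -(hamD q s (smoothB oN s0 s1) sB Nx) !hamE.
  by congr (_ * (_ * _ - _ * _)); apply: (dird_eq oN _ Nx).
have hE : ham q s (fun y => vk y * w y) x = ri * (w x * (b q * Dx s vk - b s * Dx q vk)).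
  rewrite hamE !(dirdM oN _ Nx svk sw) (Hw (cyclic3_ge2 (cyclic3_rot h))).
  rewrite (Hw (cyclic3_ge2 (cyclic3_rot (cyclic3_rot h)))); gen_dird; ring.
have hop_s i j : hop Gshift i (Gshift j p) x = hop Gam i (Gam j p) x + hop Gam i (ham q s (mu j)) x
   + (ham q s (mu i) x * Dx p (Gam j p) + ham s p (mu i) x * Dx q (Gam j p) + ham p q (mu i) x * Dx s (Gam j p))
   + (ham q s (mu i) x * Dx p (ham q s (mu j)) + ham s p (mu i) x * Dx q (ham q s (mu j))
      + ham p q (mu i) x * Dx s (ham q s (mu j))).
  rewrite (hop_Gshift _ _ h) !(hopE Gam _ _ _ h) !(dird_Gshift _ _ h).
  gen_dird; ring.
have -> : curv E Gshift p x - curv E Gam p x = ham q s (fun y => vk y * w y) x.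
  rewrite hS -L1 -L2 -L3 /curv !hop_s.
  by move: (hop _ _ _) => h1; gen_dird; ring.
by rewrite hE mulrA mulfV ?mul1r// rho0.
Qed.

Lemma dird_kshift u : dird u kshift x = dird u k x * (1 - k x * (vk x - c x))^-1
  + k x * - ((1 - k x * (vk x - c x))^-1 ^+ 2 *
      - (dird u k x * (vk x - c x) + k x * (dird u vk x - dird u c x))).
Proof.
have sd := smoothB oN svk sc; have skd := smoothM oN sk sd.
have su := smoothB oN (smooth_cst N 1) skd.
rewrite (dirdM oN u Nx sk (smoothV oN u0 su)) (dirdV u u0 su Nx).
rewrite (dirdB oN u Nx (smooth_cst N 1) skd) (dirdM oN u Nx sk sd) (dirdB oN u Nx svk sc).
by rewrite dird_cst sub0r.
Qed.

Lemma shift_eq3 p q s : cyclic3 p q s ->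
  Dx q kshift * b s - Dx s kshift * b q
  + kshift x ^+ 2 * ((w x)^-1 * (rho x * curv E Gshift p x)) = 0.
Proof.
move=> h; have h' := cyclic3_rot h; have h'' := cyclic3_rot h'.
rewrite !dird_kshift; apply: (shift_eq3_alg _ (H3 h) (Hc (cyclic3_ge2 h') (cyclic3_ge2 h''))).
  by rewrite mulVf// u0.
(* The curvature carries the factor kappa^2, so its change has to be known only where kappa is
   nonzero. *)
have [->|k0] := eqVneq (k x) 0; first by rewrite expr0n !mul0r.
congr (_ * _); have -> : curv E Gshift p x = curv E Gam p x + (curv E Gshift p x - curv E Gam p x).
  by rewrite addrC subrK.
by rewrite mulrDr (curv_Gshift h k0) mulrDr [(w x)^-1 * (w x * _)]mulrA mulVf ?mul1r.
Qed.

End HamiltonianShift.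

(** * Charts and bundles *)

Section Charts.
Variables (R : realType) (n : nat) (M : manifold R n).

Lemma chart_coordK (c : chart R M n) x : atlas c -> (coord c @` cdom c) x ->
  cdom c (param c x) /\ coord c (param c x) = x.
Proof. by move=> ac [p cp <-]; rewrite coordK. Qed.

Lemma locP (U : set M) (c : chart R M n) x : atlas c -> loc U c x ->
  [/\ U (param c x), cdom c (param c x) & coord c (param c x) = x].
Proof. by move=> ac [p [Up cp] <-]; rewrite coordK. Qed.

Lemma loc_mem (U : set M) (c : chart R M n) p : U p -> cdom c p -> loc U c (coord c p).
Proof. by move=> Up cp; exists p. Qed.

Lemma open_loc (U : set M) (c : chart R M n) : atlas c -> open U -> open (loc U c).
Proof.
move=> ac oU; rewrite openE => x [p [Up cp] <-].
have pc := param_continuous ac cp.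
have oI := cimg_open ac.
have H1 : nbhs (coord c p) (param c @^-1` (U `&` cdom c)).
  apply: pc; rewrite coordK//; apply: open_nbhs_nbhs; split=> //.
  by apply: openI => //; exact: cdom_open.
have H2 : nbhs (coord c p) (coord c @` cdom c) by apply: open_nbhs_nbhs; split=> //; exists p.
apply: filterS (filterI H1 H2) => y [[Uy cy] yI].
by have [_ <-] := chart_coordK ac yI; exact: loc_mem.
Qed.

Definition trans (c c' : chart R M n) := coord c' \o param c.

Lemma smooth_trans (c c' : chart R M n) : atlas c -> atlas c' ->
  smooth_map (loc (cdom c') c) (trans c c').
Proof. by move=> ac ac'; rewrite /loc setIC; exact: atlas_compatible. Qed.

Lemma open_loc_dom (c c' : chart R M n) : atlas c -> atlas c' -> open (loc (cdom c') c).
Proof. by move=> ac ac'; apply: open_loc => //; exact: cdom_open. Qed.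

Lemma differentiable_trans (c c' : chart R M n) p : atlas c -> atlas c' -> cdom c p -> cdom c' p ->
  differentiable (trans c c') (coord c p).
Proof.
move=> ac ac' cp c'p; apply: (smooth_map_differentiable (open_loc_dom ac ac') (smooth_trans ac ac')).
exact: loc_mem.
Qed.

Definition jtrans (c c' : chart R M n) x := 'J (trans c c') x.

Lemma jtrans_comp (c c' c'' : chart R M n) p : atlas c -> atlas c' -> atlas c'' ->
  cdom c p -> cdom c' p -> cdom c'' p ->
  jtrans c c'' (coord c p) = jtrans c c' (coord c p) *m jtrans c' c'' (coord c' p).
Proof.
move=> ac ac' ac'' cp c'p c''p.
have d1 := differentiable_trans ac ac' cp c'p.
have E : trans c c' (coord c p) = coord c' p by rewrite /trans /= coordK.
have d2 : differentiable (trans c' c'') (trans c c' (coord c p)).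
  by rewrite E; exact: differentiable_trans.
rewrite /jtrans -[in X in _ *m X]E -(jacobian_comp d1 d2).
apply: jacobian_eq_near.
- exact: differentiable_trans.
- exact: differentiable_comp.
- have : nbhs (coord c p) (loc (cdom c') c).
    by apply: open_nbhs_nbhs; split; [exact: open_loc_dom|exact: loc_mem].
  apply: filterS => y /(locP ac)[c'y cy _].
  by rewrite /trans /= coordK.
Qed.

Lemma jtrans_id (c : chart R M n) p : atlas c -> cdom c p -> jtrans c c (coord c p) = 1%:M.
Proof.
move=> ac cp; rewrite -(jacobian_id (coord c p)); apply: jacobian_eq_near.
- exact: differentiable_trans.
- exact: ex_diff.
- have : nbhs (coord c p) (loc (cdom c) c).
    by apply: open_nbhs_nbhs; split; [exact: open_loc_dom|exact: loc_mem].
  by apply: filterS => y /(locP ac)[_ cy e]; rewrite /trans /= e.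
Qed.

Lemma jtransK (c c' : chart R M n) p : atlas c -> atlas c' -> cdom c p -> cdom c' p ->
  jtrans c c' (coord c p) *m jtrans c' c (coord c' p) = 1%:M.
Proof. by move=> ac ac' cp c'p; rewrite -jtrans_comp// jtrans_id. Qed.

Lemma chart_atP (p : M) : atlas (chart_at p) /\ cdom (chart_at p) p.
Proof. by rewrite /chart_at; case: cid2. Qed.

Lemma loc_setT (U : set M) (c : chart R M n) x : loc U c x -> loc (setT : set M) c x.
Proof. by move=> [p [_ cp] <-]; exists p. Qed.

Lemma smooth_fun_continuous f : smooth_fun (setT : set M) f -> continuous f.
Proof.
move=> sf p; have [c ac cp] := atlas_cover p.
have cc := coord_continuous ac cp.
have cf : {for coord c p, continuous (f \o param c)}.
  apply: (class_C_continuous (sf c ac 0%N)); exact: loc_mem.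
have H : {for p, continuous ((f \o param c) \o coord c)} by exact: continuous_comp.
have E : (f \o param c \o coord c) p = f p by rewrite /= coordK.
rewrite /continuous_at -E.
apply: cvg_trans H; apply: near_eq_cvg.
have : nbhs p (cdom c) by apply: open_nbhs_nbhs; split=> //; exact: cdom_open.
by apply: filterS => q cq; rewrite /= coordK.
Qed.

End Charts.

(** * The projection in a fixed chart of the base *)

Section Bundle.
Variables (R : realType) (n m : nat) (M : manifold R n) (B : manifold R m).
Variable proj : M -> B.
Hypothesis hproj : fiber_bundle proj.

(** [dproj] uses a chart chosen separately at each image point and need not vary smoothly. With [b]
    fixed the expression is smooth, and the invertible matrix [jsel] leads from one Jacobian to the
    other. *)
Definition locproj (c : chart R M n) (b : chart R B m) := coord b \o proj \o param c.

Definition locdom (c : chart R M n) (b : chart R B m) := loc (proj @^-1` cdom b) c.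

Lemma smooth_locproj (c : chart R M n) (b : chart R B m) : atlas c -> atlas b -> smooth_map (locdom c b) (locproj c b).
Proof. by move=> ac ab; rewrite /locdom /loc setIC; have [_ H _ _] := hproj; exact: H. Qed.

Lemma open_locdom (c : chart R M n) (b : chart R B m) : atlas c -> atlas b -> open (locdom c b).
Proof.
move=> ac ab; apply: open_loc => //; have [cp _ _ _] := hproj.
by apply: open_comp; [move=> x _; exact: cp|exact: cdom_open].
Qed.

Lemma differentiable_locproj (c : chart R M n) (b : chart R B m) x : atlas c -> atlas b -> locdom c b x ->
  differentiable (locproj c b) x.
Proof.
by move=> ac ab; exact: (smooth_map_differentiable (open_locdom ac ab) (smooth_locproj ac ab)).
Qed.

Lemma locproj_param (c : chart R M n) (b : chart R B m) x : atlas c -> locdom c b x ->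
  locproj c b x = coord b (proj (param c x)) /\ cdom b (proj (param c x)).
Proof. by move=> ac /(locP ac)[]. Qed.

Definition jsel (b : chart R B m) (c : chart R M n) x := let q := proj (param c x) in jtrans b (chart_at q) (coord b q).

Lemma jproj_change (c : chart R M n) (b b' : chart R B m) x : atlas c -> atlas b -> atlas b' -> locdom c b x -> locdom c b' x ->
  'J (locproj c b') x = 'J (locproj c b) x *m jtrans b b' (coord b (proj (param c x))).
Proof.
move=> ac ab ab' xb xb'.
have d1 := differentiable_locproj ac ab xb.
have [E1 bq] := locproj_param ac xb; have [E2 b'q] := locproj_param ac xb'.
have d2 : differentiable (trans b b') (locproj c b x).
  by rewrite E1; exact: differentiable_trans.
rewrite /jtrans -E1 -(jacobian_comp d1 d2); apply: jacobian_eq_near.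
- exact: differentiable_locproj.
- exact: differentiable_comp.
- have : nbhs x (locdom c b) by apply: open_nbhs_nbhs; split=> //; exact: open_locdom.
  apply: filterS => y yb; have [E3 b3] := locproj_param ac yb.
  by rewrite /trans /= E3 coordK.
Qed.

Lemma dprojE (c : chart R M n) (b : chart R B m) x : atlas c -> atlas b -> locdom c b x ->
  dproj proj c x = 'J (locproj c b) x *m jsel b c x.
Proof.
move=> ac ab xb; have [a' c'] := chart_atP (proj (param c x)).
have [_ cx E] := locP ac xb.
by rewrite /dproj -(jproj_change ac ab a' xb)//; exists (param c x).
Qed.

Lemma jselK (b : chart R B m) (c : chart R M n) x : atlas c -> atlas b -> locdom c b x ->
  exists J', jsel b c x *m J' = 1%:M.
Proof.
move=> ac ab xb; have [a' c'] := chart_atP (proj (param c x)).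
have [bq _ _] := locP ac xb.
by eexists; apply: jtransK.
Qed.

(** The two Jacobians differ by an invertible right factor, hence have the same kernel. *)
Lemma verticalE (c : chart R M n) (b : chart R B m) x v : atlas c -> atlas b -> locdom c b x ->
  vertical proj c x v <-> v *m 'J (locproj c b) x = 0.
Proof.
move=> ac ab xb; rewrite /vertical (dprojE ac ab xb) mulmxA.
have [J' JJ'] := jselK ac ab xb; split=> [H|->]; last by rewrite mul0mx.
by rewrite -[LHS]mulmx1 -JJ' mulmxA H mul0mx.
Qed.

Lemma pullbackE k (w : field B (alt R m k)) (c : chart R M n) (b : chart R B m) x v : diff_form setT w -> atlas c -> atlas b ->
  locdom c b x -> pullback proj w c x v = w b (locproj c b x) (fun i => v i *m 'J (locproj c b) x).
Proof.
move=> [_ _ ow] ac ab xb; have [a' c'] := chart_atP (proj (param c x)).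
have [E1 bq] := locproj_param ac xb.
rewrite E1 (ow b (chart_at (proj (param c x))) _ ab a' I bq c') /pullback /base_value /=.
by congr (w _ _ _); apply/funext => i; rewrite -mulmxA -(dprojE ac ab xb).
Qed.

Lemma full_locproj (c : chart R M n) (b : chart R B m) x : atlas c -> atlas b -> locdom c b x -> row_full ('J (locproj c b) x).
Proof.
move=> ac ab xb; have [_ _ _ H] := hproj.
have := H c x ac (loc_setT xb); rewrite (dprojE ac ab xb) /row_full => /eqP r.
by rewrite eqn_leq rank_leq_col -{1}r mxrankM_maxl.
Qed.

End Bundle.

(** * Existence of commuting frames adapted to the projection *)

Section FrameExistence.
Variable R : realType.
Notation V := 'rV[R]_5.

(** Gaussian elimination expresses the transpose of [A] by the first two rows of the invertible
    matrix [W]; the other three rows of [W] complete it. *)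
Lemma complete_columns (A : 'M[R]_(5, 2)) : row_full A ->
  exists K : 'M[R]_(5, 3), (row_mx A K : 'M[R]_5) \in unitmx.
Proof.
move=> fA; pose T : 'M[R]_(2, 2 + 3) := A^T.
have rT : \rank T = 2%N by rewrite mxrank_tr; apply/eqP.
pose W : 'M[R]_(2 + 3, 2 + 3) := row_ebase T.
exists (dsubmx W)^T.
have ET : T = col_ebase T *m usubmx W.
  rewrite -[LHS]mulmx_ebase -mulmxA; congr (_ *m _); rewrite -/W rT.
  rewrite -[W in LHS]vsubmxK.
  have -> : (pid_mx 2 : 'M[R]_(2, 2 + 3)) = row_mx 1%:M 0.
    by rewrite pid_mx_row.
  by rewrite mul_row_col mul1mx mul0mx addr0.
have -> : (row_mx A (dsubmx W)^T : 'M[R]_5) = (col_mx T (dsubmx W))^T.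
  by rewrite tr_col_mx /T trmxK.
rewrite unitmx_tr; change (col_mx T (dsubmx W) \in @unitmx R (2 + 3)).
have -> : col_mx T (dsubmx W) = block_mx (col_ebase T) 0 0 1%:M *m W.
  rewrite -[in RHS](vsubmxK W) mul_block_col !mul0mx addr0 add0r mul1mx -ET.
  by [].
rewrite unitmx_mul row_ebase_unit andbT unitmxE det_ublock det1 mulr1 -unitmxE.
exact: col_ebase_unit.
Qed.

Lemma open_neq0 (N : set V) (f : V -> R) : open N -> (forall x, N x -> {for x, continuous f}) ->
  open (N `&` [set x | f x != 0]).
Proof.
move=> oN cf; rewrite openE => x [Nx fx].
apply: filterI; first exact: near_open.
have : nbhs (f x) [set t | t != 0].
  by apply: open_nbhs_nbhs; split=> //; exact: open_neq.
exact: (cf x Nx).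
Qed.

(** As [K] is constant, [J y] is the Jacobian of the map y -> (F y, y K). The rows of its inverse
    are the coordinate fields of that map and its columns the differentials of the coordinates. *)
Lemma frame_exists (N0 : set V) (F : V -> 'rV[R]_2) x0 :
  open N0 -> smooth_map N0 F -> N0 x0 -> row_full ('J F x0) ->
  exists N (E eps : 'I_5 -> V -> V),
  [/\ open N, N `<=` N0 & N x0] /\
  [/\ forall j, smooth_map N (E j), forall j, smooth_map N (eps j),
      forall x, N x -> forall i j, \sum_a eps a x 0 i * E a x 0 j = (i == j)%:R,
      forall x, N x -> forall i j, lie (E i) (E j) x = 0 &
      forall x v, N x -> dotp v (eps o0 x) = (v *m 'J F x) 0 ord0 /\
                         dotp v (eps o1 x) = (v *m 'J F x) 0 ord_max].
Proof.
move=> oN0 sF N0x0 fF; have [K uK] := complete_columns fF.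
pose J y : 'M[R]_5 := row_mx ('J F y) K.
have dF y : N0 y -> differentiable F y by exact: smooth_map_differentiable.
have JE y l (k : 'I_2) : J y l (lshift 3 k) = 'J F y l k by rewrite /J (row_mxEl ('J F y) K).
have JE' y l (k : 'I_3) : J y l (rshift 2 k) = K l k by rewrite /J (row_mxEr ('J F y) K).
have sJ l k : smooth_on N0 (fun y => J y l k).
  case: (splitP (k : 'I_(2 + 3))) => k' kk'.
    have -> : k = lshift 3 k' by apply: val_inj.
    apply: smooth_eq (smooth_partial l (sF k')) => // y Ny.
    by rewrite JE jacobianE//; exact: dF.
  have -> : k = rshift 2 k' by apply: val_inj.
  by apply: smooth_eq (smooth_cst N0 (K l k')) => // y Ny; rewrite JE'.
(* Every column of [J] is a gradient, so its derivative is symmetric. *)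
have cJ y l m k : N0 y -> partial m (fun z => J z l k) y = partial l (fun z => J z m k) y.
  move=> Ny; case: (splitP (k : 'I_(2 + 3))) => k' kk'.
    have -> : k = lshift 3 k' by apply: val_inj.
    have e i j : partial i (fun z => J z j (lshift 3 k')) y = partial i (partial j (fun z => F z 0 k')) y.
      apply: partial_eq_near; apply: filterS (near_open oN0 Ny) => z Nz.
      by rewrite JE jacobianE//; exact: dF.
    by rewrite !e; exact: (schwarz _ _ oN0 (sF k' 2%N) Ny).
  have -> : k = rshift 2 k' by apply: val_inj.
  have e i j : partial i (fun z => J z j (rshift 2 k')) y = 0.
    rewrite (@partial_eq_near _ _ _ (fun=> K j k')); last by near=> z; rewrite JE'.
    exact: (@derive_cst _ V R^o).
  by rewrite !e.
pose N := N0 `&` [set y | \det (J y) != 0].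
have oN : open N.
  apply: open_neq0 => // y Ny.
  exact: (class_C_continuous (smooth_det oN0 sJ 0%N) Ny).
have NN0 : N `<=` N0 by move=> y [].
have uJ y : N y -> J y \in unitmx by move=> [_]; rewrite unitmxE unitfE.
pose E j y : V := row j (invmx (J y)).
pose eps a y : V := (col a (J y))^T.
have sJN l k : smooth_on N (fun y => J y l k) by exact: smooth_sub (sJ l k).
have sE j : smooth_map N (E j).
  move=> l; apply: (smooth_eq oN _ (smooth_invmx oN uJ sJN j l)) => y _.
  by rewrite /E mxE.
exists N, E, eps; split; first split=> //.
  by split=> //=; rewrite -unitfE -unitmxE.
split.
- exact: sE.
- move=> j l; apply: (smooth_eq oN _ (sJN l j)) => y _.
  by rewrite /eps [RHS]mxE [RHS]mxE.
- move=> y Ny i j; have /matrixP/(_ i j) := mulmxV (uJ y Ny).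
  rewrite [X in X = _]mxE [X in _ = X]mxE => <-.
  apply: eq_bigr => a _; rewrite /eps /E; congr (_ * _); first by rewrite [LHS]mxE [LHS]mxE.
  by rewrite [LHS]mxE.
- move=> y Ny i j.
  (* Differentiating E J = 1 moves the derivative from [E] to [J]. By [cJ] the outcome is symmetric
     in the two fields, so that [E_i, E_j] J = 0. *)
  have H u a k : \sum_l dird u (fun z => E a z 0 l) y * J y l k =
      - \sum_l \sum_m u 0 m * E a y 0 l * partial m (fun z => J z l k) y.
    have e : dird u (fun z => \sum_l E a z 0 l * J z l k) y = 0.
      rewrite -[RHS](dird_cst y u (a == k)%:R); apply: (dird_eq oN u Ny) => z Nz.
      have /matrixP/(_ a k) := mulVmx (uJ z Nz); rewrite !mxE => <-.
      by apply: eq_bigr => l _; rewrite /E mxE.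
    rewrite (dird_sum oN u Ny) in e; last by move=> l; exact: (smoothM oN (sE a l) (sJN l k)).
    apply/eqP; rewrite -addr_eq0; apply/eqP; apply: (etrans _ e).
    rewrite -big_split; apply: eq_bigr => l _ /=.
    rewrite (dirdM oN u Ny (sE a l) (sJN l k)) (dirdE oN u Ny (sJN l k)); congr (_ + _).
    by rewrite mulr_sumr; apply: eq_bigr => m _; rewrite mulrA [u 0 m * _]mulrC.
  have L : lie (E i) (E j) y *m J y = 0.
    apply/rowP => k; rewrite [LHS]mxE [RHS]mxE.
    transitivity (\sum_l dird (E i y) (fun z => E j z 0 l) y * J y l k
                  - \sum_l dird (E j y) (fun z => E i z 0 l) y * J y l k).
      rewrite -sumrB; apply: eq_bigr => l _.
      by rewrite /lie row_addE row_oppE !dirdvE mulrBl.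
    rewrite !H opprK addrC; apply/eqP; rewrite subr_eq0; apply/eqP.
    rewrite exchange_big; apply: eq_bigr => l _; apply: eq_bigr => m _ /=.
    by rewrite (cJ _ _ _ _ (NN0 _ Ny)) [E j y 0 l * _]mulrC.
  by rewrite -[LHS]mulmx1 -(mulmxV (uJ y Ny)) mulmxA L mul0mx.
- move=> y v Ny; split; rewrite /dotp [RHS]mxE; apply: eq_bigr => l _; congr (_ * _).
    by rewrite -JE /eps [LHS]mxE [LHS]mxE; congr (J _ _ _); apply: val_inj.
  by rewrite -JE /eps [LHS]mxE [LHS]mxE; congr (J _ _ _); apply: val_inj.
Unshelve. all: by end_near. Qed.

End FrameExistence.

(** * The modified connection *)

Section LinearMaps.
Variables (R : realType) (m n : nat) (G : 'rV[R]_m -> 'rV[R]_n).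
Hypothesis Glin : forall a u v, G (a *: u + v) = a *: G u + G v.

Lemma lin0 : G 0 = 0.
Proof. by have := Glin (-1) 0 0; rewrite scaler0 addr0 scaleN1r addNr. Qed.

Lemma linD u v : G (u + v) = G u + G v.
Proof. by have := Glin 1 u v; rewrite !scale1r. Qed.

Lemma linZ a u : G (a *: u) = a *: G u.
Proof. by have := Glin a u 0; rewrite lin0 !addr0. Qed.

Lemma linB u v : G (u - v) = G u - G v.
Proof. by rewrite linD -scaleN1r linZ scaleN1r. Qed.

Lemma lin_sum (I : Type) (r : seq I) (P : pred I) (F : I -> 'rV[R]_m) :
  G (\sum_(i <- r | P i) F i) = \sum_(i <- r | P i) G (F i).
Proof. exact: (big_morph G linD lin0). Qed.

End LinearMaps.

Section Correction.
Variables (R : realType) (D : 'M[R]_(5, 2)).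
Notation V := 'rV[R]_5.
Variables (G : V -> V) (Q : alt R 5 3) (b : alt R 5 1) (A : alt R 5 2).
Hypothesis Glin : forall a u v, G (a *: u + v) = a *: G u + G v.
Hypothesis GD : forall v, G v *m D = 0.
Hypothesis Gv : forall v, v *m D = 0 -> G v = v.
Hypothesis hQ : alternating Q.
Hypothesis QV : forall h i, (forall v : V, v *m D = 0 -> dotp v (h i) = 0) -> Q h = 0.
Hypothesis hb : alternating b.
Hypothesis hA : alternating A.

Lemma dotp_unitv n (z : 'rV[R]_n) j : dotp z (unitv R j) = z 0 j.
Proof.
rewrite /dotp (bigD1 j)//= unitvE eqxx mulr1 big1 ?addr0// => i ij.
by rewrite unitvE (negbTE ij) mulr0.
Qed.

Lemma GK v : G (G v) = G v.
Proof. by rewrite Gv. Qed.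

Lemma Gh v : G (v - G v) = 0.
Proof. by rewrite (linB Glin) GK subrr. Qed.

(* For A = d mu with mu horizontal, this is d_{0,1} mu. *)
Definition mixed : alt R 5 2 := bicomp G 1 A.

Lemma alternating_mixed : alternating mixed.
Proof. exact: alternating_bicomp. Qed.

Lemma mixed_hv u v : G u = 0 -> G v = v -> mixed (argl [:: u; v]) = A (argl [:: u; v]).
Proof. by move=> u0 v0; rewrite /mixed (@bicomp_argl _ _ _ _ _ 1 [:: true; false] _ hA)// => -[|[|]]. Qed.

Lemma mixed_vv u v : G u = u -> G v = v -> mixed (argl [:: u; v]) = 0.
Proof. by move=> u0 v0; rewrite /mixed (@bicomp_argl _ _ _ _ _ 1 [:: false; false] _ hA)// => -[|[|]]. Qed.

Lemma mixed_hh u v : G u = 0 -> G v = 0 -> mixed (argl [:: u; v]) = 0.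
Proof. by move=> u0 v0; rewrite /mixed (@bicomp_argl _ _ _ _ _ 1 [:: true; true] _ hA)// => -[|[|]]. Qed.

Lemma mixedE u v :
  mixed (argl [:: u; v]) = A (argl [:: u - G u; G v]) + A (argl [:: G u; v - G v]).
Proof.
have hW := alternating_mixed.
have -> : mixed (argl [:: u; v]) = mixed (argl [:: u - G u + G u; v - G v + G v]).
  by rewrite !subrK.
rewrite (form2_Dl hW (u - G u)) !(form2_Dr hW (v - G v)).
rewrite (mixed_hh (Gh u) (Gh v)) (mixed_hv (Gh u) (GK v)) (mixed_vv (GK u) (GK v)).
rewrite add0r addr0; congr (_ + _).
by rewrite (form2_anti hW) (mixed_hv (Gh v) (GK u)) -(form2_anti hA).
Qed.

(** For A = d mu, the covector i_X d_{0,1} mu. *)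
Definition covector (X : V) : V := \row_q mixed (argl [:: X; unitv R q]).

Lemma dotp_covector X v : dotp (covector X) v = mixed (argl [:: X; v]).
Proof.
rewrite [in RHS](row_unitv v) (form2_sumr alternating_mixed); apply: eq_bigr => q _.
by rewrite (form2_Zr alternating_mixed) mxE mulrC.
Qed.

(** The closed form of the contraction that defines the modified connection, up to sign: by
    [row_iprodE] it is what gets subtracted from gamma(X). *)
Definition correction (X : V) : V :=
  \row_j Q (argl [:: row_of_alt b; covector X; unitv R j]).

Lemma dotp_correction X z : dotp (correction X) z = Q (argl [:: row_of_alt b; covector X; z]).
Proof.
rewrite [in RHS](row_unitv z) (form3_sum3 hQ); apply: eq_bigr => q _.
by rewrite (form3_Z3 hQ) mxE mulrC.
Qed.

Lemma QV3 x y z : (forall v : V, v *m D = 0 -> dotp v z = 0) -> Q (argl [:: x; y; z]) = 0.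
Proof. by move=> H; apply: (QV (i := Ordinal (isT : 2 < 3)%N)). Qed.

Lemma QV2 x y z : (forall v : V, v *m D = 0 -> dotp v y = 0) -> Q (argl [:: x; y; z]) = 0.
Proof. by move=> H; apply: (QV (i := Ordinal (isT : 1 < 3)%N)). Qed.

(** In either half of [mixedE], one slot of [Q] receives a covector that annihilates the vertical
    vectors, and there the vertical trivector [Q] vanishes. This supplies the trace hypothesis of
    [iprod31_wedge]. *)
Lemma mixed_trace x : \sum_p \sum_q mixed (argl [:: unitv R p; unitv R q]) *
  Q (argl [:: x; unitv R q; unitv R p]) = 0.
Proof.
have G0 v (z : V) : v *m D = 0 -> v - G v = 0 by move=> /Gv ->; rewrite subrr.
have sum2 (F : 'I_5 -> 'I_5 -> R) (F1 F2 : 'I_5 -> 'I_5 -> R) :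
    (forall p q, F p q = F1 p q + F2 p q) ->
    (forall q, \sum_p F1 p q = 0) -> (forall p, \sum_q F2 p q = 0) -> \sum_p \sum_q F p q = 0.
  move=> FE H1 H2; under eq_bigr do under eq_bigr do rewrite FE.
  under eq_bigr do rewrite big_split/= H2 addr0.
  by rewrite exchange_big big1.
apply: (sum2 _ (fun p q => A (argl [:: unitv R p - G (unitv R p); G (unitv R q)]) *
                 Q (argl [:: x; unitv R q; unitv R p]))
               (fun p q => A (argl [:: G (unitv R p); unitv R q - G (unitv R q)]) *
                 Q (argl [:: x; unitv R q; unitv R p]))).
- by move=> p q; rewrite mixedE mulrDl.
- move=> q; pose z : V := \row_p A (argl [:: unitv R p - G (unitv R p); G (unitv R q)]).
  transitivity (Q (argl [:: x; unitv R q; z])).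
    rewrite [in RHS](row_unitv z) (form3_sum3 hQ); apply: eq_bigr => p _.
    by rewrite (form3_Z3 hQ) mxE.
  apply: QV3 => v vD.
  have -> : dotp v z = A (argl [:: v - G v; G (unitv R q)]).
    rewrite {2 3}(row_unitv v) (lin_sum Glin) -sumrB (form2_suml hA); apply: eq_bigr => p _.
    by rewrite (linZ Glin) -scalerBr (form2_Zl hA) mxE.
  by rewrite G0// (form2_0l hA).
- move=> p; pose z : V := \row_q A (argl [:: G (unitv R p); unitv R q - G (unitv R q)]).
  transitivity (Q (argl [:: x; z; unitv R p])).
    rewrite [in RHS](row_unitv z) (form3_sum2 hQ); apply: eq_bigr => q _.
    by rewrite (form3_Z2 hQ) mxE.
  apply: QV2 => v vD.
  have -> : dotp v z = A (argl [:: G (unitv R p); v - G v]).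
    rewrite {2 3}(row_unitv v) (lin_sum Glin) -sumrB (form2_sumr hA); apply: eq_bigr => q _.
    by rewrite (linZ Glin) -scalerBr (form2_Zr hA) mxE.
  by rewrite G0// (form2_0r hA).
Qed.

Lemma row_iprodE X : row_of_alt (@iprod R 5 3 1 (wedge mixed b) (wedge Q (alt_of_row X))) = - correction X.
Proof.
apply/rowP => j; rewrite /row_of_alt [LHS]mxE argl1_cst.
rewrite (iprod31_wedge _ _ alternating_mixed hb hQ mixed_trace).
by rewrite row_oppE; congr (- _); rewrite [RHS]mxE.
Qed.

Lemma correctionP a u v : correction (a *: u + v) = a *: correction u + correction v.
Proof.
have cP : covector (a *: u + v) = a *: covector u + covector v.
  apply/rowP => q; rewrite row_addE row_scaleE [LHS]mxE (form2_Pl alternating_mixed).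
  by congr (_ * _ + _); rewrite mxE.
apply/rowP => j; rewrite row_addE row_scaleE [LHS]mxE cP (form3_P2 hQ).
by congr (_ * _ + _); rewrite mxE.
Qed.

Lemma correction_vert v : v *m D = 0 -> correction v = 0.
Proof.
move=> vD; apply/rowP => j; rewrite [LHS]mxE [RHS]mxE; apply: QV2 => u uD.
by rewrite dotpC dotp_covector mixed_vv ?Gv.
Qed.

Lemma correctionD v : correction v *m D = 0.
Proof.
apply/rowP => k; rewrite [LHS]mxE [RHS]mxE.
transitivity (dotp (correction v) (\row_j D j k)).
  by apply: eq_bigr => j _; rewrite [X in _ = _ * X]mxE.
rewrite dotp_correction; apply: QV3 => u uD.
have /rowP/(_ k) := uD; rewrite [LHS]mxE [RHS]mxE => <-.
by apply: eq_bigr => j _; rewrite [X in _ * X]mxE.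
Qed.

(** Here Q(b, -, b) = 0. This is why beta still annihilates the horizontal vectors after the
    modification. *)
Lemma form1_correction v : b (argl [:: correction v]) = 0.
Proof. by rewrite (form1E hb) dotpC dotp_correction form3_alt13. Qed.

End Correction.

(** * Behaviour under a change of coordinates *)

Section CorrectionChange.
Variables (R : realType) (J : 'M[R]_5).
Notation V := 'rV[R]_5.
Variables (G G' : V -> V) (Q Q' : alt R 5 3) (b b' : alt R 5 1) (A A' : alt R 5 2).
Hypothesis GJ : forall v, G v *m J = G' (v *m J).
Hypothesis QJ : forall h, Q' h = Q (fun i => h i *m J^T).
Hypothesis bJ : forall v, b v = b' (fun i => v i *m J).
Hypothesis AJ : forall v, A v = A' (fun i => v i *m J).
Hypothesis Glin : forall a u v, G (a *: u + v) = a *: G u + G v.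
Hypothesis Glin' : forall a u v, G' (a *: u + v) = a *: G' u + G' v.
Hypothesis hA : alternating A.
Hypothesis hA' : alternating A'.
Hypothesis hb : alternating b.
Hypothesis hb' : alternating b'.
Hypothesis hQ : alternating Q.
Hypothesis hQ' : alternating Q'.

Lemma argl_mulmx k m n (s : seq 'rV[R]_m) (K : 'M[R]_(m, n)) :
  (fun i : 'I_k => argl s i *m K) = argl [seq v *m K | v <- s].
Proof.
apply/funext => i; rewrite /argl; have [is_|is_] := ltnP i (size s).
  by rewrite (nth_map 0).
by rewrite !nth_default ?size_map// mul0mx.
Qed.

Lemma dotp_mulmx m n (u : 'rV[R]_m) (K : 'M[R]_(m, n)) v : dotp (u *m K) v = dotp u (v *m K^T).
Proof.
have E k (p q : 'rV[R]_k) : dotp p q = (p *m q^T) 0 0.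
  by rewrite mxE; apply: eq_bigr => j _; rewrite mxE.
by rewrite !E trmx_mul trmxK mulmxA.
Qed.

Lemma dotp_inj n (u v : 'rV[R]_n) : (forall z, dotp u z = dotp v z) -> u = v.
Proof. by move=> H; apply/rowP => j; have := H (unitv R j); rewrite !dotp_unitv. Qed.

Lemma mixed_change v : mixed G A v = mixed G' A' (fun i => v i *m J).
Proof.
apply: eq_bigr => S _; rewrite AJ; congr A'; apply/funext => i.
by case: ifP => _; rewrite ?mulmxBl GJ.
Qed.

(** Both vectors are paired with an arbitrary covector; each ingredient of the pairing transforms
    tensorially. *)
Lemma correction_change X : correction G Q b A X *m J = correction G' Q' b' A' (X *m J).
Proof.
apply: dotp_inj => z; rewrite dotp_mulmx !dotp_correction// QJ argl_mulmx /=.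
congr (Q (argl [:: _; _; _])).
  apply: dotp_inj => v; rewrite dotp_mulmx trmxK -!form1E// bJ; congr b'.
  by rewrite argl_mulmx.
apply: dotp_inj => v; rewrite dotp_mulmx trmxK !dotp_covector// mixed_change.
by rewrite argl_mulmx.
Qed.

End CorrectionChange.

Section ChainDirectional.
Variables (R : realType) (k n : nat) (N : set 'rV[R]_k) (N' : set 'rV[R]_n).
Variable phi : 'rV[R]_k -> 'rV[R]_n.
Hypotheses (oN : open N) (oN' : open N') (sphi : smooth_map N phi).
Hypothesis phiN : forall y, N y -> N' (phi y).

Lemma mulmx_jacobianE y (v : 'rV[R]_k) m : N y -> (v *m 'J phi y) 0 m = dird v (fun z => phi z 0 m) y.
Proof.
move=> Ny; have d := smooth_map_differentiable oN sphi Ny.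
rewrite [LHS]mxE (dirdE oN v Ny (sphi m)); apply: eq_bigr => l _.
by rewrite (jacobianE _ _ d).
Qed.

Lemma dird_comp f y (v : 'rV[R]_k) : smooth_on N' f -> N y ->
  dird v (f \o phi) y = dird (v *m 'J phi y) f (phi y).
Proof.
move=> sf Ny; have d := smooth_map_differentiable oN sphi Ny.
rewrite dird_def (derive_comp v d (smooth_differentiable oN' sf (phiN Ny))).
rewrite (dirdE oN' _ (phiN Ny) sf); apply: eq_bigr => m _.
by rewrite (mulmx_jacobianE _ _ Ny) dird_def.
Qed.

End ChainDirectional.

Section Naturality.
Variables (R : realType) (n : nat) (N N' : set 'rV[R]_n) (phi : 'rV[R]_n -> 'rV[R]_n).
Notation V := 'rV[R]_n.
Hypotheses (oN : open N) (oN' : open N') (sphi : smooth_map N phi).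
Hypothesis phiN : forall y, N y -> N' (phi y).

(** Differentiating the pulled-back form brings in second derivatives of [phi]; these are symmetric
    in [u] and [v] and cancel in the exterior derivative. *)
Lemma ext_diff1_pullback (a a' : V -> alt R n 1) y u v : smooth_form N' a' -> N y ->
  (forall z, N z -> forall w, a z w = a' (phi z) (fun i => w i *m 'J phi z)) ->
  ext_diff a y (argl [:: u; v]) = ext_diff a' (phi y) (argl [:: u *m 'J phi y; v *m 'J phi y]).
Proof.
move=> sa Ny aE; rewrite !ext_diff1.
pose psi m := (fun z => a' z (argl [:: unitv R m])) \o phi.
have sa' m : smooth_on N' (fun z => a' z (argl [:: unitv R m])) by exact: sa.2.
have spsi m : smooth_on N (psi m) by apply: (smooth_comp oN oN' phiN sphi); exact: sa'.
have aE' w z : N z -> a z (argl [:: w]) = \sum_m dird w (fun t => phi t 0 m) z * psi m z.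
  move=> Nz; rewrite aE// argl_mulmx /=.
  rewrite [X in argl [:: X]](row_unitv (w *m 'J phi z)) (form1_sum (sa.1 _ (phiN Nz))).
  apply: eq_bigr => m _; rewrite (form1Z (sa.1 _ (phiN Nz))).
  by rewrite (mulmx_jacobianE oN sphi _ _ Nz).
have sdp w m : smooth_on N (fun z => dird w (fun t => phi t 0 m) z).
  exact: (smooth_dird oN (sphi m) (smooth_map_cst N w)).
have dE w t : dird w (fun z => a z (argl [:: t])) y =
    \sum_m dird w (fun z => dird t (fun s => phi s 0 m) z) y * psi m y
    + dird (w *m 'J phi y) (fun z => a' z (argl [:: t *m 'J phi y])) (phi y).
  rewrite (dird_eq oN w Ny (aE' t)) (dird_sum oN w Ny); last first.
    by move=> m; exact: (smoothM oN (sdp t m) (spsi m)).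
  have -> : dird (w *m 'J phi y) (fun z => a' z (argl [:: t *m 'J phi y])) (phi y) =
      \sum_m dird t (fun s => phi s 0 m) y * dird w (psi m) y.
    rewrite (@dird_eq _ _ _ oN' _ _ (phiN Ny) _
       (fun z => \sum_m (t *m 'J phi y) 0 m * a' z (argl [:: unitv R m]))); last first.
      move=> z Nz; rewrite [X in argl [:: X]](row_unitv (t *m 'J phi y)) (form1_sum (sa.1 _ Nz)).
      by apply: eq_bigr => m _; rewrite (form1Z (sa.1 _ Nz)).
    have sc m := smooth_cst N' ((t *m 'J phi y) 0 m).
    rewrite (dird_sum oN' _ (phiN Ny)); last by move=> m; exact: (smoothM oN' (sc m) (sa' m)).
    apply: eq_bigr => m _; rewrite (dirdM oN' _ (phiN Ny) (sc m) (sa' m)) dird_cst mul0r add0r.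
    by rewrite (mulmx_jacobianE oN sphi _ _ Ny) (dird_comp oN oN' sphi phiN _ (sa' m) Ny).
  rewrite -big_split; apply: eq_bigr => m _.
  by rewrite (dirdM oN w Ny (sdp t m) (spsi m)).
rewrite (dE u v) (dE v u).
have -> : \sum_m dird u (fun z => dird v (fun s => phi s 0 m) z) y * psi m y =
          \sum_m dird v (fun z => dird u (fun s => phi s 0 m) z) y * psi m y.
  apply: eq_bigr => m _; congr (_ * _); apply/eqP; rewrite -subr_eq0; apply/eqP.
  rewrite (dird_comm oN (sphi m) (smooth_map_cst N u) (smooth_map_cst N v) Ny).
  have -> : lie (fun=> u) (fun=> v) y = 0.
    by apply/rowP => l; rewrite /lie row_addE row_oppE !dirdvE !dird_cst subr0 mxE.
  exact: dird_dir0.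
by rewrite [X in X - _]addrC [X in _ - X]addrC cancel_common.
Qed.

End Naturality.

(** * Bundle data in an adapted frame *)

Section LocalGeometry.
Variables (R : realType) (M : manifold R 5) (B : manifold R 2) (proj : M -> B).
Variables (Omega : field M (alt R 5 5)) (omega : field B (alt R 2 2)).
Hypothesis hproj : fiber_bundle proj.
Hypothesis homega : volume_form omega.
Notation V := 'rV[R]_5.
Variables (c : chart R M 5) (b : chart R B 2).
Hypotheses (ac : atlas c) (ab : atlas b).
Notation F := (locproj proj c b).
Variable N : set V.
Hypothesis oN : open N.
Hypothesis NS : N `<=` locdom proj c b.
Variables E eps : 'I_5 -> V -> V.
Hypothesis sE : forall j, smooth_map N (E j).
Hypothesis seps : forall j, smooth_map N (eps j).
Hypothesis dual : forall x, N x -> forall i j, \sum_a eps a x 0 i * E a x 0 j = (i == j)%:R.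
Hypothesis epsF : forall x v, N x -> dotp v (eps o0 x) = (v *m 'J F x) 0 ord0 /\
                                    dotp v (eps o1 x) = (v *m 'J F x) 0 ord_max.

Lemma frame_loc y : N y -> loc setT c y.
Proof. by move=> Ny; exact: loc_setT (NS Ny). Qed.

Lemma smooth_F : smooth_map N F.
Proof. by move=> j; apply: smooth_sub (smooth_locproj hproj ac ab j). Qed.

Lemma F_loc y : N y -> loc setT b (F y).
Proof.
move=> Ny; have [E1 bq] := locproj_param ac (NS Ny).
by exists (proj (param c y)).
Qed.

Lemma ord2E (i : 'I_2) : i = ord0 \/ i = ord_max.
Proof. by case: i => -[|[|i]] hi //; [left|right]; apply: val_inj. Qed.

Lemma verticalP y v : N y ->
  vertical proj c y v <-> dotp v (eps o0 y) = 0 /\ dotp v (eps o1 y) = 0.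
Proof.
move=> Ny; rewrite (verticalE hproj v ac ab (NS Ny)); have [e0 e1] := epsF v Ny.
rewrite e0 e1; split=> [-> |[z0 z1]]; first by rewrite !mxE.
by apply/rowP => i; rewrite [RHS]mxE; case: (ord2E i) => ->.
Qed.

Lemma frame_vertical y (a : 'I_5) : N y -> (2 <= a)%N -> vertical proj c y (E a y).
Proof.
move=> Ny a2; apply/(verticalP _ Ny); rewrite !(dualC dual _ _ Ny).
by move: a2; case: (a) => -[|[|l]] hl.
Qed.

Lemma vertical_expand y v : N y -> vertical proj c y v ->
  v = vert E (dotp v (eps o2 y)) (dotp v (eps o3 y)) (dotp v (eps o4 y)) y.
Proof.
move=> Ny /(verticalP _ Ny)[z0 z1]; rewrite [LHS](frame_expand dual v Ny).
by rewrite sum5E z0 z1 !scale0r !add0r.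
Qed.

(** The function w, equal to the pulled-back area form on E_0, E_1 by [pullback_area]. Written
    through [F], it is visibly constant along the fibres. *)
Definition area (y : V) : R := omega b (F y) (argl [:: unitv R ord0; unitv R ord_max]).

Lemma smooth_area : smooth_on N area.
Proof.
have [[_ so _] _] := homega.
have sw : smooth_on (loc setT b) (fun z => omega b z (argl [:: unitv R ord0; unitv R ord_max])) by exact: so.
exact: (smooth_comp oN (open_loc ab openT) F_loc smooth_F sw).
Qed.

Lemma frame_F0 y : N y -> E o0 y *m 'J F y = unitv R ord0.
Proof.
move=> Ny; have [e0 e1] := epsF (E o0 y) Ny.
by apply/rowP => i; rewrite unitvE; case: (ord2E i) => ->; rewrite -?e0 -?e1 (dualC dual _ _ Ny).
Qed.

Lemma frame_F1 y : N y -> E o1 y *m 'J F y = unitv R ord_max.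
Proof.
move=> Ny; have [e0 e1] := epsF (E o1 y) Ny.
by apply/rowP => i; rewrite unitvE; case: (ord2E i) => ->; rewrite -?e0 -?e1 (dualC dual _ _ Ny).
Qed.

Lemma pullback_frame y u v : N y -> pullback proj omega c y (argl [:: u; v]) =
  omega b (F y) (argl [:: u *m 'J F y; v *m 'J F y]).
Proof.
by move=> Ny; rewrite (pullbackE hproj _ homega.1 ac ab (NS Ny)) argl_mulmx.
Qed.

Lemma alternating_pullback y : N y -> alternating (pullback proj omega c y).
Proof.
move=> Ny; have hw : alternating (omega b (F y)).
  by have [[H _ _] _] := homega; exact: H ab (F_loc Ny).
have -> : pullback proj omega c y = fun v => omega b (F y) (fun i => v i *m 'J F y).
  by apply/funext => v; exact: (pullbackE hproj _ homega.1 ac ab (NS Ny)).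
have U v i u : (fun j => upd v i u j *m 'J F y) = upd (fun j => v j *m 'J F y) i (u *m 'J F y).
  by apply/funext => j; rewrite /upd; case: ifP.
split=> [v i a u z|v i j ij vij].
  by rewrite !U mulmxDl -scalemxAl (altP hw).
by apply: (alt_eq0 hw ij); rewrite vij.
Qed.

Lemma pullback_area y : N y -> pullback proj omega c y (argl [:: E o0 y; E o1 y]) = area y.
Proof. by move=> Ny; rewrite pullback_frame// frame_F0// frame_F1. Qed.

Lemma pullback_vertical y u v : N y -> vertical proj c y v ->
  pullback proj omega c y (argl [:: u; v]) = 0.
Proof.
move=> Ny /(verticalE hproj v ac ab (NS Ny)) v0; rewrite pullback_frame// v0 form2_0r//.
by have [[H _ _] _] := homega; exact: H ab (F_loc Ny).
Qed.

Lemma area_neq0 y : N y -> area y != 0.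
Proof.
move=> Ny; have [[H _ _] nz] := homega.
have hw := H b (F y) ab (F_loc Ny).
have [v] := nz b (F y) ab (F_loc Ny); apply: contraNneq => a0.
apply/eqP; apply: (alt_top_eq0 hw (b := argl [:: unitv R ord0; unitv R ord_max])) => //.
move=> u; exists (fun j => u 0 j); rewrite {1}(row_unitv u); apply: eq_bigr => j _.
by case: (ord2E j) => ->.
Qed.

Lemma dird_area (a : 'I_5) y : (2 <= a)%N -> N y -> dird (E a y) area y = 0.
Proof.
move=> a2 Ny; have [[_ so _] _] := homega.
have sw : smooth_on (loc setT b) (fun z => omega b z (argl [:: unitv R ord0; unitv R ord_max])) by exact: so.
rewrite [LHS](dird_comp oN (open_loc ab openT) smooth_F F_loc (E a y) sw Ny).
by have /(verticalE hproj _ ac ab (NS Ny)) -> := frame_vertical Ny a2; exact: dird_dir0.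
Qed.

Section Connection.
Variable g : field M (V -> V).
Hypothesis hg : connection proj setT g.

Lemma connP y : N y -> forall a u v, g c y (a *: u + v) = a *: g c y u + g c y v.
Proof. by move=> Ny; have [H _ _ _ _] := hg; exact: H ac (frame_loc Ny). Qed.

Lemma conn_vertical y v : N y -> vertical proj c y (g c y v).
Proof. by move=> Ny; have [_ _ _ H _] := hg; exact: H ac (frame_loc Ny) v. Qed.

Lemma conn_id y v : N y -> vertical proj c y v -> g c y v = v.
Proof. by move=> Ny; have [_ _ _ _ H] := hg; exact: H ac (frame_loc Ny) v. Qed.

Lemma smooth_conn Y : smooth_map N Y -> smooth_map N (fun y => g c y (Y y)).
Proof.
move=> sY l; have [_ H _ _ _] := hg.
apply: (@smooth_eq _ _ N oN (fun y => \sum_j Y y 0 j * g c y (unitv R j) 0 l)).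
  move=> y Ny; have Gl := connP Ny.
  rewrite {2}(row_unitv (Y y)) (lin_sum Gl) summxE; apply: eq_bigr => j _.
  by rewrite (linZ Gl) row_scaleE.
apply: (smooth_sum oN) => j; apply: (smoothM oN (sY j)).
by apply: smooth_sub (H c (unitv R j) ac l) => y Ny; exact: frame_loc.
Qed.

(** The sign makes h_i equal to E_i - g(E_i), the horizontal part of E_i. *)
Definition gam (i a : 'I_5) (y : V) : R := - dotp (g c y (E i y)) (eps a y).

Lemma smooth_gam i a : smooth_on N (gam i a).
Proof.
apply: (smoothN oN); apply: (smooth_sum oN) => l.
exact: (smoothM oN (smooth_conn (sE i) l) (seps a l)).
Qed.

Lemma horE i y : N y -> hor E gam i y = E i y - g c y (E i y).
Proof.
move=> Ny; rewrite [g c y (E i y) in RHS](vertical_expand Ny (conn_vertical _ Ny)).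
by rewrite /hor /gam /vert !scaleNr !opprD.
Qed.

Lemma conn_hor i y : N y -> g c y (hor E gam i y) = 0.
Proof.
move=> Ny; rewrite horE//; have Gl := connP Ny.
by rewrite (linB Gl) [X in _ - X]conn_id ?subrr//; exact: conn_vertical.
Qed.

Lemma conn_frame y (a : 'I_5) : N y -> (2 <= a)%N -> g c y (E a y) = E a y.
Proof. by move=> Ny a2; exact/conn_id/frame_vertical. Qed.

Lemma horizontal_expand y v : N y -> g c y v = 0 ->
  exists s t, v = s *: hor E gam o0 y + t *: hor E gam o1 y.
Proof.
move=> Ny v0; have Gl := connP Ny.
exists (dotp v (eps o0 y)), (dotp v (eps o1 y)).
rewrite -[LHS]subr0 -v0 {1 2}(frame_expand dual v Ny).
rewrite (lin_sum Gl) -sumrB.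
under eq_bigr do rewrite (linZ Gl) -scalerBr.
rewrite sum5E !horE// (conn_frame (a := o2))// (conn_frame (a := o3))// (conn_frame (a := o4))//.
by rewrite !subrr !scaler0 !addr0.
Qed.

Lemma form_smooth k (a : field M (alt R 5 k)) : diff_form setT a -> smooth_form N (a c).
Proof.
move=> [H1 H2 _]; split=> [y Ny|v]; first exact: H1 ac (frame_loc Ny).
by apply: smooth_sub (H2 c v ac) => y Ny; exact: frame_loc.
Qed.

Section Density.
Variable OV : field M (alt R 5 3).
Hypothesis hOV : is_OmegaV proj Omega omega setT g OV.

Lemma OV_smooth : smooth_form N (OV c).
Proof. by have [H _ _] := hOV; exact: form_smooth. Qed.

Lemma OV_horizontal y v p q : N y -> g c y v = 0 -> OV c y (argl [:: v; p; q]) = 0.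
Proof.
move=> Ny v0; have [_ H _] := hOV.
exact: (H c y ac (frame_loc Ny) (argl [:: v; p; q]) ord0 v0).
Qed.

(** The pulled-back area form kills vertical vectors, so the wedge product reduces to one term. The
    right side does not mention the connection; hence rho does not depend on it either. *)
Lemma dens_area y : N y ->
  area y * dens E (OV c) y = Omega c y (argl [:: E o0 y; E o1 y; E o2 y; E o3 y; E o4 y]).
Proof.
move=> Ny; have [_ _ H] := hOV; rewrite (H c y ac (frame_loc Ny)).
have hV u (a : 'I_5) : (2 <= a)%N -> pullback proj omega c y (argl [:: u; E a y]) = 0.
  by move=> a2; apply: pullback_vertical => //; exact: frame_vertical.
rewrite (wedge23 _ _ (alternating_pullback Ny) (OV_smooth.1 y Ny)) ?pullback_area//.
by move=> u; split; exact: hV.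
Qed.

(** The value -1 is the normalization 1 combined with the sign in [iprod3_frame]. *)
Lemma QV_frame Q y : is_QV proj setT OV Q -> N y ->
  [/\ alternating (Q c y), forall p q, Q c y (argl [:: eps o0 y; p; q]) = 0,
      forall p q, Q c y (argl [:: eps o1 y; p; q]) = 0 &
      Q c y (argl [:: eps o2 y; eps o3 y; eps o4 y]) * dens E (OV c) y = -1].
Proof.
move=> [[hQ _ _] tQ iQ] Ny; have hQy := hQ c y ac (frame_loc Ny).
have z0 (j : 'I_5) p q : (j < 2)%N -> Q c y (argl [:: eps j y; p; q]) = 0.
  move=> j2; apply: (tQ c y ac (frame_loc Ny) _ ord0) => v /(verticalP _ Ny)[e0 e1].
  have /orP[/eqP->|/eqP->] // : (j == o0) || (j == o1) by move: j2; case: j => -[|[|l]] hl.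
have z0' p q : Q c y (argl [:: eps o0 y; p; q]) = 0 by exact: z0.
have z1' p q : Q c y (argl [:: eps o1 y; p; q]) = 0 by exact: z0.
split=> //; have := iQ c y ac (frame_loc Ny) (argl [::]).
rewrite (iprod3_frame (dual Ny) (B := OV c y : alt R 5 (3 + 0)))//; last exact: OV_smooth.1.
rewrite (@cat_argl _ _ 3 0)// => /eqP; rewrite eqr_oppLR => /eqP; exact.
Qed.

End Density.

Lemma pullback_hor y : N y -> pullback proj omega c y (argl [:: hor E gam o0 y; hor E gam o1 y]) = area y.
Proof.
move=> Ny; have hp := alternating_pullback Ny.
have W u i : pullback proj omega c y (argl [:: u; hor E gam i y]) = pullback proj omega c y (argl [:: u; E i y]).
  rewrite horE// -scaleN1r (form2_Dr hp) (form2_Zr hp) (pullback_vertical u Ny (conn_vertical (E i y) Ny)).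
  by rewrite mulr0 addr0.
by rewrite W (form2_anti hp) W -(form2_anti hp) pullback_area.
Qed.

(** The sign comes from the order h_1, h_0 in [iprod2_frame]; replacing E_i by h_i does not affect
    the pulled-back form. *)
Lemma iprod_pullback (K : alt R 5 2) y (v : 'I_0 -> V) : N y -> alternating K ->
  (forall p u, dotp (hor E gam o0 y) u = 0 -> dotp (hor E gam o1 y) u = 0 -> K (argl [:: p; u]) = 0) ->
  @iprod R 5 2 0 K (pullback proj omega c y) v = - (K (argl [:: eps o0 y; eps o1 y]) * area y).
Proof.
move=> Ny hK KH; have hp := alternating_pullback Ny; rewrite (_ : v = argl [::]); last first.
  by apply/funext => -[].
rewrite (iprod2_frame (dualh_dual dual gam Ny) (B := pullback proj omega c y : alt R 5 (2 + 0)))//.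
- rewrite (@cat_argl _ _ 2 0)// /dualh /adapted /= (form2_anti hp) mulrN; congr (- (_ * _)).
  exact: pullback_hor.
- move=> i p i2.
  have dd j : dotp (adapted E gam y j) (dualh eps gam y i) = (j == i)%:R.
    exact: (@dualC R [set y] (fun j _ => adapted E gam y j) (fun j _ => dualh eps gam y j)
             (fun _ _ => dualh_dual dual gam Ny) y j i erefl).
  by apply: KH; [have := dd o0|have := dd o1]; rewrite /adapted /= => ->;
    move: i2; case: (i) => -[|[|l]] hl.
Qed.

Lemma QH_frame K y : is_QH proj omega setT g K -> N y ->
  [/\ alternating (K c y),
      forall p u, dotp (hor E gam o0 y) u = 0 -> dotp (hor E gam o1 y) u = 0 ->
        K c y (argl [:: p; u]) = 0 &
      K c y (argl [:: eps o0 y; eps o1 y]) * area y = -1].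
Proof.
move=> [[hK _ _] tK iK] Ny; have hKy := hK c y ac (frame_loc Ny).
have KH p u : dotp (hor E gam o0 y) u = 0 -> dotp (hor E gam o1 y) u = 0 ->
    K c y (argl [:: p; u]) = 0.
  move=> u0 u1; apply: (tK c y ac (frame_loc Ny) _ ord_max) => v v0.
  have [s [t ->]] := horizontal_expand Ny v0.
  by rewrite /argl /= dotpDl !dotpZl u0 u1 !mulr0 addr0.
split=> //; have := iK c y ac (frame_loc Ny) (argl [::]).
by rewrite iprod_pullback// => /eqP; rewrite eqr_oppLR => /eqP.
Qed.

End Connection.
End LocalGeometry.

Section SmoothFormField.
Variables (R : realType) (n : nat) (N : set 'rV[R]_n).
Hypothesis oN : open N.
Notation V := 'rV[R]_n.

Lemma smooth_ext_diff1 (a : V -> alt R n 1) (Y Z : V -> V) : smooth_form N a ->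
  smooth_map N Y -> smooth_map N Z ->
  smooth_on N (fun y => ext_diff a y (argl [:: Y y; Z y])).
Proof.
move=> sa sY sZ.
apply: (@smooth_eq _ _ N oN (fun y => \sum_i \sum_j Y y 0 i * (Z y 0 j *
   (dird (unitv R i) (fun z => a z (argl [:: unitv R j])) y
    - dird (unitv R j) (fun z => a z (argl [:: unitv R i])) y)))).
  move=> y Ny; have hA := alternating_ext_diff1 oN sa Ny.
  rewrite [in RHS](row_unitv (Y y)) (form2_suml hA); apply: eq_bigr => i _.
  rewrite (form2_Zl hA) [in RHS](row_unitv (Z y)) (form2_sumr hA) mulr_sumr; apply: eq_bigr => j _.
  by rewrite (form2_Zr hA) ext_diff1.
have sd i j : smooth_on N (dird (unitv R i) (fun z => a z (argl [:: unitv R j]))).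
  exact: (smooth_dird oN (sa.2 _) (smooth_map_cst N (unitv R i))).
apply: (smooth_sum oN) => i; apply: (smooth_sum oN) => j.
exact: (smoothM oN (sY i) (smoothM oN (sZ j) (smoothB oN (sd i j) (sd j i)))).
Qed.

End SmoothFormField.

(** * Restriction of fields to a subset *)

Section Restriction.
Variables (R : realType) (n m : nat) (M : manifold R n) (B : manifold R m) (proj : M -> B).
Variable U : set M.

Lemma diff_form_smooth_form k (a : field M (alt R n k)) (c : chart R M n) :
  diff_form U a -> atlas c -> smooth_form (loc U c) (a c).
Proof. by move=> [H1 H2 _] ac; split=> [y|v]; [exact: H1|exact: H2]. Qed.

Lemma multivector_smooth_form k (a : field M (alt R n k)) (c : chart R M n) :
  multivector_field U a -> atlas c -> smooth_form (loc U c) (a c).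
Proof. by move=> [H1 H2 _] ac; split=> [y|v]; [exact: H1|exact: H2]. Qed.

Lemma diff_form_sub k (a : field M (alt R n k)) : diff_form setT a -> diff_form U a.
Proof.
move=> [H1 H2 H3]; split=> [c x ac xU|c v ac|c c' p ac ac' _ cp c'p].
- exact: H1 ac (loc_setT xU).
- by apply: smooth_sub (H2 c v ac) => y; exact: loc_setT.
- exact: H3.
Qed.

Lemma multivector_field_sub k (a : field M (alt R n k)) :
  multivector_field setT a -> multivector_field U a.
Proof.
move=> [H1 H2 H3]; split=> [c x ac xU|c v ac|c c' p ac ac' _ cp c'p].
- exact: H1 ac (loc_setT xU).
- by apply: smooth_sub (H2 c v ac) => y; exact: loc_setT.
- exact: H3.
Qed.

Lemma on_charts_sub (P : chart R M n -> 'rV[R]_n -> Prop) :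
  on_charts (setT : set M) P -> on_charts U P.
Proof. by move=> H c x ac xU; exact: H ac (loc_setT xU). Qed.

Lemma connection_sub (g : field M ('rV[R]_n -> 'rV[R]_n)) :
  connection proj setT g -> connection proj U g.
Proof.
move=> [H1 H2 H3 H4 H5]; split; [exact: on_charts_sub| | |exact: on_charts_sub|exact: on_charts_sub].
  by move=> c v ac j; apply: smooth_sub (H2 c v ac j) => y; exact: loc_setT.
by move=> c c' p ac ac' _ cp c'p; exact: H3.
Qed.

End Restriction.

(** * The modified projection is a connection *)

Section TildeConnection.
Variables (R : realType) (M : manifold R 5) (B : manifold R 2) (proj : M -> B).
Notation V := 'rV[R]_5.
Variables (gamma : field M (V -> V)) (QV : field M (alt R 5 3)) (beta mu : field M (alt R 5 1)).
Hypothesis hproj : fiber_bundle proj.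
Hypothesis hg : connection proj setT gamma.
Hypothesis hQ : multivector_field setT QV.
Hypothesis tQ : tangent_to_V proj setT QV.
Hypothesis hb : diff_form setT beta.
Hypothesis bH : annihilates_H gamma setT beta.
Hypothesis hmu : diff_form setT mu.

Notation gt := (tilde_connection gamma QV beta mu).

Definition corr : field M (V -> V) := fun c x =>
  correction (gamma c x) (QV c x) (beta c x) (ext_diff (mu c) x).

Section Point.
Variables (c : chart R M 5) (x : V).
Hypotheses (ac : atlas c) (xc : loc setT c x).

Lemma tilde_oL : open (loc (setT : set M) c).
Proof. by apply: open_loc => //; exact: openT. Qed.

Let Glin : forall a u v, gamma c x (a *: u + v) = a *: gamma c x u + gamma c x v.
Proof. by have [H _ _ _ _] := hg; exact: H. Qed.
Let GD v : gamma c x v *m dproj proj c x = 0.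
Proof. by have [_ _ _ H _] := hg; exact: H. Qed.
Let Gv v : v *m dproj proj c x = 0 -> gamma c x v = v.
Proof. by have [_ _ _ _ H] := hg; exact: H. Qed.
Let hQx : alternating (QV c x).
Proof. by have [H _ _] := hQ; exact: H. Qed.
Let QVx h i : (forall v : V, v *m dproj proj c x = 0 -> dotp v (h i) = 0) -> QV c x h = 0.
Proof. exact: tQ. Qed.
Let hbx : alternating (beta c x).
Proof. by have [H _ _] := hb; exact: H. Qed.
Let hAx : alternating (ext_diff (mu c) x).
Proof. exact: (alternating_ext_diff1 tilde_oL (diff_form_smooth_form hmu ac)). Qed.

Lemma tildeE X : gt c x X = gamma c x X - corr c x X.
Proof.
rewrite /tilde_connection; congr (_ + _).
exact: (row_iprodE Glin GD Gv hQx QVx hbx hAx).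
Qed.

Lemma tilde_lin a u v : gt c x (a *: u + v) = a *: gt c x u + gt c x v.
Proof.
rewrite !tildeE Glin /corr (correctionP _ Glin hQx hAx) scalerBr opprD.
by rewrite addrACA.
Qed.

Lemma tilde_vertical v : vertical proj c x (gt c x v).
Proof.
by rewrite /vertical tildeE mulmxBl GD /corr (correctionD _ _ _ hQx QVx) subr0.
Qed.

Lemma tilde_id v : vertical proj c x v -> gt c x v = v.
Proof.
by move=> v0; rewrite tildeE /corr (correction_vert _ Glin Gv QVx hAx v0) subr0 Gv.
Qed.

Lemma gamma_tilde v : gamma c x (gt c x v) = gt c x v.
Proof. exact/Gv/tilde_vertical. Qed.

Lemma mixed_gammaE u v : mixed (gamma c x) (ext_diff (mu c) x) (argl [:: u; v]) =
  ext_diff (mu c) x (argl [:: u - gamma c x u; gamma c x v])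
  + ext_diff (mu c) x (argl [:: gamma c x u; v - gamma c x v]).
Proof. exact: (mixedE Glin GD Gv hAx). Qed.

Lemma beta_gamma v : beta c x (argl [:: gamma c x v]) = beta c x (argl [:: v]).
Proof.
have z : beta c x (argl [:: v - gamma c x v]) = 0.
  by apply: (bH ac xc (i := ord0)); rewrite /argl /=; exact: (Gh Glin GD Gv).
by rewrite -[in RHS](subrK (gamma c x v) v) (form1D hbx) z add0r.
Qed.

(** The form beta sees only the gamma-vertical part of a vector, and it kills the correction. *)
Lemma beta_tilde v : beta c x (argl [:: gt c x v]) = beta c x (argl [:: v]).
Proof.
rewrite tildeE (form1D hbx) (form1N hbx) beta_gamma /corr.
by rewrite (form1_correction _ _ hQx hbx) subr0.
Qed.

End Point.

Lemma tilde_annihilates : annihilates_H gt setT beta.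
Proof.
move=> c x ac xc v i v0; have [H _ _] := hb; rewrite (argl1E v) -beta_tilde//.
by rewrite -(ord1 i : i = ord0) v0 form1_0//; exact: H.
Qed.

Lemma smooth_corr c v : atlas c -> smooth_map (loc setT c) (fun x => corr c x v).
Proof.
move=> ac j; have oL := tilde_oL ac.
have sQ := multivector_smooth_form hQ ac; have sb := diff_form_smooth_form hb ac.
have smu := diff_form_smooth_form hmu ac.
have [g1 g2 _ _ _] := hg.
have sG u : smooth_map (loc setT c) (fun x => gamma c x u) by exact: g2.
have sGB u : smooth_map (loc setT c) (fun x => u - gamma c x u).
  move=> l; apply: (smooth_eq oL _ (smoothB oL (smooth_cst _ (u 0 l)) (sG u l))) => x _.
  by rewrite row_addE row_oppE.
have s1 : smooth_map (loc setT c) (fun x => row_of_alt (beta c x)).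
  move=> l; apply: (smooth_eq oL _ (sb.2 (fun=> unitv R l))) => x _.
  by rewrite [RHS]mxE.
have s2 : smooth_map (loc setT c) (fun x => covector (gamma c x) (ext_diff (mu c) x) v).
  move=> q.
  apply: (smooth_eq oL _ (smoothD oL (smooth_ext_diff1 oL smu (sGB v) (sG (unitv R q)))
             (smooth_ext_diff1 oL smu (sG v) (sGB (unitv R q))))) => x xc.
  by rewrite [RHS]mxE mixed_gammaE.
apply: (smooth_eq oL _ (smooth_form3 oL sQ s1 s2 (smooth_map_cst _ (unitv R j)))) => x xc.
by rewrite [RHS]mxE.
Qed.

Lemma corr_change c c' p v : atlas c -> atlas c' -> cdom c p -> cdom c' p ->
  corr c (coord c p) v *m jtrans c c' (coord c p) =
  corr c' (coord c' p) (v *m jtrans c c' (coord c p)).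
Proof.
move=> ac ac' cp c'p; have xc : loc setT c (coord c p) by exact: loc_mem.
have xc' : loc setT c' (coord c' p) by exact: loc_mem.
have [g1 _ g3 _ _] := hg; have [q1 _ q3] := hQ; have [b1 _ b3] := hb.
have smu := diff_form_smooth_form hmu ac; have smu' := diff_form_smooth_form hmu ac'.
apply: correction_change.
- by move=> u; exact: g3.
- by move=> h; exact: q3.
- by move=> u; exact: b3.
- move=> h; have [u [w ->]] := argl2E h; rewrite argl_mulmx /=.
  have oN := open_loc_dom ac ac'.
  have Nx : loc (cdom c') c (coord c p) by exact: loc_mem.
  have phiN y : loc (cdom c') c y -> loc setT c' (trans c c' y).
    by move=> /(locP ac)[y1 _ _]; exact: loc_mem.
  have E : trans c c' (coord c p) = coord c' p by rewrite /trans /= coordK.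
  rewrite -E; apply: (ext_diff1_pullback oN (tilde_oL ac') (smooth_trans ac ac') phiN _ _ smu' Nx).
  move=> z /(locP ac)[z1 z2 z3] h'; have [_ _ m3] := hmu.
  have := m3 c c' (param c z) ac ac' I z2 z1 h'.
  by rewrite z3.
- exact: g1.
- exact: g1.
- exact: (alternating_ext_diff1 (tilde_oL ac) smu).
- exact: (alternating_ext_diff1 (tilde_oL ac') smu').
- exact: b1.
- exact: b1.
- exact: q1.
- exact: q1.
Qed.

Lemma tilde_connection_connection : connection proj setT gt.
Proof.
have [_ g2 g3 _ _] := hg; split.
- by move=> c x ac xc; exact: tilde_lin.
- move=> c v ac j; have oL := tilde_oL ac.
  apply: (smooth_eq oL _ (smoothB oL (g2 c v ac j) (smooth_corr v ac j))) => x xc.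
  by rewrite tildeE// row_addE row_oppE.
- move=> c c' p ac ac' _ cp c'p v; rewrite !tildeE//; [|exact: loc_mem..].
  by rewrite mulmxBl g3// -corr_change.
- by move=> c x ac xc; exact: tilde_vertical.
- by move=> c x ac xc; exact: tilde_id.
Qed.

End TildeConnection.

Section LinearPrecomposition.
Variables (R : realType) (n : nat).
Notation V := 'rV[R]_n.

Lemma alternating_precomp m k (A : alt R n k) (L : 'rV[R]_m -> V) : alternating A ->
  (forall a u v, L (a *: u + v) = a *: L u + L v) -> alternating (fun v => A (fun i => L (v i))).
Proof.
move=> hA hL; have U (v : 'I_k -> 'rV[R]_m) i u : (fun j => L (upd v i u j)) = upd (fun j => L (v j)) i (L u).
  by apply/funext => j; rewrite /upd; case: ifP.
split=> [v i a u z|v i j ij vij]; first by rewrite !U hL (altP hA).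
by apply: (alt_eq0 hA ij); rewrite vij.
Qed.

Lemma argl_comp k (s : seq V) (L : V -> V) : L 0 = 0 ->
  (fun i : 'I_k => L (argl s i)) = argl [seq L v | v <- s].
Proof.
move=> L0; apply/funext => i; rewrite /argl; have [is_|is_] := ltnP i (size s).
  by rewrite (nth_map 0).
by rewrite !nth_default ?size_map.
Qed.

Lemma smooth_form2 N (a : V -> alt R n 2) (X Y : V -> V) : open N -> smooth_form N a ->
  smooth_map N X -> smooth_map N Y -> smooth_on N (fun y => a y (argl [:: X y; Y y])).
Proof.
move=> oN sa sX sY.
apply: (@smooth_eq _ _ N oN (fun y => \sum_i \sum_j X y 0 i * (Y y 0 j * a y (argl [:: unitv R i; unitv R j])))).
  move=> y Ny; have hA := sa.1 y Ny.
  rewrite [in RHS](row_unitv (X y)) (form2_suml hA); apply: eq_bigr => i _.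
  rewrite (form2_Zl hA) [in RHS](row_unitv (Y y)) (form2_sumr hA) mulr_sumr; apply: eq_bigr => j _.
  by rewrite (form2_Zr hA).
apply: (smooth_sum oN) => i; apply: (smooth_sum oN) => j.
exact: (smoothM oN (sX i) (smoothM oN (sY j) (sa.2 _))).
Qed.

End LinearPrecomposition.

(** * The tensors Omega^V, Q_V and Q_H of the modified connection *)

Section TildeForms.
Variables (R : realType) (M : manifold R 5) (B : manifold R 2) (proj : M -> B).
Variables (Omega : field M (alt R 5 5)) (omega : field B (alt R 2 2)).
Notation V := 'rV[R]_5.
Hypothesis hproj : fiber_bundle proj.
Hypothesis hOmega : volume_form Omega.
Hypothesis homega : volume_form omega.

Lemma local_frame (c : chart R M 5) (b : chart R B 2) (W : set V) x :
  atlas c -> atlas b -> open W -> W x -> locdom proj c b x ->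
  exists N (E eps : 'I_5 -> V -> V),
  [/\ open N, N `<=` W, N `<=` locdom proj c b & N x] /\
  [/\ forall j, smooth_map N (E j), forall j, smooth_map N (eps j),
      forall x, N x -> forall i j, \sum_a eps a x 0 i * E a x 0 j = (i == j)%:R,
      forall x, N x -> forall i j, lie (E i) (E j) x = 0 &
      forall x v, N x -> dotp v (eps o0 x) = (v *m 'J (locproj proj c b) x) 0 ord0 /\
                         dotp v (eps o1 x) = (v *m 'J (locproj proj c b) x) 0 ord_max].
Proof.
move=> ac ab oW Wx xb; have ob := open_locdom hproj ac ab.
have sF : smooth_map (W `&` locdom proj c b) (locproj proj c b).
  by move=> j; apply: smooth_sub (smooth_locproj hproj ac ab j) => y [].
have [N [E [eps [[oN NS Nx] H]]]] := frame_exists (openI oW ob) sF (conj Wx xb) (full_locproj hproj ac ab xb).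
by exists N, E, eps; split=> //; split=> // y /NS[].
Qed.

Variables (g gt : field M (V -> V)).
Hypothesis hg : connection proj setT g.
Hypothesis hgt : connection proj setT gt.
Variable OV : field M (alt R 5 3).
Hypothesis hOV : is_OmegaV proj Omega omega setT g OV.

(** Composition with the new vertical projection kills the new horizontal vectors and keeps the
    values on vertical ones, as the new Omega^V has to. *)
Definition OVproj : field M (alt R 5 3) := fun c x v => OV c x (fun i => gt c x (v i)).

Let gtlin c x : atlas c -> loc setT c x -> forall a u v, gt c x (a *: u + v) = a *: gt c x u + gt c x v.
Proof. by have [H _ _ _ _] := hgt; exact: H. Qed.

Lemma mem_locdom (c : chart R M 5) x : atlas c -> loc setT c x ->
  let b := chart_at (proj (param c x)) in atlas b /\ locdom proj c b x.
Proof.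
move=> ac xc /=; have [a' c'] := chart_atP (proj (param c x)); split=> //.
by have [_ cx E] := locP ac xc; exists (param c x).
Qed.

Lemma diff_form_OVproj : diff_form setT OVproj.
Proof.
have [[w1 w2 w3] _ _] := hOV; split.
- move=> c x ac xc; exact: (alternating_precomp (w1 c x ac xc) (gtlin ac xc)).
- move=> c v ac; have oL : open (loc (setT : set M) c) by apply: open_loc => //; exact: openT.
  have [_ s _ _ _] := hgt; have [u [w [z ->]]] := argl3E v.
  have sO : smooth_form (loc setT c) (OV c) by split=> [y yc|h]; [exact: w1 ac yc|exact: w2].
  apply: (smooth_eq oL _ (smooth_form3 oL sO (s c u ac) (s c w ac) (s c z ac))) => x xc.
  by rewrite /OVproj argl_comp//; exact: (lin0 (gtlin ac xc)).
- move=> c c' p ac ac' Up cp c'p v; have [_ _ s _ _] := hgt.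
  rewrite /OVproj (w3 c c' p ac ac' Up cp c'p); congr OV; apply/funext => i.
  exact: s.
Qed.

(** The factorization of Omega is an equality of top-degree forms, hence can be tested on the frame
    alone, where it is [dens_area]. *)
Lemma is_OmegaV_proj : is_OmegaV proj Omega omega setT gt OVproj.
Proof.
split; first exact: diff_form_OVproj.
  by move=> c x ac xc v i v0; have [[w1 _ _] _ _] := hOV; apply: (alt0 (w1 c x ac xc) (i := i)).
move=> c x ac xc v; have [ab xb] := mem_locdom ac xc.
move: (chart_at _) ab xb => b ab xb.
have [N [E [eps [[oN _ NS Nx] [sE seps dual comm epsF]]]]] := local_frame ac ab openT I xb.
have hO : alternating (Omega c x) by have [[H _ _] _] := hOmega; exact: H ac xc.
have hp := alternating_pullback hproj homega ac ab NS Nx.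
have hOVp : alternating (OVproj c x) by have [H _ _] := diff_form_OVproj; exact: H ac xc.
have hw : alternating (wedge (pullback proj omega c x) (OVproj c x)) by exact: (@alternating_wedge _ _ 2 3).
have hd := alternating_sub hO hw.
apply/eqP; rewrite -subr_eq0; apply/eqP; move: v.
apply: (alt_top_eq0 hd (b := argl [:: E o0 x; E o1 x; E o2 x; E o3 x; E o4 x])).
  move=> u; exists (fun j => dotp u (eps j x)); rewrite [LHS](frame_expand dual u Nx).
  by apply: eq_bigr => j _; congr (_ *: _); move: j; apply: ord5_ind.
rewrite -(dens_area hproj homega ac ab NS dual epsF hOV Nx).
have Ev (a : 'I_5) := frame_vertical hproj ac ab NS dual epsF (a := a) Nx.
rewrite (wedge23 _ _ hp hOVp); last first.
  by move=> y; split; apply: (pullback_vertical hproj homega ac ab NS) => //; exact: Ev.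
rewrite (pullback_area hproj homega ac ab NS dual epsF Nx) /OVproj argl_comp; last first.
  exact: (lin0 (gtlin ac xc)).
have [_ _ _ _ gid] := hgt.
by rewrite /= (gid c x ac xc _ (Ev o2 isT)) (gid c x ac xc _ (Ev o3 isT)) (gid c x ac xc _ (Ev o4 isT)) subrr.
Qed.

(** For either connection the product with the nonzero function [area] is the value of Omega on the
    frame. *)
Lemma dens_unique (g' : field M (V -> V)) OV' (c : chart R M 5) (b : chart R B 2) N (E eps : 'I_5 -> V -> V) y :
  atlas c -> atlas b -> N `<=` locdom proj c b ->
  (forall x, N x -> forall i j, \sum_a eps a x 0 i * E a x 0 j = (i == j)%:R) ->
  (forall x v, N x -> dotp v (eps o0 x) = (v *m 'J (locproj proj c b) x) 0 ord0 /\
                      dotp v (eps o1 x) = (v *m 'J (locproj proj c b) x) 0 ord_max) ->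
  is_OmegaV proj Omega omega setT g' OV' -> N y -> dens E (OV' c) y = dens E (OV c) y.
Proof.
move=> ac ab NS dual epsF h' Ny.
apply: (mulfI (area_neq0 homega ac ab NS Ny)).
by rewrite (dens_area hproj homega ac ab NS dual epsF h' Ny) (dens_area hproj homega ac ab NS dual epsF hOV Ny).
Qed.

(** In the frame the normalization of Q_V involves Omega^V only through its density, which all
    connections share. *)
Lemma is_QV_proj (OV0 Q : field M (alt R 5 3)) (g' : field M (V -> V)) :
  is_OmegaV proj Omega omega setT g' OV0 -> is_QV proj setT OV0 Q -> is_QV proj setT OVproj Q.
Proof.
move=> h0 hQ; have [mQ tQ _] := hQ; split=> // c x ac xc v; have [ab xb] := mem_locdom ac xc.
move: (chart_at _) ab xb => b ab xb.
have [N [E [eps [[oN _ NS Nx] [sE seps dual comm epsF]]]]] := local_frame ac ab openT I xb.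
have hOVp : alternating (OVproj c x) by have [H _ _] := diff_form_OVproj; exact: H ac xc.
have [hQx Q0 Q1 QW] := QV_frame hproj ac ab NS dual epsF h0 hQ Nx.
rewrite (_ : v = argl [::]); last by apply/funext => -[].
rewrite (iprod3_frame (dual x Nx) (B := OVproj c x : alt R 5 (3 + 0)))// (@cat_argl _ _ 3 0)//.
rewrite -[OVproj _ _ _]/(dens E (OVproj c) x) (dens_unique ac ab NS dual epsF is_OmegaV_proj Nx).
by rewrite -(dens_unique ac ab NS dual epsF h0 Nx) QW opprK.
Qed.

(** The transpose of the horizontal projection of [gt], acting on covectors. *)
Definition hadj (c : chart R M 5) (x u : V) : V := \row_l dotp (unitv R l - gt c x (unitv R l)) u.

Lemma dotp_hadj c x z u : atlas c -> loc setT c x -> dotp z (hadj c x u) = dotp (z - gt c x z) u.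
Proof.
move=> ac xc; have Gl := gtlin ac xc.
have ds (r : seq 'I_5) (f : 'I_5 -> V) : dotp (\sum_(i <- r) f i) u = \sum_(i <- r) dotp (f i) u.
  elim: r => [|i r IH]; rewrite ?big_nil ?big_cons ?dotpDl ?IH//.
  by rewrite /dotp big1// => j _; rewrite mxE mul0r.
rewrite [z in RHS](row_unitv z) (lin_sum Gl) -sumrB ds; apply: eq_bigr => l _.
by rewrite (linZ Gl) -scalerBr dotpZl [X in _ * X]mxE.
Qed.

Variable K : field M (alt R 5 2).
Hypothesis hK : is_QH proj omega setT g K.

(** The image of the old Q_H under the new horizontal projection, since a bivector is pushed forward
    by transposing on its arguments. *)
Definition QHproj : field M (alt R 5 2) := fun c x u => K c x (fun i => hadj c x (u i)).

Lemma hadjP c x a u v : hadj c x (a *: u + v) = a *: hadj c x u + hadj c x v.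
Proof.
have dr z : dotp z (a *: u + v) = a * dotp z u + dotp z v by rewrite !(dotpC z) dotpDl dotpZl.
apply/rowP => l; rewrite row_addE row_scaleE /hadj [LHS]mxE dr.
by congr (_ * _ + _); rewrite [RHS]mxE.
Qed.

Lemma hadj_horizontal c x u : atlas c -> loc setT c x ->
  (forall v, gt c x v = 0 -> dotp v u = 0) -> hadj c x u = 0.
Proof.
move=> ac xc H; apply: dotp_inj => z; rewrite dotpC dotp_hadj// H.
  by rewrite /dotp big1// => j _; rewrite mxE mul0r.
have [_ _ _ gv gid] := hgt.
exact: (Gh (D := dproj proj c x) (gtlin ac xc) (gv c x ac xc) (gid c x ac xc)).
Qed.

(** The covectors eps_0, eps_1 annihilate vertical vectors, so [hadj] fixes them. The component of
    Q_H on them, and with it the normalization, is unchanged. *)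
Lemma is_QH_proj : is_QH proj omega setT gt QHproj.
Proof.
have [[k1 k2 k3] tK iK] := hK.
have mQ : multivector_field setT QHproj.
  split.
  - move=> c x ac xc; apply: (alternating_precomp (k1 c x ac xc)) => a u v; exact: hadjP.
  - move=> c v ac; have oL : open (loc (setT : set M) c) by apply: open_loc => //; exact: openT.
    have sK : smooth_form (loc setT c) (K c) by split=> [y yc|h]; [exact: k1 ac yc|exact: k2].
    have [_ sgt _ _ _] := hgt; have [u [w ->]] := argl2E v.
    have sA z : smooth_map (loc setT c) (fun x => hadj c x z).
      move=> l; apply: (@smooth_eq _ _ _ oL (fun x => \sum_m ((unitv R l : V) 0 m - gt c x (unitv R l) 0 m) * z 0 m)).
        by move=> x _; rewrite [RHS]mxE; apply: eq_bigr => m _; rewrite row_addE row_oppE.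
      apply: (smooth_sum oL) => m.
      exact: (smoothM oL (smoothB oL (smooth_cst _ _) (sgt c (unitv R l) ac m)) (smooth_cst _ (z 0 m))).
    apply: (smooth_eq oL _ (smooth_form2 oL sK (sA u) (sA w))) => x xc.
    rewrite /QHproj argl_comp//; apply/rowP => l; rewrite [LHS]mxE [RHS]mxE.
    by rewrite /dotp big1// => j _; rewrite [X in _ * X]mxE mulr0.
  - move=> c c' p ac ac' Up cp c'p v; have [_ _ s _ _] := hgt.
    rewrite /QHproj (k3 c c' p ac ac' Up cp c'p); congr K; apply/funext => i.
    apply: dotp_inj => z; rewrite ![dotp _ z]dotpC -dotp_mulmx dotp_hadj//; last exact: loc_mem.
    rewrite dotp_hadj//; last exact: loc_mem.
    by rewrite -dotp_mulmx mulmxBl s.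
have tQ : tangent_to_H gt setT QHproj.
  move=> c x ac xc u i H; apply: (alt0 (k1 c x ac xc) (i := i)).
  exact: hadj_horizontal.
split=> // c x ac xc v; have [ab xb] := mem_locdom ac xc.
move: (chart_at _) ab xb => b ab xb.
have [N [E [eps [[oN _ NS Nx] [sE seps dual comm epsF]]]]] := local_frame ac ab openT I xb.
have [H1 _ _] := mQ.
rewrite (iprod_pullback hproj homega ac ab NS dual epsF hgt v Nx (H1 c x ac xc)).
  have eE (j : 'I_5) : (j < 2)%N -> hadj c x (eps j x) = eps j x.
    move=> j2; apply: dotp_inj => z; rewrite ![dotp _ z]dotpC dotp_hadj// dotpDl -scaleN1r dotpZl.
    have /(verticalP hproj ac ab NS epsF _ Nx)[e0 e1] : vertical proj c x (gt c x z).
      by have [_ _ _ gv _] := hgt; exact: gv ac xc z.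
    have /orP[/eqP->|/eqP->] : (j == o0) || (j == o1) by move: j2; case: j => -[|[|l]] hl.
      by rewrite e0 mulr0 addr0.
    by rewrite e1 mulr0 addr0.
  rewrite /QHproj argl_comp /= ?eE//; last first.
    by apply: hadj_horizontal => // w _; rewrite /dotp big1// => j _; rewrite mxE mulr0.
  have [_ _ ->] := QH_frame hproj homega ac ab NS dual epsF hg hK Nx.
  by rewrite opprK.
move=> p u u0 u1; apply: (tQ c x ac xc _ ord_max) => w w0.
have [s [t ->]] := horizontal_expand hproj ac ab NS dual epsF hgt Nx w0.
by rewrite /argl /= dotpDl !dotpZl u0 u1 !mulr0 addr0.
Qed.

End TildeForms.

(** * Reduction of the third equation to cyclic index triples *)

Section CyclicForm.
Variables (R : realType) (N : set 'rV[R]_5).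
Notation V := 'rV[R]_5.
Variables (E : 'I_5 -> V -> V) (Gam : 'I_5 -> 'I_5 -> V -> R).
Variables (W : V -> alt R 5 3) (b : V -> alt R 5 1) (k w : V -> R) (x : V).
Hypothesis sW : smooth_form N W.
Hypothesis Nx : N x.

Notation eq3 := (eq3 E Gam W b k w x).
Notation cyc p q s := (dird (E q x) k x * cmp E b s x - dird (E s x) k x * cmp E b q x
  + k x ^+ 2 * ((w x)^-1 * (dens E W x * curv E Gam p x))).

(** Together with E_q and E_s the volume form detects only the component of the curvature along
    E_p. *)
Lemma eq3_cyc p q s : cyclic3 p q s -> eq3 q s = cyc p q s.
Proof.
have hW := sW.1 x Nx.
have [P1 P2 P3 P4 P5] := form3_perms (E o2 x) (E o3 x) (E o4 x) hW.
rewrite /eq3 (W_vert E sW _ _ _ _ _ Nx) /cyclic3 !inE => /or3P[] /eqP[-> -> ->];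
  congr (_ + _ * (_ * _)); rewrite ?(form3_alt12 hW) ?(form3_alt13 hW) ?P3 ?P4 -/(dens E W x) mulrC; ring.
Qed.

Lemma eq3_anti a c : eq3 a c = - eq3 c a.
Proof.
rewrite /eq3 (form3_anti23 (sW.1 x Nx)); gen_dird.
move: (W x _) => t; ring.
Qed.

Lemma eq3_diag a : eq3 a a = 0.
Proof. by rewrite /eq3 subrr (form3_alt23 (sW.1 x Nx)) !mulr0 addr0. Qed.

(** Two vertical indices are either equal or, in one of the two orders, part of a cyclic triple. *)
Lemma eq3_cyclic : (forall p q s, cyclic3 p q s -> cyc p q s = 0) ->
  forall a c : 'I_5, (2 <= a)%N -> (2 <= c)%N -> eq3 a c = 0.
Proof.
move=> H a c a2 c2.
have H' p q s : cyclic3 p q s -> eq3 q s = 0 by move=> h; rewrite (eq3_cyc h) H.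
have K : a = c \/ exists p, cyclic3 p a c \/ cyclic3 p c a.
  clear -a2 c2; rewrite /cyclic3.
  have F (d : 'I_5) : (2 <= d)%N -> [|| d == o2, d == o3 | d == o4] by case: d => -[|[|[|[|[|d]]]]].
  have /or3P[/eqP->|/eqP->|/eqP->] := F a a2; have /or3P[/eqP->|/eqP->|/eqP->] := F c c2;
    try (by left); right; [exists o4|exists o3|exists o4|exists o2|exists o3|exists o2];
    rewrite !inE !xpair_eqE -!val_eqE /=; by [left|right].
case: K => [->|[p [h|h]]]; first exact: eq3_diag; first exact: H' h.
by rewrite eq3_anti (H' _ _ _ h) oppr0.
Qed.

End CyclicForm.

(** * Coordinate fields of the base and their horizontal lifts *)

Section BaseFields.
Variables (R : realType) (m : nat) (B : manifold R m).

(* The coordinate field d/dx_i of the chart b. *)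
Definition basefield (b : chart R B m) (i : 'I_m) : field B 'rV[R]_m :=
  fun b' q => unitv R i *m jtrans b b' (coord b (param b' q)).

Lemma vector_field_basefield b i : atlas b -> vector_field (cdom b) (basefield b i).
Proof.
move=> ab; split=> [b' ab' j|b1 b2 p a1 a2 bp b1p b2p]; last first.
  rewrite /basefield (coordK a1 b1p) (coordK a2 b2p) (jtrans_comp ab a1 a2 bp b1p b2p).
  exact: mulmxA.
have oN := open_loc_dom ab ab'; have sphi := smooth_trans ab ab'.
pose f := dird (unitv R i) (fun z => trans b b' z 0 j).
have sf : smooth_on (loc (cdom b') b) f.
  exact: (smooth_dird oN (sphi j) (smooth_map_cst _ (unitv R i))).
have phiN q : loc (cdom b) b' q -> loc (cdom b') b (trans b' b q).
  by move=> /(locP ab')[q1 q2 q3]; apply: loc_mem.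
have oN' := open_loc_dom ab' ab.
apply: (smooth_eq oN' _ (smooth_comp oN' oN phiN (smooth_trans ab' ab) sf)) => q /phiN qN.
by rewrite /basefield /jtrans (mulmx_jacobianE oN sphi _ _ qN).
Qed.

End BaseFields.

Section HorizontalLift.
Variables (R : realType) (M : manifold R 5) (B : manifold R 2) (proj : M -> B).
Notation V := 'rV[R]_5.
Hypothesis hproj : fiber_bundle proj.
Variable g : field M (V -> V).
Hypothesis hg : connection proj setT g.
Variable u : field B 'rV[R]_2.

(** [pinvmx] selects a preimage under the differential of the projection; subtracting its vertical
    part makes it horizontal. *)
Definition lift_field : field M V := fun c y =>
  let z := base_value proj u c y *m pinvmx (dproj proj c y) in z - g c y z.

Lemma horizontal_lift_field (W : set B) : horizontal_lift proj g W u lift_field.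
Proof.
move=> c x ac xW; have xc := loc_setT xW.
have [_ _ _ hD] := hproj; have [H1 _ _ gv gid] := hg.
split; first exact: (Gh (D := dproj proj c x) (H1 c x ac xc) (gv c x ac xc) (gid c x ac xc)).
rewrite /lift_field mulmxBl (gv c x ac xc) subr0 mulmxKpV//.
by apply: submx_full; exact: hD.
Qed.

End HorizontalLift.

(** * Poisson triples in an adapted frame *)

Section LocalTilde.
Variables (R : realType) (M : manifold R 5) (B : manifold R 2) (proj : M -> B).
Variables (Omega : field M (alt R 5 5)) (omega : field B (alt R 2 2)).
Notation V := 'rV[R]_5.
Hypothesis hproj : fiber_bundle proj.
Hypothesis hOmega : volume_form Omega.
Hypothesis homega : volume_form omega.
Variables (gamma : field M (V -> V)) (beta mu : field M (alt R 5 1)).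
Variables (OmegaV QV OV : field M (alt R 5 3)).
Hypothesis hg : connection proj setT gamma.
Hypothesis hb : diff_form setT beta.
Hypothesis bH : annihilates_H gamma setT beta.
Hypothesis hOmegaV : is_OmegaV proj Omega omega setT gamma OmegaV.
Hypothesis hQV : is_QV proj setT OmegaV QV.
Hypothesis hOV : is_OmegaV proj Omega omega setT gamma OV.
Hypothesis hmu : diff_form setT mu.
Hypothesis hmuV : annihilates_V proj setT mu.

Variables (c : chart R M 5) (b : chart R B 2).
Hypotheses (ac : atlas c) (ab : atlas b).
Notation F := (locproj proj c b).
Variable N : set V.
Hypothesis oN : open N.
Hypothesis NS : N `<=` locdom proj c b.
Variables E eps : 'I_5 -> V -> V.
Hypothesis sE : forall j, smooth_map N (E j).
Hypothesis seps : forall j, smooth_map N (eps j).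
Hypothesis dual : forall x, N x -> forall i j, \sum_a eps a x 0 i * E a x 0 j = (i == j)%:R.
Hypothesis comm : forall x, N x -> forall i j, lie (E i) (E j) x = 0.
Hypothesis epsF : forall x v, N x -> dotp v (eps o0 x) = (v *m 'J F x) 0 ord0 /\
                                    dotp v (eps o1 x) = (v *m 'J F x) 0 ord_max.

Notation gt := (tilde_connection gamma QV beta mu).
Notation Gam := (gam c E eps gamma).
Notation bet := (cmp E (beta c)).
Notation rho := (dens E (OV c)).
Notation mui := (cmp E (mu c)).
Notation h i := (hor E Gam i).
Notation D j f := (fun x => dird (E j x) f x).

Lemma local_smooth_form k (a : field M (alt R 5 k)) : diff_form setT a -> smooth_form N (a c).
Proof. exact: (form_smooth ac NS). Qed.

Let NL y : N y -> loc setT c y. Proof. exact: (frame_loc NS). Qed.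
Let sb := local_smooth_form hb.
Let smu := local_smooth_form hmu.

Lemma mu_vert (a : 'I_5) y : N y -> (2 <= a)%N -> mui a y = 0.
Proof.
by move=> Ny a2; apply: (hmuV ac (NL Ny) (i := ord0)); exact: (frame_vertical hproj ac ab NS dual epsF).
Qed.

Lemma QV_rho y : N y -> QV c y (argl [:: eps o2 y; eps o3 y; eps o4 y]) * rho y = -1.
Proof.
move=> Ny; have [_ _ _ <-] := QV_frame hproj ac ab NS dual epsF hOmegaV hQV Ny.
by rewrite (dens_unique hproj homega hOmegaV ac ab NS dual epsF hOV Ny).
Qed.

Lemma rho_neq0_local y : N y -> rho y != 0.
Proof. by move=> Ny; exact: (@rho_neq0 R E eps (OV c) (QV c) y (QV_rho Ny)). Qed.

(** The arguments are expanded in the coframe, where Q_V ignores eps_0 and eps_1; the sign is that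
    of [QV_rho]. *)
Lemma QV_cov y p q r : N y -> QV c y (argl [:: p; q; r]) = - ((rho y)^-1 *
  det3 (dotp p (E o2 y)) (dotp p (E o3 y)) (dotp p (E o4 y))
       (dotp q (E o2 y)) (dotp q (E o3 y)) (dotp q (E o4 y))
       (dotp r (E o2 y)) (dotp r (E o3 y)) (dotp r (E o4 y))).
Proof.
move=> Ny; have [hQ Q0 Q1 _] := QV_frame hproj ac ab NS dual epsF hOmegaV hQV Ny.
rewrite {1}(coframe_expand dual p Ny) {1}(coframe_expand dual q Ny) {1}(coframe_expand dual r Ny).
rewrite (form3_comb _ _ _ hQ Q0 Q1) mulrC -mulNr; congr (_ * _).
by apply: (mulIf (rho_neq0_local Ny)); rewrite QV_rho// mulNr mulVf ?rho_neq0_local//.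
Qed.

(** The coefficient grows by the pairing of [correction] of E_i with eps_a. Q_V carries -1/rho and
    d_{0,1} mu (E_i, E_j) = - E_j mu_i, so the signs cancel and rho^-1 (beta x d mu_i) results. *)
Lemma gam_tilde (i : 'I_5) (a : 'I_5) y : (i < 2)%N -> (2 <= a)%N -> N y ->
  gam c E eps gt i a y = Gshift E Gam bet rho mui i a y.
Proof.
move=> i2 a2 Ny; have [mQ tQ _] := hQV; have yL := NL Ny.
have [qa _ _] := mQ; have [ba _ _] := hb.
rewrite /gam (tildeE hg mQ tQ hb hmu ac yL) dotpDl.
have dN (u z : V) : dotp (- u) z = - dotp u z by rewrite -scaleN1r dotpZl mulN1r.
rewrite dN opprB addrC.
rewrite /Gshift; congr (_ + _).
rewrite /corr dotp_correction; last exact: qa ac yL.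
have hA : alternating (ext_diff (mu c) y) by exact: (alternating_ext_diff1 oN smu Ny).
have [gl _ _ _ _] := hg; have hM := alternating_mixed (gl c y ac yL) hA.
have e1 (j : 'I_5) : dotp (row_of_alt (beta c y)) (E j y) = bet j y.
  by rewrite -form1E//; exact: ba ac yL.
have e2 (j : 'I_5) : (2 <= j)%N ->
    dotp (covector (gamma c y) (ext_diff (mu c) y) (E i y)) (E j y) = - D j (mui i) y.
  move=> j2; have gE := conn_frame hproj ac ab NS dual epsF hg Ny j2.
  rewrite (dotp_covector (gl c y ac yL) hA) (mixed_gammaE hg hmu ac yL) gE subrr (form2_0r hA) addr0.
  rewrite -(horE hproj ac ab NS dual epsF hg i Ny).
  exact: (d1h_hor_vert oN sE comm (smooth_gam ac oN NS sE seps hg) smu (fun a y Ny a2 => mu_vert Ny a2) i j2 Ny).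
have e3 (j : 'I_5) : dotp (eps a y) (E j y) = (j == a)%:R.
  by rewrite dotpC (dualC dual).
rewrite QV_cov// !e1 !e2// !e3.
have H : forall a, [|| a == o2, a == o3 | a == o4] -> shift E bet rho (mui i) a y = 
  - ((rho y)^-1 * det3 (bet o2 y) (bet o3 y) (bet o4 y) (- D o2 (mui i) y) (- D o3 (mui i) y) (- D o4 (mui i) y)
      (o2 == a)%:R (o3 == a)%:R (o4 == a)%:R).
  move=> a' /or3P[] /eqP ->; rewrite /shift /= hamE /det3 /=; gen_dird; ring.
symmetry; apply: H.
by move: a2; case: (a) => -[|[|[|[|[|l]]]]] hl.
Qed.

Lemma hor_tilde (i : 'I_5) y : (i < 2)%N -> N y ->
  hor E (Gshift E Gam bet rho mui) i y = hor E (gam c E eps gt) i y.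
Proof. by move=> i2 Ny; rewrite /hor !gam_tilde. Qed.

(** [F1] and [F2] are smooth representatives: the functions mu(Y_i) to which this is applied are
    identified with frame components on [N] only. *)
Lemma bracket_frame f1 f2 F1 F2 y : N y -> smooth_on N F1 -> smooth_on N F2 ->
  (forall z, N z -> f1 c z = F1 z) -> (forall z, N z -> f2 c z = F2 z) ->
  bracket QV beta f1 f2 c y = brk E bet rho o2 o3 o4 F1 F2 y.
Proof.
move=> Ny s1 s2 H1 H2; have [[qa _ _] _ _] := hQV; have yL := NL Ny; have [ba _ _] := hb.
have hQ := qa c y ac yL.
rewrite /bracket /P_ (@iprod1E R 5 2 (beta c y) (QV c y) _ hQ) args2E (@cat_argl _ _ 1 2)//=.
have e1 (j : 'I_5) : dotp (row_of_alt (beta c y)) (E j y) = bet j y.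
  by rewrite -form1E//; exact: ba ac yL.
have e2 (f : field M R) G (j : 'I_5) : smooth_on N G -> (forall z, N z -> f c z = G z) ->
    dotp (gradient (f c) y) (E j y) = D j G y.
  move=> sG fG; rewrite (dirdE oN _ Ny sG); apply: eq_bigr => l _.
  rewrite mulrC [X in _ * X]mxE; congr (_ * _); apply: partial_eq_near.
  by apply: filterS (near_open oN Ny) => z Nz; exact: fG.
rewrite QV_cov// !e1 !(e2 f1 F1)// !(e2 f2 F2)// opprK /brk /det3; congr (_ * _).
gen_dird; ring.
Qed.

(** Both vectors are horizontal with the same projection to the base, so their difference is
    horizontal and vertical at once. *)
Lemma lift_hor (i : 'I_5) (i' : 'I_2) y : N y -> E i y *m 'J F y = unitv R i' ->
  lift_field proj gamma (basefield b i') c y = h i y.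
Proof.
move=> Ny Ei; have yL := NL Ny; have [gl _ _ gv gid] := hg.
have yb : loc (proj @^-1` cdom b) c y := NS Ny.
have [l0 l1] := horizontal_lift_field hproj hg (basefield b i') ac yb.
have h0 := conn_hor hproj ac ab NS dual epsF hg i Ny.
have h1 : h i y *m dproj proj c y = base_value proj (basefield b i') c y.
  rewrite (horE hproj ac ab NS dual epsF hg i Ny) mulmxBl (gv c y ac yL) subr0.
  rewrite (dprojE hproj ac ab (NS Ny)) mulmxA Ei /base_value /basefield.
  have [aq cq] := chart_atP (proj (param c y)).
  rewrite (coordK aq cq).
  reflexivity.
have dv : vertical proj c y (lift_field proj gamma (basefield b i') c y - h i y).
  by rewrite /vertical mulmxBl l1 h1 subrr.
apply/eqP; rewrite -subr_eq0 -(gid c y ac yL _ dv) (linB (gl c y ac yL)) l0 h0 subrr.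
exact: eqxx.
Qed.

(** The relation defining varkappa is evaluated on the lifts of the two coordinate fields of the
    base chart, which are h_0 and h_1. *)
Lemma varkappa_frame vk y : is_varkappa proj omega gamma QV beta mu vk -> N y ->
  vk (param c y) * area proj omega c b y =
  hop E Gam o0 (mui o1) y - hop E Gam o1 (mui o0) y + brk E bet rho o2 o3 o4 (mui o0) (mui o1) y.
Proof.
move=> [_ [mm [_ _ hmm] hvk]] Ny; have yL := NL Ny.
have F0 z : N z -> E o0 z *m 'J F z = unitv R ord0 by exact: (frame_F0 dual epsF).
have F1 z : N z -> E o1 z *m 'J F z = unitv R ord_max by exact: (frame_F1 dual epsF).
have Y0 z : N z -> lift_field proj gamma (basefield b ord0) c z = h o0 z.
  by move=> Nz; exact: lift_hor Nz (F0 z Nz).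
have Y1 z : N z -> lift_field proj gamma (basefield b ord_max) c z = h o1 z.
  by move=> Nz; exact: lift_hor Nz (F1 z Nz).
have yb : loc (proj @^-1` cdom b) c y := NS Ny.
have := hmm (cdom b) _ _ _ _ (cdom_open ab) (vector_field_basefield ord0 ab)
  (vector_field_basefield ord_max ab) (horizontal_lift_field hproj hg _ (W := cdom b))
  (horizontal_lift_field hproj hg _ (W := cdom b)) c y ac yb.
rewrite args2E (Y0 y Ny) (Y1 y Ny).
have sG := smooth_gam ac oN NS sE seps hg.
have bV (a : 'I_5) z : N z -> (2 <= a)%N -> mui a z = 0 by exact: mu_vert.
have p0 z : N z -> pairing mu (lift_field proj gamma (basefield b ord0)) c z = mui o0 z.
  by move=> Nz; rewrite /pairing (Y0 z Nz) argl1_cst (cmp_hor Gam smu bV).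
have p1 z : N z -> pairing mu (lift_field proj gamma (basefield b ord_max)) c z = mui o1 z.
  by move=> Nz; rewrite /pairing (Y1 z Nz) argl1_cst (cmp_hor Gam smu bV).
have sm j : smooth_on N (mui j) by exact: (smooth_cmp oN sE smu).
rewrite (bracket_frame Ny (sm o0) (sm o1) p0 p1) (bracket_frame Ny (sm o1) (sm o0) p1 p0) => mmE.
have := hvk c y ac yL (argl [:: h o0 y; h o1 y]).
rewrite (pullback_hor hproj homega ac ab NS dual epsF hg Ny) mmE => <-.
have hA : alternating (ext_diff (mu c) y) by exact: (alternating_ext_diff1 oN smu Ny).
have H0 i := conn_hor hproj ac ab NS dual epsF hg i Ny.
rewrite /d10 (@bicomp_argl _ _ _ _ _ 2 [:: true; true] _ hA)//; last first.
  by move=> -[|[|l]]// _; exact: H0.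
rewrite /=.
rewrite (d1h_hor oN sE comm sG smu bV Ny); congr (_ + _).
(* By antisymmetry of the bracket, the difference {mu_0, mu_1} - {mu_1, mu_0} is twice {mu_0, mu_1},
   which cancels the factor 1/2. *)
rewrite /brk; gen_dird; move: (rho y)^-1 => r; by field.
Qed.

Variables (QV' : field M (alt R 5 3)) (K : field M (alt R 5 2)) (kappa cas vk : M -> R).
Hypothesis hQV' : is_QV proj setT OV QV'.
Hypothesis hK : is_QH proj omega setT gamma K.
Hypothesis skappa : smooth_fun setT kappa.
Hypothesis scas : smooth_fun setT cas.
Hypothesis e1 : on_charts (setT : set M) (fun c x => forall v,
  wedge (d01 gamma 0 beta c x) (beta c x) v = 0).
Hypothesis e2 : on_charts (setT : set M) (fun c x => forall v, kappa (param c x) *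
  (d10 gamma 0 beta c x v - wedge (theta gamma OV QV' c x) (beta c x) v) = 0).
Hypothesis e3 : on_charts (setT : set M) (fun c x => forall v,
  wedge (d01 gamma 0 (form0 kappa) c x) (beta c x) v
  - kappa (param c x) ^+ 2 * varrho gamma OV K c x v = 0).
Hypothesis hcas : casimir gamma beta cas.
Hypothesis hvk : is_varkappa proj omega gamma QV beta mu vk.
Hypothesis u0 : forall y, N y -> 1 - kappa (param c y) * (vk (param c y) - cas (param c y)) != 0.

Notation k := (kappa \o param c).
Notation w := (area proj omega c b).

Lemma smooth_on_param f : smooth_fun (setT : set M) f -> smooth_on N (f \o param c).
Proof. by move=> sf; apply: smooth_sub (sf c ac) => y; exact: NL. Qed.

Let sG := smooth_gam ac oN NS sE seps hg.
Let sW := OV_smooth ac NS hOV.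
Let glin y (Ny : N y) := connP ac NS hg Ny.
Let gV y (a : 'I_5) (Ny : N y) (a2 : (2 <= a)%N) := conn_frame hproj ac ab NS dual epsF hg Ny a2.
Let gH y (i : 'I_5) (Ny : N y) (i2 : (i < 2)%N) := conn_hor hproj ac ab NS dual epsF hg i Ny.

Lemma OV_hor y (i : 'I_5) p q : N y -> (i < 2)%N -> OV c y (argl [:: h i y; p; q]) = 0.
Proof. by move=> Ny i2; apply: (OV_horizontal ac NS hOV _ _ Ny); exact: gH. Qed.

Lemma beta_hor (i : 'I_5) y : N y -> (i < 2)%N -> beta c y (argl [:: h i y]) = 0.
Proof. by move=> Ny i2; apply: (bH ac (NL Ny) (i := ord0)); exact: gH. Qed.

Variable x : V.
Hypothesis Nx : N x.

(** The first equation of the triple, evaluated on E_2, E_3, E_4. *)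
Lemma jacob_beta : jacob E bet x o2 o3 o4 = 0.
Proof.
have hB : alternating (ext_diff (beta c) x) by exact: (alternating_ext_diff1 oN sb Nx).
have := e1 ac (NL Nx) (argl [:: E o2 x; E o3 x; E o4 x]).
rewrite (wedge21 _ _ _ _ (A := d01 gamma 0 beta c x)); last first.
  by apply: alternating_bicomp hB _; exact: glin.
have dB (i j : 'I_5) : (2 <= i)%N -> (2 <= j)%N -> d01 gamma 0 beta c x (argl [:: E i x; E j x]) =
    dird (E i x) (bet j) x - dird (E j x) (bet i) x.
  move=> i2 j2; rewrite /d01 (@bicomp_argl _ _ _ _ _ 0 [:: false; false] _ hB)//; last first.
    by move=> -[|[|l]]// _; exact: gV.
  exact: (d1_vert oN sE comm sb i j Nx).
rewrite !dB// => <-; rewrite /jacob /cmp; gen_dird.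
move: (beta c x _) (beta c x _) (beta c x _) => b2 b3 b4; ring.
Qed.

Lemma inv2_gamma (i a : 'I_5) : (i < 2)%N -> (2 <= a)%N -> k x * inv2 E bet rho x Gam i a = 0.
Proof.
move=> i2 a2; have [hQ Q0 Q1 QW] := QV_frame hproj ac ab NS dual epsF hOV hQV' Nx.
have [H _] := eq2_iff oN sE dual comm sG glin gV gH k sW OV_hor sb (fun i y Ny i2 => beta_hor Ny i2) Nx hQ Q0 Q1 QW.
by apply: H => // v; exact: e2 ac (NL Nx) v.
Qed.

Lemma curv_gamma p q s : cyclic3 p q s -> dird (E q x) k x * bet s x - dird (E s x) k x * bet q x +
  k x ^+ 2 * ((w x)^-1 * (rho x * curv E Gam p x)) = 0.
Proof.
move=> hc; have [hKx KH Kw] := QH_frame hproj homega ac ab NS dual epsF hg hK Nx.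
have [H _] := eq3_iff oN sE dual comm sG glin gV gH sW OV_hor sb (fun i y Ny i2 => beta_hor Ny i2)
  (smooth_on_param skappa) Nx hKx KH Kw.
have [q2 s2] : (2 <= q)%N /\ (2 <= s)%N by split; [exact: cyclic3_ge2 (cyclic3_rot hc)|
  exact: cyclic3_ge2 (cyclic3_rot (cyclic3_rot hc))].
rewrite -(@eq3_cyc R N E Gam (OV c) (beta c) k w x sW Nx p q s hc).
by apply: H => // v; exact: e3 ac (NL Nx) v.
Qed.

Lemma casimir_frame (q s : 'I_5) : (2 <= q)%N -> (2 <= s)%N ->
  dird (E q x) (cas \o param c) x * bet s x - dird (E s x) (cas \o param c) x * bet q x = 0.
Proof.
move=> q2 s2; have hD := hdk oN (smooth_on_param scas) Nx.
have := hcas ac (NL Nx) (argl [:: E q x; E s x]).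
rewrite (wedge11 _ _ _ (A := d01 gamma 0 (form0 cas) c x)); last first.
  by apply: alternating_bicomp hD _; exact: glin.
have dB (i : 'I_5) : (2 <= i)%N -> d01 gamma 0 (form0 cas) c x (argl [:: E i x]) = dird (E i x) (cas \o param c) x.
  move=> i2; rewrite /d01 (@bicomp_argl _ _ _ _ _ 0 [:: false] _ hD)//; last first.
    by move=> -[|l]// _; exact: gV.
  exact: ext_diff0.
by rewrite !dB//.
Qed.

Let mQ : multivector_field setT QV. Proof. by have [] := hQV. Qed.
Let tQ : tangent_to_V proj setT QV. Proof. by have [] := hQV. Qed.

Let hgt : connection proj setT gt := tilde_connection_connection hg mQ tQ hb hmu.

Notation Gam' := (Gshift E Gam bet rho mui).
Notation OV' := (OVproj gt OV).
Notation K' := (QHproj gt K).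
Notation kt := (tilde_kappa kappa vk cas \o param c).

Let sbet (a : 'I_5) : smooth_on N (bet a) := smooth_cmp oN sE sb a.
Let smui (i : 'I_5) : smooth_on N (mui i) := smooth_cmp oN sE smu i.
Let srho : smooth_on N rho := smooth_dens oN sE sW.
Let sG' := smooth_Gshift oN sE sG sbet srho (fun y Ny => rho_neq0_local Ny) smui.
Let hOV' : is_OmegaV proj Omega omega setT gt OV' := is_OmegaV_proj hproj hOmega homega hgt hOV.
Let sW' := OV_smooth ac NS hOV'.
Let glin' y (Ny : N y) := connP ac NS hgt Ny.
Let gV' y (a : 'I_5) (Ny : N y) (a2 : (2 <= a)%N) := conn_frame hproj ac ab NS dual epsF hgt Ny a2.

Let gH' y (i : 'I_5) : N y -> (i < 2)%N -> gt c y (hor E Gam' i y) = 0.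
Proof.
by move=> Ny i2; rewrite hor_tilde//; exact: (conn_hor hproj ac ab NS dual epsF hgt).
Qed.

Let OV_hor' y (i : 'I_5) p q : N y -> (i < 2)%N -> OV' c y (argl [:: hor E Gam' i y; p; q]) = 0.
Proof. by move=> Ny i2; apply: (OV_horizontal ac NS hOV' _ _ Ny); exact: gH'. Qed.

Let beta_hor' (i : 'I_5) y : N y -> (i < 2)%N -> beta c y (argl [:: hor E Gam' i y]) = 0.
Proof.
move=> Ny i2; apply: (tilde_annihilates hg mQ tQ hb bH hmu ac (NL Ny) (i := ord0)).
exact: gH'.
Qed.

Let rho' y : N y -> dens E (OV' c) y = rho y.
Proof. by move=> Ny; exact: (dens_unique hproj homega hOV ac ab NS dual epsF hOV' Ny). Qed.

(** In the frame, the new equation differs from the old one only in the coefficients of the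
    connection, because the new Omega^V has the old density; [shift_eq2] then applies. *)
Lemma tilde_eq2 v : kt x * (d10 gt 0 beta c x v - wedge (theta gt OV' QV c x) (beta c x) v) = 0.
Proof.
have [hQ Q0 Q1 QW] := QV_frame hproj ac ab NS dual epsF hOmegaV hQV Nx.
have QW' : QV c x (argl [:: eps o2 x; eps o3 x; eps o4 x]) * dens E (OV' c) x = -1.
  by rewrite rho'// QV_rho.
have [_ H] := eq2_iff oN sE dual comm sG' glin' gV' gH' kt sW' OV_hor' sb (fun i y Ny i2 => beta_hor' Ny i2) Nx hQ Q0 Q1 QW'.
apply: H v => i a i2 a2.
have := shift_eq2 oN sE comm sG sbet srho (fun y Ny => rho_neq0_local Ny) Nx
  (cas \o param c) (vk \o param c) smui jacob_beta inv2_gamma i2 a2.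
have hE : hop E Gam' i (dens E (OV' c)) x = hop E Gam' i rho x.
  by rewrite /hop !(dird_eq oN _ Nx rho').
rewrite /eq2 /inv2 hE (rho' Nx); exact.
Qed.

Lemma tilde_eq3 v : wedge (d01 gt 0 (form0 (tilde_kappa kappa vk cas)) c x) (beta c x) v
  - kt x ^+ 2 * varrho gt OV' K' c x v = 0.
Proof.
have hK' := is_QH_proj hproj homega hg hgt hK.
have [hKx KH Kw] := QH_frame hproj homega ac ab NS dual epsF hgt hK' Nx.
have KH' p u : dotp (hor E Gam' o0 x) u = 0 -> dotp (hor E Gam' o1 x) u = 0 -> K' c x (argl [:: p; u]) = 0.
  by rewrite !hor_tilde//; exact: KH.
have sk := smooth_on_param skappa; have sc := smooth_on_param scas.
have svk := smooth_on_param hvk.1.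
(* The denominator is nonzero on all of [N] and not just at [x], as differentiating the new kappa
   requires. *)
have skt : smooth_on N kt.
  exact: (smoothM oN sk (smoothV oN u0 (smoothB oN (smooth_cst N 1) (smoothM oN sk (smoothB oN svk sc))))).
have [_ H] := eq3_iff oN sE dual comm sG' glin' gV' gH' sW' OV_hor' sb (fun i y Ny i2 => beta_hor' Ny i2)
  skt Nx hKx KH' Kw.
apply: H v; apply: (eq3_cyclic sW' Nx) => p q s hc; rewrite (rho' Nx).
exact: (shift_eq3 oN sE comm sG sbet srho (fun y Ny => rho_neq0_local Ny) Nx sk sc svk
  (smooth_area hproj homega ac ab oN NS) smui jacob_beta inv2_gamma curv_gamma (area_neq0 homega ac ab NS Nx)
  (fun a a2 => dird_area hproj homega ac ab oN NS dual epsF a2 Nx) (fun y Ny => varkappa_frame hvk Ny)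
  casimir_frame u0 hc).
Qed.

End LocalTilde.

(** * From the frame back to the manifold *)

Lemma bicomp0E (R : realType) (n k : nat) (G : 'rV[R]_n -> 'rV[R]_n) (A : alt R n k) v :
  bicomp G 0 A v = A (fun i => G (v i)).
Proof.
rewrite /bicomp (big_pred1 (finset.set0 : {set 'I_k})) => [|S]; last by rewrite /= cards_eq0.
by congr A; apply/funext => i; rewrite finset.in_set0.
Qed.

Lemma smooth_tilde_kappa (R : realType) (M : manifold R 5) (kappa vk f : M -> R) :
  let U := [set p : M | 1 - kappa p * (vk p - f p) != 0] in
  smooth_fun setT kappa -> smooth_fun setT vk -> smooth_fun setT f ->
  open U /\ smooth_fun U (tilde_kappa kappa vk f).
Proof.
move=> U sk sv sf.
have oU : open U.
  pose u p := 1 - kappa p * (vk p - f p).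
  have cu : continuous u.
    move=> p; apply: cvgB; first exact: cvg_cst.
    by apply: cvgM; [exact: smooth_fun_continuous|apply: cvgB; exact: smooth_fun_continuous].
  have -> : U = u @^-1` [set t | t != 0] by [].
  by apply: open_comp; [move=> p _; exact: cu|exact: open_neq].
split=> // c ac; have oL := open_loc ac oU.
have s g : smooth_fun setT g -> smooth_on (loc U c) (g \o param c).
  by move=> sg; apply: smooth_sub (sg c ac) => y; exact: loc_setT.
have nz y : loc U c y -> 1 - kappa (param c y) * (vk (param c y) - f (param c y)) != 0.
  by move=> /(locP ac)[].
exact: (smoothM oL (s _ sk) (smoothV oL nz (smoothB oL (smooth_cst _ 1)
  (smoothM oL (s _ sk) (smoothB oL (s _ sv) (s _ sf)))))).
Qed.

(** The new equation at [v] is the old one at the new vertical parts of [v]: gamma fixes these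
    vectors, and beta has the same value on them as on [v]. No frame is required. *)
Lemma tilde_eq1 (R : realType) (M : manifold R 5) (B : manifold R 2) (proj : M -> B)
  (gamma : field M ('rV[R]_5 -> 'rV[R]_5)) (QV : field M (alt R 5 3)) (beta mu : field M (alt R 5 1)) :
  connection proj setT gamma -> multivector_field setT QV -> tangent_to_V proj setT QV ->
  diff_form setT beta -> annihilates_H gamma setT beta -> diff_form setT mu ->
  on_charts (setT : set M) (fun c x => forall v, wedge (d01 gamma 0 beta c x) (beta c x) v = 0) ->
  on_charts (setT : set M) (fun c x => forall v,
    wedge (d01 (tilde_connection gamma QV beta mu) 0 beta c x) (beta c x) v = 0).
Proof.
move=> hg hQ tQ hb bH hmu e1 c x ac xc v; set gt := tilde_connection _ _ _ _.
rewrite -(e1 c x ac xc (fun i => gt c x (v i))).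
rewrite /wedge; congr (_ * _); apply: eq_bigr => s _; congr (_ * (_ * _)).
  rewrite /d01 !bicomp0E; congr (ext_diff_field _ _ _); apply/funext => i.
  by rewrite (gamma_tilde hg hQ tQ hb hmu).
rewrite (argl1E (fun j => v _)) (argl1E (fun j => gt c x _)).
by rewrite (beta_tilde hg hQ tQ hb bH hmu).
Qed.

Theorem proposition6p1 (R : realType) (M : manifold R 5) (B : manifold R 2)
  (proj : M -> B) (Omega : field M (alt R 5 5)) (omega : field B (alt R 2 2))
  (hproj : fiber_bundle proj) (hOmega : volume_form Omega)
  (homega : volume_form omega)
  (gamma : field M ('rV[R]_5 -> 'rV[R]_5)) (kappa : M -> R)
  (beta : field M (alt R 5 1))
  (htriple : poisson_triple proj Omega omega setT gamma kappa beta)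
  (OmegaV QV : field M (alt R 5 3))
  (hOmegaV : is_OmegaV proj Omega omega setT gamma OmegaV)
  (hQV : is_QV proj setT OmegaV QV)
  (mu : field M (alt R 5 1)) (hmu : diff_form setT mu)
  (hmuV : annihilates_V proj setT mu)
  (c : M -> R) (hc : smooth_fun setT c) (hcas : casimir gamma beta c)
  (varkappa : M -> R)
  (hvk : is_varkappa proj omega gamma QV beta mu varkappa) :
  let U := [set p : M | 1 - kappa p * (varkappa p - c p) != 0] in
  open U /\
  poisson_triple proj Omega omega U
    (tilde_connection gamma QV beta mu) (tilde_kappa kappa varkappa c) beta.
Proof.
move=> U; have [hg skappa hb bH [OV [QV' [K [hOV hQV' hK [e1 e2 e3]]]]]] := htriple.
have [oU sU] := smooth_tilde_kappa skappa hvk.1 hc.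
have [mQ tQ _] := hQV.
have hgt := tilde_connection_connection hg mQ tQ hb hmu.
have hOVt := is_OmegaV_proj hproj hOmega homega hgt hOV.
have hQVt := is_QV_proj hproj hOmega homega hgt hOV hOmegaV hQV.
have hKt := is_QH_proj hproj homega hg hgt hK.
split; first exact: oU.
split; first exact: connection_sub.
- exact: sU.
- exact: diff_form_sub.
- exact: (on_charts_sub (tilde_annihilates hg mQ tQ hb bH hmu)).
set gt := tilde_connection _ _ _ _.
(* The given [QV] can be kept, as Q_V does not depend on the connection; the other two tensors are
   transported. *)
exists (OVproj gt OV), QV, (QHproj gt K); split.
- have [H1 H2 H3] := hOVt.
  by split; [exact: diff_form_sub|exact: on_charts_sub|exact: on_charts_sub].
- have [H1 H2 H3] := hQVt.
  by split; [exact: multivector_field_sub|exact: on_charts_sub|exact: on_charts_sub].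
- have [H1 H2 H3] := hKt.
  by split; [exact: multivector_field_sub|exact: on_charts_sub|exact: on_charts_sub].
(* The frame is chosen inside [U], so that the denominator of the new kappa has no zero on its
   domain. *)
have loc_frame d x : atlas d -> loc U d x -> exists b N (E eps : 'I_5 -> 'rV[R]_5 -> 'rV[R]_5),
  [/\ open N, N `<=` loc U d, N `<=` locdom proj d b & N x] /\ atlas b /\
  [/\ forall j, smooth_map N (E j), forall j, smooth_map N (eps j),
      forall x, N x -> forall i j, \sum_a eps a x 0 i * E a x 0 j = (i == j)%:R,
      forall x, N x -> forall i j, lie (E i) (E j) x = 0 &
      forall x v, N x -> dotp v (eps o0 x) = (v *m 'J (locproj proj d b) x) 0 ord0 /\
                         dotp v (eps o1 x) = (v *m 'J (locproj proj d b) x) 0 ord_max].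
  move=> ad xU; have [ab xb] := mem_locdom proj ad (loc_setT xU).
  have [N [E [eps [H1 H2]]]] := local_frame hproj ad ab (open_loc ad oU) xU xb.
  by exists (chart_at (proj (param d x))), N, E, eps; split.
have nz d y : atlas d -> loc U d y ->
    1 - kappa (param d y) * (varkappa (param d y) - c (param d y)) != 0.
  by move=> ad /(locP ad)[].
split.
- exact: (on_charts_sub (tilde_eq1 hg mQ tQ hb bH hmu e1)).
- move=> d x ad xU v.
  have [b [N [E [eps [[oN NU NS Nx] [ab [sE seps dual comm epsF]]]]]]] := loc_frame d x ad xU.
  exact: (tilde_eq2 hproj hOmega homega hg hb bH hOmegaV hQV hOV hmu hmuV ad ab oN NS sE seps dual
    comm epsF c varkappa hQV' e1 e2 Nx v).
- move=> d x ad xU v.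
  have [b [N [E [eps [[oN NU NS Nx] [ab [sE seps dual comm epsF]]]]]]] := loc_frame d x ad xU.
  exact: (tilde_eq3 hproj hOmega homega hg hb bH hOmegaV hQV hOV hmu hmuV ad ab oN NS sE seps dual
    comm epsF hQV' hK skappa hc e1 e2 e3 hcas hvk (fun y Ny => nz d y ad (NU y Ny)) Nx v).
Qed.
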